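(* Let $\varphi$ be an analytic self-map of the unit disc $\mathbb{D}$ and $C_\varphi$ the composition operator on $H^2$. (a) Let $B$ be an arbitrary finite Blaschke product of degree $n-1$ and let $0<r<1$. Then \[ a_n(C_\varphi)\le\Big(\sup_{z\in\mathbb{T}:\,|\varphi(z)|\le r}|B(\varphi(z))|^2\,\|C_\varphi\|^2+\|\mu_{\varphi,r}\|_{\mathcal C}\Big)^{1/2}. \] (b) Let $Z=(z_j)_{j=1}^n$ be a finite sequence of $n$ distinct points of $\mathbb{D}$ such that the images $\varphi(Z)=(\varphi(z_j))_{j=1}^n$ are also $n$ distinct points. Then \[ a_n(C_\varphi)\ge [M(\varphi(Z))]^{-1}\,\|\upsilon_Z\|_{\mathcal C}^{-1/2}\inf_{1\le j\le n}\Big(\frac{1-|z_j|^2}{1-|\varphi(z_j)|^2}\Big)^{1/2}. \]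
   Context: $H^2$ is the Hardy space of $\mathbb{D}$, $C_\varphi f=f\circ\varphi$, $a_n(T)$ the $n$th approximation number (distance in operator norm from $T$ to operators of rank $<n$). On $\mathbb{T}$, $\varphi(z)$ denotes radial boundary values (defined a.e.). A finite Blaschke product of degree $n-1$ is $B(z)=z^m\prod_{j=1}^{n-m-1}\frac{z_j-z}{1-\overline{z_j}z}$ with $0\le m\le n-1$ and not necessarily distinct $z_j\in\mathbb{D}\setminus\{0\}$. For a nonnegative Borel measure $\mu$ on $\overline{\mathbb{D}}$, $\|\mu\|_{\mathcal C}$ is the smallest $K$ with $\int|f|^2d\mu\le K\|f\|_{H^2}^2$ for all $f\in H^2$ ($=\infty$ if none exists). With $\sigma$ normalized Lebesgue measure on $\mathbb{T}$, $\mu_{\varphi,r}(E):=\sigma(\{z\in\mathbb{T}:|\varphi(z)|>r,\ \varphi(z)\in E\})$. For a sequence $Z=(z_j)$, $\upsilon_Z:=\sum_j(1-|z_j|^2)\delta_{z_j}$. For a finite sequence $W=(w_j)$ of distinct points, $M(W)$ (the constant of interpolation) is the smallest $C$ such that every interpolation problem $f(w_j)=a_j$ has a solution $f\in H^2$ with $\|f\|_{H^2}\le C(\sum_j|a_j|^2(1-|w_j|^2))^{1/2}$. *)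

(* Defs.v *)
From HB Require Import structures.
From mathcomp Require Import all_boot all_order all_algebra.
From mathcomp Require Import all_classical all_reals all_analysis.
From mathcomp Require Import complex.

Set Implicit Arguments.
Unset Strict Implicit.
Unset Printing Implicit Defensive.

Import Order.TTheory GRing.Theory Num.Theory.
Import numFieldNormedType.Exports.

Local Open Scope classical_set_scope.
Local Open Scope ring_scope.

Section Hardy.
Variable R : realType.
Local Notation C := R[i].

Definition cabs (z : C) : R := let: Complex a b := z in Num.sqrt (a ^+ 2 + b ^+ 2).

Definition inD (z : C) : Prop := cabs z < 1.

(* e^{it}; the unit circle T is parametrized by t in [0, 2 pi) *)
Definition expi (t : R) : C := Complex (cos t) (sin t).

Definition rsc (r : R) (z : C) : C := Complex r 0 * z.

Definition cconv (u : nat -> C) (l : C) : Prop :=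
  (fun N => cabs (u N - l)) @ \oo --> (0 : R).

Definition taylor_on_D (a : nat -> C) (f : C -> C) : Prop :=
  forall z, inD z -> cconv (fun N => \sum_(k < N) a k * z ^+ k) (f z).

Definition analytic_D (f : C -> C) : Prop := exists a, taylor_on_D a f.

Definition selfmap_D (phi : C -> C) : Prop :=
  analytic_D phi /\ forall z, inD z -> inD (phi z).

Definition int_mean2 (f : C -> C) (r : R) : \bar R :=
  ((2 * pi)^-1)%R%:E *
  (\int[lebesgue_measure]_(t in `[0%R, (2 * pi)%R]) ((cabs (f (rsc r (expi t)))) ^+ 2)%:E)%E.

Definition H2norm2 (f : C -> C) : \bar R :=
  ereal_sup [set int_mean2 f r | r in `]0, 1[].

Definition inH2 (f : C -> C) : Prop := analytic_D f /\ (H2norm2 f < +oo)%E.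

Definition radial_lim (f : C -> C) (w : C) (l : C) : Prop :=
  (fun rho : R => cabs (f (rsc rho w) - l)) @ (1 : R)^'- --> (0 : R).

Definition has_radial (f : C -> C) (w : C) : Prop := exists l, radial_lim f w l.

(* radial boundary value (arbitrary, 0, where the limit does not exist) *)
Definition bval (f : C -> C) (w : C) : C := xget 0 [set l | radial_lim f w l].

Definition ext_f (f : C -> C) (w : C) : C :=
  if cabs w < 1 then f w else bval f w.

(* Carleson norm of a nonnegative measure mu, given through the functional
   f |-> int |f|^2 dmu : the smallest K with int |f|^2 dmu <= K ||f||^2
   on H^2, and +oo if there is none *)
Definition carleson_norm (Int2 : (C -> C) -> \bar R) : \bar R :=
  ereal_inf [set K%:E | K in [set K : R | 0 <= K /\
     forall f, inH2 f -> (Int2 f <= K%:E * H2norm2 f)%E]].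

(* int |f|^2 d mu_{phi,r}, where mu_{phi,r}(E) =
   sigma{z in T : |phi(z)| > r, phi(z) in E} (image of sigma restricted to
   {|phi| > r} under the boundary map of phi) *)
Definition mu_phi_r_int2 (phi : C -> C) (r : R) (f : C -> C) : \bar R :=
  ((2 * pi)^-1)%R%:E *
  (\int[lebesgue_measure]_(t in [set t | (`[0%R, (2 * pi)%R[%classic t) /\
          has_radial phi (expi t) /\ (r < cabs (bval phi (expi t)))%R])
      ((cabs (ext_f f (bval phi (expi t)))) ^+ 2)%:E)%E.

(* int |f|^2 d upsilon_Z,  upsilon_Z = sum_j (1 - |z_j|^2) delta_{z_j} *)
Definition upsilon_int2 (n : nat) (Z : 'I_n -> C) (f : C -> C) : \bar R :=
  (\sum_(j < n) (1 - cabs (Z j) ^+ 2) * cabs (f (Z j)) ^+ 2)%:E.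

Definition interp_const (n : nat) (W : 'I_n -> C) : \bar R :=
  ereal_inf [set c%:E | c in [set c : R | 0 <= c /\
     forall a : 'I_n -> C, exists f, inH2 f /\ (forall j, f (W j) = a j) /\
       (H2norm2 f <= (c ^+ 2 * \sum_(j < n) cabs (a j) ^+ 2 * (1 - cabs (W j) ^+ 2))%:E)%E]].

(* operators on H^2, acting on functions (only values on D matter) *)
Definition Op := (C -> C) -> (C -> C).

Definition Cop (phi : C -> C) : Op := fun f => f \o phi.

Definition opnorm (T : Op) : \bar R :=
  sqrte (ereal_sup [set H2norm2 (T f) | f in [set f | inH2 f /\ (H2norm2 f <= 1)%E]]).

Definition rank_lt (n : nat) (Rk : Op) : Prop :=
  (forall f g, inH2 f -> inH2 g -> forall z, inD z ->
      Rk (fun w => f w + g w) z = Rk f z + Rk g z) /\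
  (forall (c : C) f, inH2 f -> forall z, inD z ->
      Rk (fun w => c * f w) z = c * Rk f z) /\
  exists g : 'I_n.-1 -> (C -> C), (forall i, inH2 (g i)) /\
    forall f, inH2 f -> exists c : 'I_n.-1 -> C,
      forall z, inD z -> Rk f z = \sum_(i < n.-1) c i * g i z.

Definition approx_num (n : nat) (T : Op) : \bar R :=
  ereal_inf [set opnorm (fun f z => T f z - Rk f z) | Rk in [set Rk | rank_lt n Rk]].

Definition blaschke (m : nat) (w : seq C) (z : C) : C :=
  z ^+ m * \prod_(a <- w) ((a - z) / (1 - conjc a * z)).

Definition is_blaschke (d : nat) (B : C -> C) : Prop :=
  exists (m : nat) (w : seq C), (m + size w)%N = d /\
    (forall a, a \in w -> inD a /\ a != 0) /\ B = blaschke m w.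

End Hardy.

(* Main.v *)
Require Import Defs.
From HB Require Import structures.
From mathcomp Require Import all_boot all_order all_algebra.
From mathcomp Require Import all_classical all_reals all_analysis.
From mathcomp Require Import measurable_realfun complex.
From mathcomp Require Import ring lra.
Set Implicit Arguments.
Unset Strict Implicit.
Unset Printing Implicit Defensive.
Import Order.TTheory GRing.Theory Num.Theory.
Import numFieldNormedType.Exports.
Import Normc.
Local Open Scope classical_set_scope.
Local Open Scope ring_scope.

(* (a) A function of H^2 is [sum_(i < n-1) c_i e_i + B g] with [|g| <= |f|] and
   [c_i] linear in [f]; this is obtained by dividing out the zeros of [B] one at
   a time on Taylor coefficients.  Then [f o phi] differs by an operator of rank
   less than [n] from [(B o phi) (g o phi)], whose norm is the L^2 norm of its
   boundary values, and the circle splits into [|phi| <= r] and [|phi| > r].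
   The estimate is first made for polynomials [g], which extend continuously to
   the closed disc, so that only [phi] needs boundary values; their existence
   almost everywhere (Fatou) comes from the Hardy-Littlewood maximal inequality,
   since the Poisson kernel is decreasing.
   (b) For [R] of rank less than [n] some nonzero [v] annihilates all vectors
   [(R f (z_j))_j], so [sum_j v_j (f o phi - R f)(z_j) = sum_j v_j f(w_j)]. The
   left-hand side is bounded through the Carleson norm, and [f] is chosen by
   interpolation to make the right-hand side large. *)

(** Norms are computed on Taylor coefficients: by Parseval on circles, [H2norm2 f <= M] says that
    all partial sums of [|a_k|^2] are at most [M], so no infinite sum is ever formed. The obstacle
    that shapes both parts is composition: for a polynomial [p], analyticity of [p o phi] and the
    value of [p] at unimodular boundary points of [phi] are immediate, for a general member of [H^2]
    they are not. So [f] or [g] is truncated, which does not increase the norm, and only the final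
    inequality passes to the limit: by Fatou on a fixed circle in (a), at the [n] points [w_j] in
    (b). In (a) the division does not increase the norm because the part split off at a zero [alpha]
    is the orthogonal projection onto the Szego kernel at [alpha]. In (b) [rank_lt] contains no
    continuity, so [R f] cannot be reached as a limit of [R p_N]; but [v] annihilates [R p_N] for
    every [N], and [R f] never occurs. The Cauchy-Schwarz step of (b) is a weighted inequality
    between arithmetic and geometric means whose weight lets half of the left-hand side absorb one
    of the two terms. *)

Local Notation Re := complex.Re.
Local Notation Im := complex.Im.

(** * Absolute value and limits in R[i] *)

Section ComplexAbs.
Variable R : realType.
Local Notation C := R[i].
Implicit Types (z w : C) (x : R).

Lemma cabsE z : cabs z = normc z. Proof. by case: z. Qed.

Lemma cabs0 : cabs (0 : C) = 0. Proof. by rewrite cabsE normc0. Qed.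
Lemma cabs1 : cabs (1 : C) = 1. Proof. by rewrite cabsE normc1. Qed.

Lemma cabs_ge0 z : 0 <= cabs z. Proof. by case: z => a b; exact: sqrtr_ge0. Qed.

Lemma cabsM z w : cabs (z * w) = cabs z * cabs w.
Proof. by rewrite !cabsE normcM. Qed.

Lemma cabsV z : cabs z^-1 = (cabs z)^-1. Proof. by rewrite !cabsE normcV. Qed.

Lemma cabsN z : cabs (- z) = cabs z.
Proof. by case: z => a b /=; rewrite !sqrrN. Qed.

Lemma cabs_distC z w : cabs (z - w) = cabs (w - z).
Proof. by rewrite -cabsN opprB. Qed.

Lemma cabsD z w : cabs (z + w) <= cabs z + cabs w.
Proof. by rewrite !cabsE; exact: le_normcD. Qed.

Lemma cabsX z n : cabs (z ^+ n) = cabs z ^+ n.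
Proof. by elim: n => [|n ih]; rewrite ?expr0 ?cabs1// !exprS cabsM ih. Qed.

Lemma cabs_sum (I : Type) (s : seq I) (P : pred I) (F : I -> C) :
  cabs (\sum_(i <- s | P i) F i) <= \sum_(i <- s | P i) cabs (F i).
Proof.
elim/big_ind2 : _ => [|x y z w xy zw|//]; first by rewrite cabs0.
by rewrite (le_trans (cabsD _ _))// lerD.
Qed.

Lemma cabs_eq0 z : (cabs z == 0) = (z == 0).
Proof.
apply/eqP/eqP => [|->]; last exact: cabs0.
by rewrite cabsE; exact: eq0_normc.
Qed.

Lemma cabs_gt0 z : (0 < cabs z) = (z != 0).
Proof. by rewrite lt_neqAle cabs_ge0 andbT eq_sym cabs_eq0. Qed.

Lemma cabs_sqr z : cabs z ^+ 2 = Re z ^+ 2 + Im z ^+ 2.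
Proof. by case: z => a b /=; rewrite sqr_sqrtr// addr_ge0// sqr_ge0. Qed.

Lemma mul_conjc z : z * conjc z = Complex (cabs z ^+ 2) 0.
Proof.
rewrite cabs_sqr; case: z => a b; apply/eqP; rewrite eq_complex/=.
by apply/andP; split; apply/eqP; ring.
Qed.

Lemma cabs_conjc z : cabs (conjc z) = cabs z.
Proof. by case: z => a b /=; rewrite sqrrN. Qed.

Lemma cabs_real x : cabs (Complex x 0) = `|x|.
Proof. by rewrite /cabs expr0n/= addr0 sqrtr_sqr. Qed.

Lemma cabs_expi x : cabs (expi x) = 1.
Proof. by rewrite /= cos2Dsin2 sqrtr1. Qed.

Lemma cabs_rsc x z : cabs (rsc x z) = `|x| * cabs z.
Proof. by rewrite /rsc cabsM cabs_real. Qed.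

Lemma inD_rsc_expi x t : 0 <= x < 1 -> inD (rsc x (expi t)).
Proof.
by move=> /andP[x0 x1]; rewrite /inD cabs_rsc cabs_expi mulr1 ger0_norm.
Qed.

Lemma normr_Re_le z : `|Re z| <= cabs z.
Proof.
rewrite -(ler_pXn2r (_ : 0 < 2)%N) ?nnegrE ?cabs_ge0// real_normK ?num_real//.
by rewrite cabs_sqr lerDl sqr_ge0.
Qed.

Lemma normr_Im_le z : `|Im z| <= cabs z.
Proof.
rewrite -(ler_pXn2r (_ : 0 < 2)%N) ?nnegrE ?cabs_ge0// real_normK ?num_real//.
by rewrite cabs_sqr lerDr sqr_ge0.
Qed.

Lemma cabs_le_ReIm z : cabs z <= `|Re z| + `|Im z|.
Proof.
rewrite -(ler_pXn2r (_ : 0 < 2)%N) ?nnegrE ?cabs_ge0 ?addr_ge0//.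
rewrite cabs_sqr sqrrD !real_normK ?num_real//.
by rewrite -addrA lerD2l lerDr mulrn_wge0// mulr_ge0.
Qed.

Lemma lerB_cabs z w : cabs z - cabs w <= cabs (z - w).
Proof. by rewrite lerBlDr (le_trans _ (cabsD _ _))// subrK. Qed.

Lemma ler_dist_cabs z w : `|cabs z - cabs w| <= cabs (z - w).
Proof.
by rewrite ler_norml lerB_cabs lerNl opprB cabs_distC lerB_cabs.
Qed.

Lemma cReD z w : Re (z + w) = Re z + Re w. Proof. by case: z w => ? ? []. Qed.
Lemma cImD z w : Im (z + w) = Im z + Im w. Proof. by case: z w => ? ? []. Qed.
Lemma cReN z : Re (- z) = - Re z. Proof. by case: z. Qed.
Lemma cImN z : Im (- z) = - Im z. Proof. by case: z. Qed.
Lemma cReM z w : Re (z * w) = Re z * Re w - Im z * Im w.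
Proof. by case: z w => ? ? []. Qed.
Lemma cImM z w : Im (z * w) = Re z * Im w + Im z * Re w.
Proof. by case: z w => ? ? []. Qed.
Lemma cReV z : Re z^-1 = Re z / (Re z ^+ 2 + Im z ^+ 2).
Proof. by case: z. Qed.
Lemma cImV z : Im z^-1 = - (Im z / (Re z ^+ 2 + Im z ^+ 2)).
Proof. by case: z => a b; rewrite /=/GRing.inv/=. Qed.

Lemma Re_sum (I : Type) (s : seq I) (P : pred I) (F : I -> C) :
  Re (\sum_(i <- s | P i) F i) = \sum_(i <- s | P i) Re (F i).
Proof. by elim/big_ind2 : _ => // x y z w <- <-; rewrite cReD. Qed.

Lemma Im_sum (I : Type) (s : seq I) (P : pred I) (F : I -> C) :
  Im (\sum_(i <- s | P i) F i) = \sum_(i <- s | P i) Im (F i).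
Proof. by elim/big_ind2 : _ => // x y z w <- <-; rewrite cImD. Qed.

Lemma complex_ext z w : Re z = Re w -> Im z = Im w -> z = w.
Proof. by case: z w => a b [c d] /= -> ->. Qed.

Lemma cabs_unit_Re z : exists w, cabs w = 1 /\ Re (w * z) = cabs z.
Proof.
have [->|z0] := eqVneq z 0; first by exists 1; rewrite cabs1 mulr0 cabs0.
exists (conjc z / Complex (cabs z) 0); split.
  rewrite cabsM cabsV cabs_real cabs_conjc ger0_norm ?cabs_ge0//.
  by rewrite divff// cabs_eq0.
rewrite mulrAC [_ * z]mulrC mul_conjc cReM cReV cImV /=.
rewrite mul0r subr0 expr0n/= addr0.
have c0 : cabs z != 0 by rewrite cabs_eq0.
by field.
Qed.

Lemma expi_powE x n : expi x ^+ n = expi (n%:R * x).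
Proof.
elim: n => [|n ih]; first by rewrite expr0 mul0r /expi cos0 sin0.
rewrite exprS ih (_ : n.+1%:R * x = x + n%:R * x); last by rewrite -natr1; ring.
by apply: complex_ext; rewrite ?cReM ?cImM /= ?cosD// sinD addrC.
Qed.

Lemma expiD x y : expi (x + y) = expi x * expi y.
Proof.
by apply: complex_ext; rewrite ?cReM ?cImM /= ?cosD// sinD addrC.
Qed.

Lemma rscX x z n : rsc x z ^+ n = rsc (x ^+ n) (z ^+ n).
Proof.
rewrite /rsc exprMn; congr (_ * _).
elim: n => [//|n ih]; rewrite !exprS ih; apply: complex_ext; rewrite ?cReM ?cImM/=; ring.
Qed.

End ComplexAbs.

Section ComplexLimits.
Variable R : realType.
Local Notation C := R[i].

(** With [\oo] or the left neighbourhoods of 1 as [F], this unfolds to [cconv] or [radial_lim], so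
    one calculus serves Taylor sums and radial limits. *)
Definition ccv T (F : set_system T) (f : T -> C) (l : C) : Prop :=
  (fun x => cabs (f x - l)) @ F --> (0 : R).

Section filter.
Context {T : Type} {F : set_system T} {FF : ProperFilter F}.
Implicit Types f g : T -> C.

Lemma ccvP f l : ccv F f l <->
  ((fun x => Re (f x)) @ F --> Re l) /\ ((fun x => Im (f x)) @ F --> Im l).
Proof.
split=> [fl|[fr fi]].
  split; apply/cvgrPdist_le => e e0; move/cvgrPdist_le : fl => /(_ _ e0).
    apply: filterS => x; rewrite sub0r normrN ger0_norm ?cabs_ge0//.
    by apply: le_trans; rewrite cabs_distC -cReN -cReD normr_Re_le.
  apply: filterS => x; rewrite sub0r normrN ger0_norm ?cabs_ge0//.
  by apply: le_trans; rewrite cabs_distC -cImN -cImD normr_Im_le.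
apply: (@squeeze_cvgr _ _ _ _ (cst 0)
  (fun x => `|Re l - Re (f x)| + `|Im l - Im (f x)|)).
- near=> x; rewrite cabs_ge0/= cabs_distC (le_trans (cabs_le_ReIm _))//.
  by rewrite cReD cImD cReN cImN.
- exact: cvg_cst.
- have -> : (0 : R) = `|Re l - Re l| + `|Im l - Im l|.
    by rewrite !subrr normr0 addr0.
  by apply: cvgD; apply: cvg_norm; apply: cvgB => //; exact: cvg_cst.
Unshelve. all: by end_near. Qed.

Lemma ccv_cst c : ccv F (fun=> c) c.
Proof. by rewrite /ccv subrr cabs0; exact: cvg_cst. Qed.

Lemma ccvD f g a b : ccv F f a -> ccv F g b -> ccv F (fun x => f x + g x) (a + b).
Proof.
move=> /ccvP[fr fi] /ccvP[gr gi]; apply/ccvP; rewrite cReD cImD.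
split.
  by under eq_fun do rewrite cReD; exact: cvgD.
by under eq_fun do rewrite cImD; exact: cvgD.
Qed.

Lemma ccvN f a : ccv F f a -> ccv F (fun x => - f x) (- a).
Proof.
move=> /ccvP[fr fi]; apply/ccvP; rewrite cReN cImN.
split.
  by under eq_fun do rewrite cReN; exact: cvgN.
by under eq_fun do rewrite cImN; exact: cvgN.
Qed.

Lemma ccvB f g a b : ccv F f a -> ccv F g b -> ccv F (fun x => f x - g x) (a - b).
Proof. by move=> fa gb; apply: ccvD => //; exact: ccvN. Qed.

Lemma ccvM f g a b : ccv F f a -> ccv F g b -> ccv F (fun x => f x * g x) (a * b).
Proof.
move=> /ccvP[fr fi] /ccvP[gr gi]; apply/ccvP; rewrite cReM cImM.
split.
  by under eq_fun do rewrite cReM; apply: cvgB; exact: cvgM.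
by under eq_fun do rewrite cImM; apply: cvgD; exact: cvgM.
Qed.

Lemma ccvX f a n : ccv F f a -> ccv F (fun x => f x ^+ n) (a ^+ n).
Proof.
move=> fa; elim: n => [|n ih]; first exact: ccv_cst.
rewrite exprS; under eq_fun do rewrite exprS; exact: ccvM.
Qed.

Lemma ccv_sum (I : Type) (s : seq I) (P : pred I) (f : I -> T -> C) (a : I -> C) :
  (forall i, ccv F (f i) (a i)) ->
  ccv F (fun x => \sum_(i <- s | P i) f i x) (\sum_(i <- s | P i) a i).
Proof.
move=> fa; elim: s => [|i s ih].
  by rewrite big_nil; under eq_fun do rewrite big_nil; exact: ccv_cst.
rewrite big_cons; under eq_fun do rewrite big_cons.
by case: (P i) => //; exact: ccvD.
Qed.

Lemma ccv_horner f a (p : {poly C}) : ccv F f a -> ccv F (fun x => p.[f x]) p.[a].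
Proof.
move=> fa; rewrite horner_coef; under eq_fun do rewrite horner_coef.
by apply: ccv_sum => i; apply: ccvM; [exact: ccv_cst|exact: ccvX].
Qed.

Lemma ccv_cabs f a : ccv F f a -> (fun x => cabs (f x)) @ F --> cabs a.
Proof.
move=> fa; apply/cvgrPdist_le => e e0; move/cvgrPdist_le : fa => /(_ _ e0).
apply: filterS => x; rewrite sub0r normrN ger0_norm ?cabs_ge0//.
by apply: le_trans; rewrite distrC ler_dist_cabs.
Qed.

Lemma ccv_cabs2 f a : ccv F f a -> (fun x => cabs (f x) ^+ 2) @ F --> cabs a ^+ 2.
Proof.
by move=> /ccv_cabs fa; under eq_fun do rewrite expr2; rewrite expr2; exact: cvgM.
Qed.

Lemma ccv_unique f a b : ccv F f a -> ccv F f b -> a = b.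
Proof.
move=> /ccvP[ar ai] /ccvP[br bi]; apply: complex_ext.
  exact: (cvg_unique (@norm_hausdorff _ R) ar br).
exact: (cvg_unique (@norm_hausdorff _ R) ai bi).
Qed.

Lemma ccv_ext f g a : f =1 g -> ccv F f a -> ccv F g a.
Proof. by move=> /funext ->. Qed.

Lemma ccv_near f g a : (\forall x \near F, f x = g x) -> ccv F f a -> ccv F g a.
Proof.
move=> fg; apply: cvg_trans; apply: near_eq_cvg.
by apply: filterS fg => x ->.
Qed.

End filter.

End ComplexLimits.

(** * Integrals of squared moduli *)

Section SquareIntegrals.
Variable R : realType.
Local Notation C := R[i].
Local Notation mu := (@lebesgue_measure R).
Implicit Types (D : set R) (f g : R -> C).

Definition cmeas D f : Prop :=
  measurable_fun D (fun t => Re (f t)) /\ measurable_fun D (fun t => Im (f t)).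

Lemma cmeas_cst D c : cmeas D (fun=> c).
Proof. by split; exact: measurable_cst. Qed.

Lemma cmeasD D f g : cmeas D f -> cmeas D g -> cmeas D (fun t => f t + g t).
Proof.
move=> [fr fi] [gr gi]; split.
  by under eq_fun do rewrite cReD; exact: measurable_funD.
by under eq_fun do rewrite cImD; exact: measurable_funD.
Qed.

Lemma cmeasM D f g : cmeas D f -> cmeas D g -> cmeas D (fun t => f t * g t).
Proof.
move=> [fr fi] [gr gi]; split.
  by under eq_fun do rewrite cReM; apply: measurable_funB; exact: measurable_funM.
by under eq_fun do rewrite cImM; apply: measurable_funD; exact: measurable_funM.
Qed.

Lemma cmeasX D f n : cmeas D f -> cmeas D (fun t => f t ^+ n).
Proof.
move=> mf; elim: n => [|n ih]; first exact: cmeas_cst.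
by under eq_fun do rewrite exprS; exact: cmeasM.
Qed.

Lemma cmeas_sum D (n : nat) (f : nat -> R -> C) :
  (forall i, cmeas D (f i)) -> cmeas D (fun t => \sum_(i < n) f i t).
Proof.
move=> mf; elim: n => [|n ih].
  by under eq_fun do rewrite big_ord0; exact: cmeas_cst.
by under eq_fun do rewrite big_ord_recr/=; exact: cmeasD.
Qed.

Lemma cmeas_horner D f (p : {poly C}) : cmeas D f -> cmeas D (fun t => p.[f t]).
Proof.
move=> mf; under eq_fun do rewrite horner_coef.
apply: (@cmeas_sum D _ (fun i t => p`_i * f t ^+ i)) => i.
by apply: cmeasM; [exact: cmeas_cst|exact: cmeasX].
Qed.

Lemma cmeas_lim D (f : nat -> R -> C) g : (forall n, cmeas D (f n)) ->
  (forall t, D t -> ccv \oo (f ^~ t) (g t)) -> cmeas D g.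
Proof.
move=> mf fg; split.
  apply: (@measurable_realfun.measurable_fun_cvg _ _ _ _ (fun n t => Re (f n t))).
    by move=> n; case: (mf n).
  by move=> t /fg/ccvP[].
apply: (@measurable_realfun.measurable_fun_cvg _ _ _ _ (fun n t => Im (f n t))).
  by move=> n; case: (mf n).
by move=> t /fg/ccvP[].
Qed.

Lemma cmeas_expi D : cmeas D (@expi R).
Proof.
split; apply: measurable_funTS; apply: continuous_measurable_fun.
  exact: continuous_cos.
exact: continuous_sin.
Qed.

Lemma cmeas_sub D D' f : measurable D -> D' `<=` D -> cmeas D f -> cmeas D' f.
Proof. by move=> mD DD' [fr fi]; split; exact: measurable_funS fr || exact: measurable_funS fi. Qed.

Lemma measurable_cabs2 D f : cmeas D f ->
  measurable_fun D (fun t => cabs (f t) ^+ 2).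
Proof.
move=> [fr fi]; under eq_fun do rewrite cabs_sqr.
by apply: measurable_funD; exact: measurable_funX.
Qed.

Lemma measurable_cabs2E D f : cmeas D f ->
  measurable_fun D (fun t => (cabs (f t) ^+ 2)%:E).
Proof. by move=> mf; apply/measurable_EFinP; exact: measurable_cabs2. Qed.

Definition sqint D f : \bar R := (\int[mu]_(t in D) (cabs (f t) ^+ 2)%:E)%E.

Lemma sqint_ge0 D f : (0 <= sqint D f)%E.
Proof. by apply: integral_ge0 => t _; rewrite lee_fin sqr_ge0. Qed.

Lemma sqint_dominated D (f : nat -> R -> C) g (K : R) : measurable D ->
  (mu D < +oo)%E -> (forall n, cmeas D (f n)) ->
  (forall t, D t -> ccv \oo (f ^~ t) (g t)) ->
  (forall n t, D t -> cabs (f n t) <= K) ->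
  (fun n => sqint D (f n)) @ \oo --> sqint D g.
Proof.
move=> mD fD mf fg fK.
have mg : cmeas D g by exact: cmeas_lim mf fg.
have [] // := @dominated_convergence _ _ R mu D mD
  (fun n t => (cabs (f n t) ^+ 2)%:E) (fun t => (cabs (g t) ^+ 2)%:E)
  (cst (K ^+ 2)%:E).
- by move=> n; exact: measurable_cabs2E.
- exact: measurable_cabs2E.
- apply: aeW => t Dt; apply: cvg_EFin; first exact: nearW.
  exact: ccv_cabs2 (fg _ Dt).
- apply/integrableP; split; first exact: measurable_cst.
  rewrite (eq_integral (cst (K ^+ 2)%:E)); last first.
    by move=> t _; rewrite gee0_abs ?lee_fin ?sqr_ge0.
  rewrite integral_cst//.
  by rewrite lte_mul_pinfty ?lee_fin ?sqr_ge0.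
- apply: aeW => t n Dt; rewrite gee0_abs ?lee_fin ?sqr_ge0//.
  rewrite ler_pXn2r ?nnegrE ?cabs_ge0 ?fK//.
  exact: le_trans (cabs_ge0 _) (fK n _ Dt).
Qed.

Lemma sqint_fatou D (f : nat -> R -> C) g (V : \bar R) : measurable D ->
  (forall n, cmeas D (f n)) ->
  (forall t, D t -> ccv \oo (f ^~ t) (g t)) ->
  (forall n, sqint D (f n) <= V)%E -> (sqint D g <= V)%E.
Proof.
move=> mD mf fg fV.
have /le_trans := @fatou _ _ R mu D mD (fun n t => (cabs (f n t) ^+ 2)%:E)
  (fun n => measurable_cabs2E (mf n)) (fun n t _ => sqr_ge0 (cabs (f n t))).
have -> : (\int[mu]_(x in D) limn_einf (fun n => (cabs (f n x) ^+ 2)%:E))%E =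
    sqint D g.
  apply: eq_integral => t; rewrite inE => Dt.
  have h : (fun n => (cabs (f n t) ^+ 2)%:E) @ \oo --> (cabs (g t) ^+ 2)%:E.
    by apply: cvg_EFin; [exact: nearW|exact: ccv_cabs2 (fg _ Dt)].
  by rewrite is_cvg_limn_einfE; [exact/cvg_lim|apply/cvg_ex; eexists; exact: h].
apply; rewrite limn_einf_lim; apply: lime_le; first exact: is_cvg_einfs.
apply: nearW => n; apply: le_trans (fV n); apply: ereal_inf_lbound.
by exists n => //=.
Qed.

Lemma le_sqint D f g : measurable D -> cmeas D f -> cmeas D g ->
  (forall t, D t -> cabs (f t) <= cabs (g t)) -> (sqint D f <= sqint D g)%E.
Proof.
move=> mD mf mg fg; apply: ge0_le_integral => //.
- by move=> t _; rewrite lee_fin sqr_ge0.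
- exact: measurable_cabs2E.
- exact: measurable_cabs2E.
- by move=> t Dt; rewrite lee_fin ler_pXn2r ?nnegrE ?cabs_ge0 ?fg.
Qed.

Lemma eq_sqint D f g : (forall t, D t -> cabs (f t) = cabs (g t)) ->
  sqint D f = sqint D g.
Proof. by move=> fg; apply: eq_integral => t; rewrite inE => /fg ->. Qed.

(* No measurability is needed: the integral of a nonnegative function is a
   supremum over simple functions lying below it. *)
Lemma le_sqint_subset D D' f g : D `<=` D' ->
  (forall t, D t -> cabs (f t) <= cabs (g t)) -> (sqint D f <= sqint D' g)%E.
Proof.
move=> DD' fg; rewrite /sqint.
have f0 (h : R -> C) E t : E t -> (0 <= (cabs (h t) ^+ 2)%:E)%E.
  by move=> _; rewrite lee_fin sqr_ge0.
have /= -> := ge0_integralE mu (f0 f D); have /= -> := ge0_integralE mu (f0 g D').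
apply: le_ereal_sup => _ [h /= hf <-]; exists h => //= t.
apply: le_trans (hf t) _; rewrite /patch; case: ifPn => [|_].
  rewrite inE => Dt; rewrite ifT ?inE; last exact: DD'.
  by rewrite lee_fin ler_pXn2r ?nnegrE ?cabs_ge0 ?fg.
by case: ifP => // _; rewrite lee_fin sqr_ge0.
Qed.

End SquareIntegrals.

(** * Trigonometric polynomials *)

Section TrigonometricPrimitives.
Variable R : realType.
Local Notation C := R[i].
Local Notation mu := (@lebesgue_measure R).

Lemma is_derive_mulr (m t : R) : is_derive t 1 (fun x : R => m * x) m.
Proof.
have := @is_deriveZ R R R id m t 1 1 (@is_derive_id _ _ _ _).
by move/is_derive_eq; apply; rewrite /GRing.scale/= mulr1.
Qed.

Lemma is_derive_sinM (m t : R) :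
  is_derive t 1 (fun x => sin (m * x)) (m * cos (m * t)).
Proof.
have := is_derive1_comp (is_derive_sin (m * t)) (is_derive_mulr m t).
by move/is_derive_eq; apply; rewrite mulrC.
Qed.

Lemma is_derive_cosM (m t : R) :
  is_derive t 1 (fun x => cos (m * x)) (- (m * sin (m * t))).
Proof.
have := is_derive1_comp (is_derive_cos (m * t)) (is_derive_mulr m t).
by move/is_derive_eq; apply; rewrite mulNr mulrC.
Qed.

Lemma is_derive_scaler (f : R -> R) (k t df : R) :
  is_derive t 1 f df -> is_derive t 1 (fun x => k * f x) (k * df).
Proof. by move=> h; exact: (is_deriveZ k h). Qed.

Lemma is_derive_addf (f g : R -> R) (t df dg : R) :
  is_derive t 1 f df -> is_derive t 1 g dg ->
  is_derive t 1 (fun x => f x + g x) (df + dg).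
Proof. by move=> h k; exact: (is_deriveD h k). Qed.

Lemma is_derive_sumf n (f : nat -> R -> R) (t : R) (df : nat -> R) :
  (forall k, is_derive t 1 (f k) (df k)) ->
  is_derive t 1 (fun x => \sum_(k < n) f k x) (\sum_(k < n) df k).
Proof.
move=> h; elim: n => [|n ih].
  rewrite big_ord0 (_ : (fun x => _) = cst 0); first exact: is_derive_cst.
  by apply/funext => x; rewrite big_ord0.
rewrite big_ord_recr (_ : (fun x => _) = fun x => \sum_(k < n) f k x + f n x).
  exact: is_derive_addf.
by apply/funext => x; rewrite big_ord_recr.
Qed.

(** Antiderivatives of [cos (m x)] and [sin (m x)]. In the double sums below [m] is a difference of
    two indices, so the diagonal produces the case [m = 0]. *)
Definition cos_prim (m x : R) : R := if m == 0 then x else m^-1 * sin (m * x).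
Definition sin_prim (m x : R) : R := if m == 0 then 0 else - m^-1 * cos (m * x).

Lemma is_derive_cos_prim (m t : R) : is_derive t 1 (cos_prim m) (cos (m * t)).
Proof.
rewrite /cos_prim; have [->|m0] := eqVneq m 0.
  by rewrite mul0r cos0; exact: is_derive_id.
apply: is_derive_eq (is_derive_scaler m^-1 (is_derive_sinM m t)) _.
by rewrite mulrA mulVf// mul1r.
Qed.

Lemma is_derive_sin_prim (m t : R) : is_derive t 1 (sin_prim m) (sin (m * t)).
Proof.
rewrite /sin_prim; have [->|m0] := eqVneq m 0.
  by rewrite mul0r sin0; exact: is_derive_cst.
apply: is_derive_eq (is_derive_scaler (- m^-1) (is_derive_cosM m t)) _.
by rewrite mulrNN mulrA mulVf// mul1r.
Qed.

Lemma cos_prim0 m : cos_prim m 0 = 0.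
Proof. by rewrite /cos_prim; case: ifP => // _; rewrite mulr0 sin0 mulr0. Qed.

Lemma sin_natpi n : sin (n%:R * pi) = 0 :> R.
Proof.
elim: n => [|n ih]; first by rewrite mul0r sin0.
by rewrite -natr1 mulrDl mul1r sinDpi ih oppr0.
Qed.

Lemma expi_2pi n : expi (n%:R * (2 * pi)) = 1 :> C.
Proof.
rewrite -expi_powE (_ : expi (2 * pi) = 1) ?expr1n//.
by rewrite /expi mulr_natl cos2pi sin2pi.
Qed.

Lemma integral_FTC (F f : R -> R) (a b : R) : a < b -> continuous f ->
  (forall t : R, is_derive t 1 F (f t)) ->
  (\int[mu]_(t in `[a, b]) (f t)%:E = (F b - F a)%:E)%E.
Proof.
move=> ab cf dF; have cF : continuous F.
  move=> t; apply: differentiable_continuous; apply/derivable1_diffP.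
  by case: (dF t).
rewrite (@continuous_FTC2 _ f F a b)//.
- exact: continuous_subspaceT.
- split.
  + by move=> t _; case: (dF t).
  + exact: cvg_at_right_filter (cF a).
  + exact: cvg_at_left_filter (cF b).
- by move=> t _; rewrite derive1E; case: (dF t).
Qed.

Lemma ccv_expi (t : R) : ccv (nbhs t) (@expi R) (expi t).
Proof. by apply/ccvP; split; [exact: continuous_cos|exact: continuous_sin]. Qed.

Definition trigpoly n (c : nat -> C) (t : R) : C := \sum_(k < n) c k * expi t ^+ k.

Lemma ccv_trigpoly n c (t : R) : ccv (nbhs t) (trigpoly n c) (trigpoly n c t).
Proof.
apply: ccv_sum => k; apply: ccvM; first exact: ccv_cst.
by apply: ccvX; exact: ccv_expi.
Qed.

Lemma cmeas_trigpoly D n c : cmeas D (trigpoly n c).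
Proof.
apply: (@cmeas_sum _ D n (fun k t => c k * expi t ^+ k)) => k.
by apply: cmeasM; [exact: cmeas_cst|apply: cmeasX; exact: cmeas_expi].
Qed.

(** [A] and [B] are the real and imaginary parts of [conj (c_j) c_k], the coefficients of the
    expanded square of a trigonometric polynomial. *)
Let A (c : nat -> C) j k : R := Re (c j) * Re (c k) + Im (c j) * Im (c k).
Let B (c : nat -> C) j k : R := Re (c j) * Im (c k) - Im (c j) * Re (c k).

Lemma Re_trigpoly n c t : Re (trigpoly n c t) =
  \sum_(k < n) (Re (c k) * cos (k%:R * t) - Im (c k) * sin (k%:R * t)).
Proof. by rewrite Re_sum; apply: eq_bigr => k _; rewrite expi_powE cReM. Qed.

Lemma Im_trigpoly n c t : Im (trigpoly n c t) =
  \sum_(k < n) (Re (c k) * sin (k%:R * t) + Im (c k) * cos (k%:R * t)).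
Proof. by rewrite Im_sum; apply: eq_bigr => k _; rewrite expi_powE cImM. Qed.

Lemma cabs_trigpoly_sqr n c t : cabs (trigpoly n c t) ^+ 2 =
  \sum_(j < n) \sum_(k < n) (A c j k * cos ((j%:R - k%:R) * t) +
                             B c j k * sin ((j%:R - k%:R) * t)).
Proof.
rewrite cabs_sqr Re_trigpoly Im_trigpoly !expr2 !big_distrlr/= -big_split/=.
apply: eq_bigr => j _; rewrite -big_split/=; apply: eq_bigr => k _.
by rewrite [(_ - _) * t]mulrBl cosB sinB /A /B; ring.
Qed.

(** Parseval over [p + q] full periods: off the diagonal the antiderivatives take equal values at
    both endpoints. The pair (0, 1) gives the circle, and (1, 2) the longer interval on which the
    maximal function is estimated. *)
Lemma sqint_trigpoly_periods p q n c : (0 < p + q)%N ->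
  sqint `[- (p%:R * (2 * pi)), q%:R * (2 * pi)] (trigpoly n c) =
  ((p + q)%:R * (2 * pi) * \sum_(k < n) cabs (c k) ^+ 2)%:E.
Proof.
move=> pq0.
pose F t := \sum_(j < n) \sum_(k < n) (A c j k * cos_prim (j%:R - k%:R) t +
                             B c j k * sin_prim (j%:R - k%:R) t).
transitivity (F (q%:R * (2 * pi)) - F (- (p%:R * (2 * pi))))%:E.
  apply: integral_FTC.
- rewrite -subr_gt0 opprK -mulrDl -natrD mulr_gt0 ?mulr_gt0 ?pi_gt0//.
  by rewrite ltr0n addnC.
- by move=> t; exact: ccv_cabs2 (ccv_trigpoly _ _ _).
- move=> t; rewrite cabs_trigpoly_sqr.
  apply: (@is_derive_sumf n (fun j t => \sum_(k < n) (A c j k *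
    cos_prim (j%:R - k%:R) t + B c j k * sin_prim (j%:R - k%:R) t)) t
    (fun j => \sum_(k < n) (A c j k * cos ((j%:R - k%:R) * t) +
                             B c j k * sin ((j%:R - k%:R) * t)))) => j.
  apply: (@is_derive_sumf n (fun k t => A c j k *
    cos_prim (j%:R - k%:R) t + B c j k * sin_prim (j%:R - k%:R) t) t
    (fun k => A c j k * cos ((j%:R - k%:R) * t) +
              B c j k * sin ((j%:R - k%:R) * t))) => k.
  by apply: is_derive_addf; apply: is_derive_scaler;
    [exact: is_derive_cos_prim|exact: is_derive_sin_prim].
congr EFin; rewrite /F -sumrB mulr_sumr; apply: eq_bigr => j _.
rewrite -sumrB (bigD1 j)//= big1 ?addr0 => [|k kj].
  by rewrite /cos_prim /sin_prim subrr eqxx /A cabs_sqr natrD; ring.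
rewrite /cos_prim /sin_prim subr_eq0 eqr_nat (_ : (j == k :> nat) = false); last first.
  by apply/negbTE; rewrite eq_sym.
(* The frequency [j - k] may be negative, so periodicity is obtained by cancelling [expi] at [k m]
   periods from [expi] at [j m] periods. *)
have e m : expi ((j%:R - k%:R) * (m%:R * (2 * pi))) = 1 :> C.
  have := expi_2pi (k * m); have := expi_2pi (j * m).
  rewrite (_ : (j * m)%:R * _ = (j%:R - k%:R) * (m%:R * (2 * pi))
    + (k * m)%:R * (2 * pi)); last by rewrite !natrM; ring.
  by rewrite expiD => /[swap] ->; rewrite mulr1.
have [cp sp] := e p; have [cq sq] := e q.
by rewrite !mulrN cosN sinN cp sp cq sq; ring.
Qed.

Lemma sqint_trigpoly n c :
  sqint `[0, 2 * pi] (trigpoly n c) = (2 * pi * \sum_(k < n) cabs (c k) ^+ 2)%:E.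
Proof.
by have := @sqint_trigpoly_periods 0 1 n c isT; rewrite mul0r oppr0 !mul1r.
Qed.

End TrigonometricPrimitives.

(** * Power series on the disc *)

Section PowerSeries.
Variable R : realType.
Local Notation C := R[i].
Implicit Types (a b : nat -> C) (f g : C -> C) (z : C).

Definition psum a z N : C := \sum_(k < N) a k * z ^+ k.

Lemma geometric_sum_le (q : R) N : 0 <= q < 1 -> \sum_(k < N) q ^+ k <= (1 - q)^-1.
Proof.
move=> /andP[q0 q1]; have q1' : 0 < 1 - q by rewrite subr_gt0.
rewrite -[leLHS](mulfK (lt0r_neq0 q1')) ler_pdivrMr// mulVf ?gt_eqF//.
rewrite mulrC -[X in X <= _]opprK -mulNr opprB -subrX1 opprB.
by rewrite gerBl exprn_ge0.
Qed.

Definition absconv a : Prop := forall r : R, 0 <= r < 1 ->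
  exists K, forall N, \sum_(k < N) cabs (a k) * r ^+ k <= K.

Lemma absconv_term a (r : R) : absconv a -> 0 <= r < 1 ->
  exists K, forall k, cabs (a k) * r ^+ k <= K.
Proof.
move=> aa /[dup] r01 /aa[K hK]; exists K => k; apply: le_trans (hK k.+1).
rewrite big_ord_recr/= lerDr sumr_ge0// => i _.
by case/andP : r01 => r0 _; rewrite mulr_ge0 ?cabs_ge0 ?exprn_ge0.
Qed.

(** Abel's argument: terms bounded at the intermediate radius [s = (1 + r) / 2] are dominated at [r]
    by a geometric series of ratio [r / s]. *)
Lemma term_absconv a : (forall r : R, 0 <= r < 1 ->
  exists K, forall k, cabs (a k) * r ^+ k <= K) -> absconv a.
Proof.
move=> h r /andP[r0 r1]; pose s := (1 + r) / 2.
have s0 : 0 < s by rewrite /s; lra.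
have s1 : s < 1 by rewrite /s; lra.
have rs : r < s by rewrite /s; lra.
have [K hK] : exists K, forall k, cabs (a k) * s ^+ k <= K.
  by apply: h; rewrite (ltW s0).
have K0 : 0 <= K.
  by apply: le_trans (hK 0%N); rewrite mulr_ge0 ?cabs_ge0 ?exprn_ge0// ltW.
exists (K * (1 - r / s)^-1) => N.
have q01 : 0 <= r / s < 1.
  by rewrite divr_ge0 ?(ltW s0)//= ltr_pdivrMr// mul1r.
apply: (@le_trans _ _ (K * \sum_(k < N) (r / s) ^+ k)); last first.
  by rewrite ler_wpM2l// geometric_sum_le.
rewrite mulr_sumr ler_sum// => k _; rewrite expr_div_n mulrA ler_pdivlMr ?exprn_gt0//.
by rewrite mulrAC ler_wpM2r ?exprn_ge0.
Qed.

Lemma bounded_absconv a (K : R) : (forall k, cabs (a k) <= K) -> absconv a.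
Proof.
move=> aK; apply: term_absconv => r /andP[r0 r1]; exists K => k.
rewrite -[leRHS]mulr1; apply: ler_pM; rewrite ?cabs_ge0 ?exprn_ge0//.
by rewrite exprn_ile1// ltW.
Qed.

(** Convergence at the real point [r] bounds the distances of the partial sums from the limit, and a
    term of the series is the difference of two such errors. *)
Lemma taylor_absconv a f : taylor_on_D a f -> absconv a.
Proof.
move=> af; apply: term_absconv => r /andP[r0 r1].
have rD : inD (Complex r 0) by rewrite /inD cabs_real ger0_norm.
have /cvgP/cvg_seq_bounded[M [_ hM]] := af _ rD.
have {}hM N : cabs (psum a (Complex r 0) N - f (Complex r 0)) <= `|M| + 1.
  have Mlt : M < `|M| + 1 by rewrite (le_lt_trans (ler_norm _))// ltrDl.
  by have := hM _ Mlt N I; rewrite /= ger0_norm ?cabs_ge0.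
exists ((`|M| + 1) + (`|M| + 1)) => k.
rewrite (_ : cabs _ * _ = cabs (a k * Complex r 0 ^+ k)); last first.
  by rewrite cabsM cabsX cabs_real ger0_norm.
rewrite (_ : _ * _ = (psum a (Complex r 0) k.+1 - f (Complex r 0)) -
   (psum a (Complex r 0) k - f (Complex r 0))); last first.
  by rewrite /psum big_ord_recr/=; ring.
by rewrite (le_trans (cabsD _ _))// cabsN lerD.
Qed.

Lemma cabs_psum_le a z (r : R) N : cabs z <= r ->
  cabs (psum a z N) <= \sum_(k < N) cabs (a k) * r ^+ k.
Proof.
move=> zr; rewrite (le_trans (cabs_sum _ _ _))// ler_sum// => k _.
rewrite cabsM cabsX ler_wpM2l ?cabs_ge0// lerXn2r ?nnegrE ?cabs_ge0//.
exact: le_trans (cabs_ge0 z) zr.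
Qed.

Definition evs a z : C :=
  Complex (limn (fun N => Re (psum a z N))) (limn (fun N => Im (psum a z N))).

Lemma is_cvg_sum_le (u v : nat -> R) (K : R) : (forall k, `|u k| <= v k) ->
  (forall N, \sum_(k < N) v k <= K) -> cvgn (fun N => \sum_(k < N) u k).
Proof.
move=> uv vK; rewrite (_ : (fun _ => _) = series u); last first.
  by apply/funext => N; rewrite seriesEnat/= big_mkord.
apply: normed_cvg; apply: nondecreasing_is_cvgn.
  apply/nondecreasing_seqP => n.
  by rewrite /normed_series_of /series/= big_nat_recr//= lerDl.
exists K => _ [N _ <-] /=; rewrite /normed_series_of /series/= big_mkord.
by apply: le_trans (vK N); exact: ler_sum.
Qed.

Lemma taylor_evs a : absconv a -> taylor_on_D a (evs a).
Proof.
move=> aa z zD; have [K hK] := aa (cabs z) (introT andP (conj (cabs_ge0 z) zD)).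
apply/(@ccvP R nat \oo); split => /=.
  under eq_fun do rewrite Re_sum.
  apply: (@is_cvg_sum_le (fun k => Re (a k * z ^+ k))
    (fun k => cabs (a k) * cabs z ^+ k) K) => // k.
  by rewrite -cabsX -cabsM normr_Re_le.
under eq_fun do rewrite Im_sum.
  apply: (@is_cvg_sum_le (fun k => Im (a k * z ^+ k))
    (fun k => cabs (a k) * cabs z ^+ k) K) => // k.
by rewrite -cabsX -cabsM normr_Im_le.
Qed.

Lemma taylor_eq a f g : (forall z, inD z -> f z = g z) ->
  taylor_on_D a f -> taylor_on_D a g.
Proof. by move=> fg h z zD; rewrite -fg//; exact: h. Qed.

Lemma taylor_unique a f g z : taylor_on_D a f -> taylor_on_D a g -> inD z ->
  f z = g z.
Proof. by move=> h k zD; exact: ccv_unique (h _ zD) (k _ zD). Qed.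

Lemma taylorD a b f g : taylor_on_D a f -> taylor_on_D b g ->
  taylor_on_D (fun k => a k + b k) (fun z => f z + g z).
Proof.
move=> h k z zD; apply: (ccv_ext _ (ccvD (h _ zD) (k _ zD))) => N.
rewrite -big_split/=.
by apply: eq_bigr => i _; rewrite mulrDl.
Qed.

Lemma taylorZ c a f : taylor_on_D a f ->
  taylor_on_D (fun k => c * a k) (fun z => c * f z).
Proof.
move=> h z zD; apply: (ccv_ext _ (ccvM (ccv_cst c) (h _ zD))) => N; rewrite mulr_sumr.
by apply: eq_bigr => i _; rewrite mulrA.
Qed.

Definition conv a b n : C := \sum_(i < n.+1) a i * b (n - i)%N.

(** Cauchy product through polynomials: the product of the two truncations at [N] has the
    coefficients of [conv a b] below [N], and its remaining coefficients are at most [K L r^-n] for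
    a radius [r] between [|z|] and 1. *)
Lemma taylorM a b f g : taylor_on_D a f -> taylor_on_D b g ->
  taylor_on_D (conv a b) (fun z => f z * g z).
Proof.
move=> af bg z zD; pose r := (1 + cabs z) / 2.
have zD' : cabs z < 1 by [].
have z0 := cabs_ge0 z.
have r0 : 0 < r by rewrite /r; lra.
have r01 : 0 <= r < 1 by rewrite /r; lra.
have zr : cabs z < r by rewrite /r; lra.
have [K hK] := taylor_absconv af r01.
have [L hL] := absconv_term (taylor_absconv bg) r01.
have L0 : 0 <= L.
  by apply: le_trans (hL 0%N); rewrite mulr_ge0 ?cabs_ge0 ?exprn_ge0// ltW.
pose p N := \poly_(i < N) a i; pose q N := \poly_(i < N) b i.
have pz N : (p N).[z] = psum a z N by rewrite horner_poly.
have qz N : (q N).[z] = psum b z N by rewrite horner_poly.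
have pqlt N n : (n < N)%N -> (p N * q N)`_n = conv a b n.
  move=> nN; rewrite coefM /conv; apply: eq_bigr => i _; rewrite !coef_poly.
  have iN : (i < N)%N by rewrite (leq_trans _ nN).
  by rewrite iN (leq_ltn_trans (leq_subr _ _) nN).
have pqle N n : cabs (p N * q N)`_n * r ^+ n <= K * L.
  rewrite coefM (le_trans (ler_wpM2r _ (cabs_sum _ _ _))) ?exprn_ge0 ?(ltW r0)//.
  apply: le_trans (ler_wpM2r L0 (hK n.+1)); rewrite !mulr_suml ler_sum// => i _.
  rewrite cabsM !coef_poly; have [iN|_] := ltnP i N; last first.
    by rewrite cabs0 !mul0r mulr_ge0// mulr_ge0 ?cabs_ge0 ?exprn_ge0 ?(ltW r0).
  have -> : r ^+ n = r ^+ i * r ^+ (n - i) by rewrite -exprD subnKC// -ltnS.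
  rewrite mulrACA; apply: ler_pM => //; rewrite ?mulr_ge0 ?cabs_ge0 ?exprn_ge0 ?(ltW r0)//.
  case: ifP => _ //.
  by rewrite cabs0 mul0r.
pose x := cabs z / r.
have x01 : 0 <= x < 1.
  by rewrite divr_ge0 ?(ltW r0)//= ltr_pdivrMr// mul1r.
have KL0 : 0 <= K * L.
  apply: le_trans (pqle 0%N 0%N); rewrite mulr_ge0 ?cabs_ge0 ?exprn_ge0//.
  exact: ltW.
(* The coefficients from [N] on contribute a geometric tail of ratio [x = |z| / r], which tends to
   0. *)
have rem N : cabs (psum a z N * psum b z N - psum (conv a b) z N) <=
    K * L * (x ^+ N * (1 - x)^-1).
  rewrite -pz -qz -hornerM (@horner_coef_wide _ (N + N)); last first.
    rewrite (leq_trans (size_polyMleq _ _))// (leq_trans (leq_pred _))//.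
    by rewrite leq_add// size_poly.
  rewrite big_split_ord/= (eq_bigr (fun k : 'I_N => conv a b k * z ^+ k)); last first.
    by move=> k _; rewrite pqlt.
  rewrite addrAC subrr add0r (le_trans (cabs_sum _ _ _))//.
  apply: (@le_trans _ _ (K * L * (x ^+ N * \sum_(k < N) x ^+ k))).
    rewrite !mulr_sumr ler_sum// => k _; rewrite -exprD cabsM cabsX.
    rewrite /x expr_div_n mulrA ler_pdivlMr ?exprn_gt0//.
    by rewrite mulrAC ler_wpM2r ?exprn_ge0.
  rewrite ler_wpM2l// ler_wpM2l ?geometric_sum_le//.
  by case/andP: x01 => x0 _; rewrite exprn_ge0.
have rem0 : ccv \oo (fun N => psum a z N * psum b z N - psum (conv a b) z N) 0.
  rewrite /ccv; under eq_fun do rewrite subr0.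
  apply: (@squeeze_cvgr _ _ _ _ (cst 0)
    (fun N => K * L * (x ^+ N * (1 - x)^-1))).
  - by apply: nearW => N; rewrite cabs_ge0 rem.
  - exact: cvg_cst.
  - rewrite -[X in _ --> X](mulr0 (K * L)); apply: cvgM; first exact: cvg_cst.
    rewrite -[X in _ --> X](mul0r (1 - x)^-1); apply: cvgM; last exact: cvg_cst.
    by apply: cvg_expr; case/andP: x01 => x0 x1; rewrite ger0_norm.
rewrite -[_ * _]subr0; apply: (ccv_ext _ (ccvB (ccvM (af _ zD) (bg _ zD)) rem0)) => N.
by rewrite /psum opprB addrCA subrr addr0.
Qed.

Lemma analytic_cst c : analytic_D (fun=> c : C).
Proof.
exists (fun k => if k == 0%N then c else 0) => z _.
apply: (@ccv_near R nat \oo _ (fun=> c)); last exact: ccv_cst.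
exists 1%N => // -[//|N] _ /=; rewrite big_ord_recl big1 ?addr0 ?expr0 ?mulr1//.
by move=> i _; rewrite lift0 /= mul0r.
Qed.

Lemma analyticD f g : analytic_D f -> analytic_D g -> analytic_D (fun z => f z + g z).
Proof. by move=> [a fa] [b gb]; eexists; exact: taylorD fa gb. Qed.

Lemma analyticZ c f : analytic_D f -> analytic_D (fun z => c * f z).
Proof. by move=> [a fa]; eexists; exact: taylorZ fa. Qed.

Lemma analyticM f g : analytic_D f -> analytic_D g -> analytic_D (fun z => f z * g z).
Proof. by move=> [a fa] [b gb]; eexists; exact: taylorM fa gb. Qed.

(** The source of analyticity for compositions with [phi]; beyond polynomials it is extended only to
    uniform limits of them. *)
Lemma analytic_horner (p : {poly C}) f : analytic_D f -> analytic_D (fun z => p.[f z]).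
Proof.
move=> fa; elim/poly_ind: p => [|p c ih].
  by under eq_fun do rewrite horner0; exact: analytic_cst.
under eq_fun do rewrite hornerMXaddC.
by apply: analyticD; [exact: analyticM|exact: analytic_cst].
Qed.

Lemma analytic_sum (n : nat) (f : 'I_n -> C -> C) : (forall i, analytic_D (f i)) ->
  analytic_D (fun z => \sum_(i < n) f i z).
Proof.
elim: n f => [|n ih] f fa.
  by under eq_fun do rewrite big_ord0; exact: analytic_cst.
under eq_fun do rewrite big_ord_recl.
by apply: analyticD => //; exact: ih.
Qed.

End PowerSeries.

(** * The norm of the Hardy space *)

Section HardyNorm.
Variable R : realType.
Local Notation C := R[i].
Local Notation mu := (@lebesgue_measure R).
Local Notation circ := (`[0, 2 * pi]%classic : set R).
Implicit Types (a b : nat -> C) (f g : C -> C) (z : C) (r : R).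

Lemma int_mean2E f r : int_mean2 f r =
  (((2 * pi)^-1)%:E * sqint circ (fun t => f (rsc r (expi t))))%E.
Proof. by []. Qed.

Lemma twopi_gt0 : 0 < 2 * pi :> R.
Proof. by rewrite mulr_gt0// pi_gt0. Qed.

Lemma invtwopi_ge0 : (0 <= ((2 * pi)^-1 : R)%:E)%E.
Proof. by rewrite lee_fin invr_ge0 ltW// twopi_gt0. Qed.

Lemma mu_circle : (mu circ < +oo)%E.
Proof. by rewrite lebesgue_measure_itv/= lte_fin twopi_gt0 oppr0 adde0 ltry. Qed.

Lemma int_mean2_ge0 f r : (0 <= int_mean2 f r)%E.
Proof. by rewrite int_mean2E mule_ge0 ?invtwopi_ge0 ?sqint_ge0. Qed.

Lemma psum_circle a N r t : psum a (rsc r (expi t)) N =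
  trigpoly N (fun k => a k * Complex (r ^+ k) 0) t.
Proof.
by apply: eq_bigr => k _; rewrite rscX /rsc mulrA.
Qed.

Lemma int_mean2_psum a N r : int_mean2 (fun z => psum a z N) r =
  (\sum_(k < N) cabs (a k) ^+ 2 * (r ^+ k) ^+ 2)%:E.
Proof.
rewrite int_mean2E (_ : (fun t => _) = trigpoly N (fun k => a k * Complex (r ^+ k) 0)).
  rewrite sqint_trigpoly -EFinM mulrA mulVf ?mul1r ?gt_eqF ?twopi_gt0//.
  congr EFin; apply: eq_bigr => k _.
  by rewrite cabsM cabs_real exprMn real_normK ?num_real.
by apply/funext => t; exact: psum_circle.
Qed.

Lemma cvg_int_mean2 (f : nat -> C -> C) g r (K : R) :
  (forall n, cmeas circ (fun t => f n (rsc r (expi t)))) ->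
  (forall t, ccv \oo (fun n => f n (rsc r (expi t))) (g (rsc r (expi t)))) ->
  (forall n t, cabs (f n (rsc r (expi t))) <= K) ->
  (fun n => int_mean2 (f n) r) @ \oo --> int_mean2 g r.
Proof.
move=> mf fg fK; apply: cvgeZl => //.
apply: (@sqint_dominated _ _ (fun n t => f n (rsc r (expi t)))
  (fun t => g (rsc r (expi t))) K) => //.
exact: mu_circle.
Qed.

Lemma cmeas_psum D a N r : cmeas D (fun t => psum a (rsc r (expi t)) N).
Proof.
by rewrite (_ : (fun t => _) = trigpoly N (fun k => a k * Complex (r ^+ k) 0));
  [exact: cmeas_trigpoly|apply/funext => t; exact: psum_circle].
Qed.

Lemma cmeas_taylor D a f r : 0 <= r < 1 -> taylor_on_D a f ->
  cmeas D (fun t => f (rsc r (expi t))).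
Proof.
move=> r01 af; apply: (@cmeas_lim _ _ (fun N t => psum a (rsc r (expi t)) N)).
  by move=> N; exact: cmeas_psum.
by move=> t _; apply: af; exact: inD_rsc_expi.
Qed.

(** Parseval on the circle of radius [r]: the partial sums converge there pointwise and stay
    bounded, so their square integrals converge. *)
Lemma cvg_taylor_int_mean2 a f r : taylor_on_D a f -> 0 <= r < 1 ->
  (fun N => (\sum_(k < N) cabs (a k) ^+ 2 * (r ^+ k) ^+ 2)%:E) @ \oo -->
    int_mean2 f r.
Proof.
move=> af r01; have [K hK] := taylor_absconv af r01.
rewrite (_ : (fun N => _) = (fun N => int_mean2 (fun z => psum a z N) r)).
  apply: (@cvg_int_mean2 _ _ _ K).
  - by move=> N; exact: cmeas_psum.
  - by move=> t; apply: af; exact: inD_rsc_expi.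
  - move=> N t; apply: le_trans (hK N); apply: cabs_psum_le.
    by rewrite cabs_rsc cabs_expi mulr1 ger0_norm//; case/andP: r01.
by apply/funext => N; rewrite int_mean2_psum.
Qed.

Lemma taylor_sum_le_int_mean2 a f r N : taylor_on_D a f -> 0 <= r < 1 ->
  ((\sum_(k < N) cabs (a k) ^+ 2 * (r ^+ k) ^+ 2)%:E <= int_mean2 f r)%E.
Proof.
move=> af r01; have h := cvg_taylor_int_mean2 af r01.
rewrite -(cvg_lim _ h)//; apply: lime_ge; first by apply/cvg_ex; eexists; exact: h.
exists N => // n /= Nn; rewrite lee_fin -(subnKC Nn) big_split_ord/= lerDl.
by rewrite sumr_ge0// => i _; rewrite mulr_ge0 ?sqr_ge0.
Qed.

(** By Parseval the mean is a limit of sums with nonnegative coefficients in even powers of the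
    radius, hence monotone. *)
Lemma le_int_mean2 f r s : analytic_D f -> 0 <= r -> r <= s -> s < 1 ->
  (int_mean2 f r <= int_mean2 f s)%E.
Proof.
move=> [a af] r0 rs s1.
have r01 : 0 <= r < 1 by rewrite r0 (le_lt_trans rs).
have s01 : 0 <= s < 1 by rewrite (le_trans r0).
have h := cvg_taylor_int_mean2 af r01.
rewrite -(cvg_lim _ h)//; apply: lime_le; first by apply/cvg_ex; eexists; exact: h.
apply: nearW => N; apply: le_trans (taylor_sum_le_int_mean2 N af s01).
rewrite lee_fin ler_sum// => k _; rewrite ler_wpM2l ?sqr_ge0// lerXn2r//.
- by rewrite nnegrE exprn_ge0.
- by rewrite nnegrE exprn_ge0// (le_trans r0).
- by rewrite lerXn2r// nnegrE (le_trans r0).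
Qed.

Lemma int_mean2_le_H2norm2 f r : 0 < r < 1 -> (int_mean2 f r <= H2norm2 f)%E.
Proof. by move=> r01; apply: ereal_sup_ubound; exists r => //=; rewrite in_itv. Qed.

Lemma H2norm2_ge0 f : (0 <= H2norm2 f)%E.
Proof.
apply: le_trans (int_mean2_ge0 f 2^-1) (int_mean2_le_H2norm2 _ _).
by rewrite invr_gt0 ltr0n invf_lt1 ?ltr1n.
Qed.

Lemma H2norm2_le f (V : \bar R) :
  (forall r, 0 < r < 1 -> (int_mean2 f r <= V)%E) -> (H2norm2 f <= V)%E.
Proof.
by move=> h; apply: ge_ereal_sup => _ [r /= + <-]; rewrite in_itv/=; exact: h.
Qed.

Lemma eq_int_mean2 f g r : 0 <= r < 1 -> (forall z, inD z -> cabs (f z) = cabs (g z)) ->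
  int_mean2 f r = int_mean2 g r.
Proof.
move=> r01 fg; congr (_ * _)%E; apply: eq_sqint => t _.
by apply: fg; exact: inD_rsc_expi.
Qed.

Lemma eq_H2norm2 f g : (forall z, inD z -> cabs (f z) = cabs (g z)) ->
  H2norm2 f = H2norm2 g.
Proof.
have h f' g' : (forall z, inD z -> cabs (f' z) = cabs (g' z)) ->
    (H2norm2 f' <= H2norm2 g')%E.
  move=> fg; apply: H2norm2_le => r /andP[r0 r1].
  rewrite (eq_int_mean2 (g := g')) ?(ltW r0)//.
  by apply: int_mean2_le_H2norm2; rewrite r0.
by move=> fg; apply/eqP; rewrite eq_le !h// => z /fg.
Qed.

(** The dictionary between the norm by integral means and the [l^2] norm of the coefficients. One
    direction lets [r] tend to 1 in a finite sum; the other uses [r^(2k) <= 1]. *)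
Lemma H2norm2_leP a f (M : R) : taylor_on_D a f ->
  (H2norm2 f <= M%:E)%E <-> forall N, \sum_(k < N) cabs (a k) ^+ 2 <= M.
Proof.
move=> af; split=> [fM N|aM].
  pose S r := \sum_(k < N) cabs (a k) ^+ 2 * (r ^+ k) ^+ 2.
  have SM : \forall r \near (1 : R)^'-, S r <= M.
    near=> r; rewrite -lee_fin; apply: le_trans fM.
    have r0 : 0 < r by near: r; exact: nbhs_left_gt.
    have r1 : r < 1 by near: r; exact: nbhs_left_lt.
    apply: le_trans (int_mean2_le_H2norm2 f (introT andP (conj r0 r1))).
    by apply: taylor_sum_le_int_mean2 => //; rewrite (ltW r0).
  have cS : S @ (1 : R)^'- --> \sum_(k < N) cabs (a k) ^+ 2.
    rewrite (_ : \sum_(k < N) cabs (a k) ^+ 2 = S 1); last first.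
      by apply: eq_bigr => k _; rewrite !expr1n mulr1.
    apply: cvg_at_left_filter; rewrite /S.
    apply: (@cvg_big _ _ +%R 0) => //; first exact: add_continuous.
    move=> k _; apply: cvgM; first exact: cvg_cst.
    under eq_fun do rewrite -exprM; rewrite -exprM.
    exact: exprn_continuous.
  rewrite -(cvg_lim _ cS)//; apply: limr_le => //.
  by apply/cvg_ex; eexists; exact: cS.
apply: H2norm2_le => r /andP[r0 r1].
have r01 : 0 <= r < 1 by rewrite (ltW r0).
have h := cvg_taylor_int_mean2 af r01.
rewrite -(cvg_lim _ h)//; apply: lime_le; first by apply/cvg_ex; eexists; exact: h.
apply: nearW => N; rewrite lee_fin; apply: le_trans (aM N).
apply: ler_sum => k _; rewrite -[leRHS]mulr1 ler_wpM2l ?sqr_ge0//.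
by rewrite -exprM exprn_ile1// ltW.
Unshelve. all: by end_near. Qed.

(** The difference of the two series vanishes on the disc, so its norm is 0, and [H2norm2_leP] makes
    every coefficient 0. *)
Lemma taylor_coef_unique a b f g : (forall z, inD z -> f z = g z) ->
  taylor_on_D a f -> taylor_on_D b g -> a = b.
Proof.
move=> fg /(taylor_eq fg) ag bg.
have h := taylorD ag (taylorZ (-1) bg).
have h0 : (H2norm2 (fun z => (g z + -1 * g z)%R) <= 0%:E)%E.
  apply: H2norm2_le => r r01; rewrite int_mean2E /sqint integral0_eq ?mule0//.
  by move=> t _; rewrite mulN1r subrr cabs0 expr0n.
apply/funext => k; have := (H2norm2_leP _ h).1 h0 k.+1.
rewrite big_ord_recr/= => hk.
have : cabs (a k + -1 * b k) ^+ 2 <= 0.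
  by apply: le_trans hk; rewrite lerDr sumr_ge0// => i _; rewrite sqr_ge0.
rewrite le_eqVlt ltNge sqr_ge0 orbF sqrf_eq0 cabs_eq0 mulN1r subr_eq0.
by move/eqP.
Qed.

Lemma H2norm2Z_le c f (V : R) : analytic_D f -> (H2norm2 f <= V%:E)%E ->
  (H2norm2 (fun z => (c * f z)%R) <= (cabs c ^+ 2 * V)%:E)%E.
Proof.
move=> [a af] /(H2norm2_leP _ af) aV; apply/(H2norm2_leP _ (taylorZ c af)) => N.
rewrite (eq_bigr (fun k : 'I_N => cabs c ^+ 2 * cabs (a k) ^+ 2)).
  by rewrite -mulr_sumr ler_wpM2l ?sqr_ge0 ?aV.
by move=> k _; rewrite cabsM exprMn.
Qed.

End HardyNorm.

(** * The Poisson kernel and the radial maximal function *)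

Section PoissonKernel.
Variables (R : realType) (rho : R).
Hypothesis rho01 : 0 <= rho < 1.
Local Notation C := R[i].

Let rho0 : 0 <= rho. Proof. by case/andP : rho01. Qed.
Let rho1 : rho < 1. Proof. by case/andP : rho01. Qed.

(** [q x] is [|1 - rho e^(ix)|^2], the denominator of the Poisson kernel. *)
Let q (x : R) : R := 1 - 2 * rho * cos x + rho ^+ 2.
Definition poisson (x : R) : R := (1 - rho ^+ 2) / q x.

Let q_ge x : (1 - rho) ^+ 2 <= q x.
Proof. by rewrite /q; have := cos_le1 x; move: rho0; nra. Qed.

Let q_gt0 x : 0 < q x.
Proof. by apply: lt_le_trans (q_ge x); rewrite exprn_gt0// subr_gt0. Qed.

Let omr2_ge0 : 0 <= 1 - rho ^+ 2.
Proof. by rewrite subr_ge0 exprn_ile1// ltW. Qed.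

Lemma poisson_ge0 x : 0 <= poisson x.
Proof. by rewrite /poisson divr_ge0// ltW. Qed.

Let is_derive_q (x : R) : is_derive x 1 q (2 * rho * sin x).
Proof.
have h : is_derive x 1 (fun y : R => (1 + rho ^+ 2) + - (2 * rho) * cos y)
    (0 + - (2 * rho) * - sin x).
  exact: is_derive_addf.
rewrite (_ : q = fun y : R => (1 + rho ^+ 2) + - (2 * rho) * cos y).
  by apply: is_derive_eq h _; ring.
by apply/funext => y; rewrite /q; ring.
Qed.

Lemma is_derive_poisson (x : R) : is_derive x 1 poisson
  (- ((1 - rho ^+ 2) * (2 * rho * sin x) / q x ^+ 2)).
Proof.
have qx0 : q x != 0 by rewrite gt_eqF.
have h := is_derive_scaler (1 - rho ^+ 2) (is_deriveV qx0 (is_derive_q x)).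
by apply: is_derive_eq h _; rewrite /GRing.scale/=; ring.
Qed.

Lemma poisson_derive_le0 (x : R) : 0 < x < pi ->
  - ((1 - rho ^+ 2) * (2 * rho * sin x) / q x ^+ 2) <= 0.
Proof.
move=> xpi; rewrite oppr_le0 divr_ge0 ?exprn_ge0 ?(ltW (q_gt0 _))//.
by rewrite !mulr_ge0// ltW// sin_gt0_pi.
Qed.

(** A partial sum of the Fourier series [1 + 2 sum_(j >= 1) rho^j cos (j x)] of the Poisson kernel;
    the [- 1] corrects the doubled term [j = 0]. *)
Definition poisson_sum m (x : R) : R :=
  2 * (\sum_(j < m.+1) rho ^+ j * cos (j%:R * x)) - 1.

(** Multiplication by [q] telescopes the sum, by [cos ((m+2) x) + cos (m x) = 2 cos x cos ((m+1)
    x)]; only the last two terms survive. *)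
Let poisson_sumE m x : q x * poisson_sum m x =
  1 - rho ^+ 2 - 2 * rho ^+ m.+1 * cos (m.+1%:R * x)
  + 2 * rho ^+ m.+2 * cos (m%:R * x).
Proof.
elim: m => [|m ih].
  by rewrite /poisson_sum big_ord1/= !mul0r cos0 expr0 [1%:R * x]mul1r /q; ring.
have -> : poisson_sum m.+1 x =
    poisson_sum m x + 2 * rho ^+ m.+1 * cos (m.+1%:R * x).
  by rewrite /poisson_sum big_ord_recr/=; ring.
have e : cos (m.+2%:R * x) + cos (m%:R * x) = 2 * cos x * cos (m.+1%:R * x).
  rewrite (_ : m.+2%:R * x = m.+1%:R * x + x); last by rewrite -[in LHS]natr1; ring.
  rewrite (_ : m%:R * x = m.+1%:R * x - x); last by rewrite -[in RHS]natr1; ring.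
  by rewrite cosD cosB; ring.
rewrite mulrDr ih (_ : cos (m.+2%:R * x) =
  2 * cos x * cos (m.+1%:R * x) - cos (m%:R * x)); last by rewrite -e; ring.
by rewrite /q !exprS; ring.
Qed.

(** The two terms left by [poisson_sumE] are at most [2 rho^m] each, which gives the 4, and [q] is
    at least [(1 - rho)^2]. *)
Lemma poisson_sum_close m x :
  `|poisson_sum m x - poisson x| <= 4 / (1 - rho) ^+ 2 * rho ^+ m.
Proof.
have qx := q_gt0 x.
have -> : poisson_sum m x - poisson x =
    (2 * rho ^+ m.+2 * cos (m%:R * x) - 2 * rho ^+ m.+1 * cos (m.+1%:R * x)) / q x.
  have e y : q x * (y / q x) = y by rewrite mulrC divfK ?gt_eqF.
  apply: (mulfI (lt0r_neq0 qx)); rewrite mulrBr poisson_sumE /poisson !e.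
  by ring.
rewrite normrM normfV (gtr0_norm qx) [leRHS]mulrAC.
apply: ler_pM; rewrite ?normr_ge0 ?invr_ge0 ?(ltW qx)//; last first.
  by rewrite lef_pV2 ?posrE// exprn_gt0// subr_gt0.
have normE k y : `|2 * rho ^+ k * y| = 2 * (rho ^+ k * `|y|).
  by rewrite !normrM [`|2|]ger0_norm// [`|_ ^+ _|]ger0_norm ?exprn_ge0// mulrA.
rewrite (le_trans (ler_normB _ _))// !normE.
have c1 : `|cos (m%:R * x)| <= 1 by rewrite ler_norml cos_geN1 cos_le1.
have c2 : `|cos (m.+1%:R * x)| <= 1 by rewrite ler_norml cos_geN1 cos_le1.
have p0 : 0 <= rho ^+ m by rewrite exprn_ge0.
have p1 : rho ^+ m.+1 <= rho ^+ m by rewrite exprS ler_piMl// ltW.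
have p2 : rho ^+ m.+2 <= rho ^+ m.
  by rewrite exprS (le_trans _ p1)// ler_piMl ?exprn_ge0// ltW.
have : rho ^+ m.+2 * `|cos (m%:R * x)| <= rho ^+ m * 1.
  by apply: ler_pM; rewrite ?exprn_ge0.
have : rho ^+ m.+1 * `|cos (m.+1%:R * x)| <= rho ^+ m * 1.
  by apply: ler_pM; rewrite ?exprn_ge0.
lra.
Qed.

(** The antiderivative, vanishing at 0, of [poisson_sum m x] times [2 cos (k x)], written out by the
    product formula for cosines. Its value at [pi] extracts the Fourier coefficient [rho^k]. *)
Let T m k (x : R) : R := \sum_(j < m.+1)
  2 * rho ^+ j * (cos_prim (j%:R + k%:R) x + cos_prim (j%:R - k%:R) x)
  + - 2 * cos_prim k%:R x.

Let T0 m k : T m k 0 = 0.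
Proof.
by rewrite /T big1 ?cos_prim0 ?mulr0 ?addr0// => j _; rewrite !cos_prim0 addr0 mulr0.
Qed.

Let cos_prim_pi (j k : nat) : cos_prim (j%:R - k%:R) pi = (j == k)%:R * pi :> R.
Proof.
rewrite /cos_prim subr_eq0 eqr_nat; case: eqP => [_|_]; first by rewrite mul1r.
by rewrite mulrBl sinB !sin_natpi mulr0 mul0r subr0 mulr0 mul0r.
Qed.

Let Tpi m k : (k <= m)%N -> T m k pi = 2 * pi * rho ^+ k.
Proof.
move=> km; rewrite /T.
have h0 (j : nat) : cos_prim j%:R pi = (j == 0)%N%:R * pi :> R.
  by have := cos_prim_pi j 0; rewrite subr0.
have h (j : nat) : cos_prim (j%:R + k%:R) pi = (j + k == 0)%N%:R * pi :> R.
  by rewrite -natrD h0.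
rewrite h0.
rewrite (bigD1 (inord k))//= inordK// big1 => [|j jk]; last first.
  rewrite h cos_prim_pi.
  have jk' : (j == k :> nat) = false.
    by apply: contraNF jk => /eqP jk; apply/eqP/val_inj; rewrite /= inordK.
  rewrite jk' mul0r addr0; case: (j + k == 0)%N / eqP => [/eqP|]; last first.
    by move=> _; rewrite mul0r mulr0.
  by rewrite addn_eq0 => /andP[/eqP j0 /eqP k0]; rewrite j0 k0 eqxx in jk'.
(* Only the term [j = k] is left. For [k = 0] both of its primitives contribute, and the term with
   factor [- 2] removes the excess. *)
rewrite h cos_prim_pi eqxx addr0 addn_eq0 andbb.
by case: eqP => [->|_] /=; rewrite ?expr0; ring.
Qed.

Let is_derive_T m k (x : R) :
  is_derive x 1 (T m k) (poisson_sum m x * (2 * cos (k%:R * x))).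
Proof.
have h : is_derive x 1 (T m k) (\sum_(j < m.+1)
    2 * rho ^+ j * (cos ((j%:R + k%:R) * x) + cos ((j%:R - k%:R) * x))
    + - 2 * cos (k%:R * x)).
  apply: is_derive_addf; last exact/is_derive_scaler/is_derive_cos_prim.
  apply: (@is_derive_sumf _ m.+1 (fun j x =>
    2 * rho ^+ j * (cos_prim (j%:R + k%:R) x + cos_prim (j%:R - k%:R) x)) x
   (fun j => 2 * rho ^+ j * (cos ((j%:R + k%:R) * x) + cos ((j%:R - k%:R) * x)))) => j.
  by apply: is_derive_scaler; apply: is_derive_addf; exact: is_derive_cos_prim.
apply: is_derive_eq h _; rewrite /poisson_sum mulrBl mul1r mulNr; congr (_ - _).
rewrite mulrC mulrA mulr_sumr; apply: eq_bigr => j _.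
by rewrite [(_ + _) * x]mulrDl [(_ - _) * x]mulrBl cosD cosB; ring.
Qed.

Section majorant.
(** [Phi] is an antiderivative of [|u|] for the trigonometric polynomial [u], and [M] bounds the
    averages of [|u|] over intervals centred at [theta] of half-length at most [pi]. The margin
    [pi + 1] makes [Phi] differentiable at the endpoints [theta - pi] and [theta + pi] too. *)
Variables (n : nat) (c : nat -> C) (theta M : R) (Phi : R -> R).
Hypothesis dPhi : forall x, theta - (pi + 1) < x < theta + (pi + 1) ->
  is_derive x 1 Phi (cabs (trigpoly n c x)).
Hypothesis PhiM : forall h, 0 < h <= pi ->
  Phi (theta + h) - Phi (theta - h) <= 2 * h * M.

Let is_derive_Phi_add (x : R) : - (pi + 1) < x < pi + 1 ->
  is_derive x 1 (fun y => Phi (theta + y)) (cabs (trigpoly n c (theta + x))).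
Proof.
move=> /andP[x1 x2]; have h : is_derive (theta + x) 1 Phi (cabs (trigpoly n c (theta + x))).
  by apply: dPhi; apply/andP; split; lra.
have g : is_derive x 1 (fun y : R => theta + y) (0 + 1).
  exact: is_derive_addf.
by apply: is_derive_eq (is_derive1_comp h g) _; rewrite add0r mulr1.
Qed.

Let is_derive_Phi_sub (x : R) : - (pi + 1) < x < pi + 1 ->
  is_derive x 1 (fun y => Phi (theta - y)) (- cabs (trigpoly n c (theta - x))).
Proof.
move=> /andP[x1 x2]; have h : is_derive (theta - x) 1 Phi (cabs (trigpoly n c (theta - x))).
  by apply: dPhi; apply/andP; split; lra.
have g : is_derive x 1 (fun y : R => theta + -1 * y) (0 + -1).
  by apply: is_derive_addf; exact: is_derive_mulr.
rewrite (_ : (fun y => _) = Phi \o (fun y : R => theta + -1 * y)); last first.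
  by apply/funext => y; rewrite /= mulN1r.
have h' : is_derive (theta + -1 * x) 1 Phi (cabs (trigpoly n c (theta - x))).
  by rewrite mulN1r.
have k := @is_derive1_comp R Phi (fun y : R => theta + -1 * y) x _ _ h' g.
by apply: is_derive_eq k _; rewrite add0r mulrN1.
Qed.

(** [2 M x] minus the integral of [|u|] from [theta - x] to [theta + x]: the hypothesis on averages
    says exactly that it is nonnegative on []0, pi]]. *)
Let D (x : R) : R := 2 * M * x + -1 * (Phi (theta + x) + -1 * Phi (theta - x)).

Let D0 : D 0 = 0. Proof. by rewrite /D addr0 subr0; ring. Qed.

Let Dpi : 0 <= D pi.
Proof.
by have := @PhiM pi; rewrite pi_gt0 lexx => /(_ isT); rewrite /D; lra.
Qed.

Let D_ge0 (x : R) : 0 < x <= pi -> 0 <= D x.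
Proof. by move=> /PhiM; rewrite /D; lra. Qed.

Let is_derive_D (x : R) : - (pi + 1) < x < pi + 1 -> is_derive x 1 D
  (2 * M - (cabs (trigpoly n c (theta + x)) + cabs (trigpoly n c (theta - x)))).
Proof.
move=> hx.
have h : is_derive x 1 D (2 * M + -1 * (cabs (trigpoly n c (theta + x))
    + -1 * - cabs (trigpoly n c (theta - x)))).
  apply: is_derive_addf; first exact: is_derive_mulr.
  apply: is_derive_scaler; apply: is_derive_addf; first exact: is_derive_Phi_add.
  by apply: is_derive_scaler; exact: is_derive_Phi_sub.
by apply: is_derive_eq h _; rewrite !mulN1r opprK.
Qed.

(* [x |-> int_0^x P_m (2 M - V) - P D] has derivative
   [(P_m - P) (2 M - V) + P (|u| + |u| - V) - P' D], where [D' = 2 M - |u| - |u|];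
   up to the truncation error [P_m - P] it is nonnegative, so no integral of
   the Poisson kernel itself is ever needed. *)
Lemma poisson_majorant_real (w : C) : cabs w = 1 ->
  \sum_(k < n) Re (w * c k * expi theta ^+ k) * rho ^+ k <= M.
Proof.
move=> w1; pose d k := w * c k * expi theta ^+ k.
(* [V x] is [Re (u x) + Re (u (- x))] for the polynomial [u] with coefficients [d], since the sines
   cancel. As [u] is a rotated translate of the original polynomial, [Vle] follows. *)
pose V (x : R) := \sum_(k < n) 2 * Re (d k) * cos (k%:R * x).
have dE x : trigpoly n d x = w * trigpoly n c (theta + x).
  rewrite /trigpoly mulr_sumr; apply: eq_bigr => k _.
  by rewrite expiD exprMn /d; ring.
have Vle x : V x <= cabs (trigpoly n c (theta + x)) + cabs (trigpoly n c (theta - x)).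
  have cw y : Re (trigpoly n d y) <= cabs (trigpoly n c (theta + y)).
    rewrite dE (le_trans (ler_norm _))// (le_trans (normr_Re_le _))//.
    by rewrite cabsM w1 mul1r.
  apply: le_trans (lerD (cw x) (cw (- x))).
  rewrite !Re_trigpoly -big_split/= ler_sum// => k _.
  by rewrite mulrN cosN sinN -/(d k); lra.
pose K := 2 * `|M| + \sum_(k < n) 2 * `|Re (d k)|.
have VK x : `|2 * M - V x| <= K.
  rewrite (le_trans (ler_normB _ _))// lerD//.
    by rewrite normrM ger0_norm.
  rewrite (le_trans (ler_norm_sum _ _ _))// ler_sum// => k _.
  rewrite !normrM [`|2|]ger0_norm// ler_piMr ?mulr_ge0//.
  by rewrite ler_norml cos_geN1 cos_le1.
have K0 : 0 <= K by apply: le_trans (VK 0); exact: normr_ge0.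
pose L := 4 / (1 - rho) ^+ 2.
have L0 : 0 <= L by rewrite divr_ge0 ?sqr_ge0.
have main m : (n <= m)%N ->
    \sum_(k < n) Re (d k) * rho ^+ k <= M + K * (L * rho ^+ m) / 2.
  move=> nm; pose e := L * rho ^+ m.
  (* The summand [K * e * x] pays for truncating the kernel: [K] bounds [|2 M - V|] and [e] bounds
     [|P_m - P|], so it makes the derivative nonnegative. *)
  pose J (x : R) := ((M * T m 0 x + -1 * \sum_(k < n) Re (d k) * T m k x)
    + K * e * x) + -1 * (poisson x * D x).
  pose dP (x : R) := - ((1 - rho ^+ 2) * (2 * rho * sin x) / q x ^+ 2).
  pose dJ (x : R) := ((M * (poisson_sum m x * (2 * cos (0%:R * x))) +
    -1 * \sum_(k < n) Re (d k) * (poisson_sum m x * (2 * cos (k%:R * x)))) + K * e) +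
    -1 * (poisson x * (2 * M - (cabs (trigpoly n c (theta + x)) +
       cabs (trigpoly n c (theta - x)))) + D x * dP x).
  have is_dJ (x : R) : - (pi + 1) < x < pi + 1 -> is_derive x 1 J (dJ x).
    move=> hx; apply: is_derive_addf; [apply: is_derive_addf|]; first last.
    - apply: is_derive_scaler.
      exact: (is_deriveM (is_derive_poisson x) (is_derive_D hx)).
    - exact: is_derive_mulr.
    - apply: is_derive_addf; first exact/is_derive_scaler/is_derive_T.
      apply: is_derive_scaler.
      apply: (@is_derive_sumf _ n (fun k x => Re (d k) * T m k x) x
        (fun k => Re (d k) * (poisson_sum m x * (2 * cos (k%:R * x))))) => k.
      exact/is_derive_scaler/is_derive_T.
  have dJ_ge0 (x : R) : 0 < x < pi -> 0 <= dJ x.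
    move=> xpi.
    have -> : dJ x = (K * e + (poisson_sum m x - poisson x) * (2 * M - V x)) +
        poisson x * (cabs (trigpoly n c (theta + x)) +
          cabs (trigpoly n c (theta - x)) - V x) - D x * dP x.
      rewrite /dJ mul0r cos0.
      have -> : \sum_(k < n) Re (d k) * (poisson_sum m x * (2 * cos (k%:R * x))) =
          poisson_sum m x * V x.
        by rewrite /V mulr_sumr; apply: eq_bigr => k _; ring.
      ring.
    have h1 : 0 <= K * e + (poisson_sum m x - poisson x) * (2 * M - V x).
      have : `|(poisson_sum m x - poisson x) * (2 * M - V x)| <= K * e.
        rewrite normrM mulrC; apply: ler_pM => //; exact: poisson_sum_close.
      by rewrite ler_norml => /andP[]; lra.
    have h2 : 0 <= poisson x * (cabs (trigpoly n c (theta + x)) +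
          cabs (trigpoly n c (theta - x)) - V x).
      by rewrite mulr_ge0 ?poisson_ge0// subr_ge0.
    have h3 : D x * dP x <= 0.
      rewrite mulr_ge0_le0 ?poisson_derive_le0// D_ge0//.
      by case/andP : xpi => -> /ltW.
    by rewrite subr_ge0 (le_trans h3)// addr_ge0.
  have J0pi : J 0 <= J pi.
    have pi0 := pi_gt0 R.
    apply: (@ger0_derive1_le_cc _ J 0 pi).
    - move=> x; rewrite in_itv/= => /andP[x0 x1].
      by have /is_dJ[] : - (pi + 1) < x < pi + 1 by apply/andP; split; lra.
    - move=> x; rewrite in_itv/= => /andP[x0 x1].
      have /is_dJ[_ h] : - (pi + 1) < x < pi + 1 by apply/andP; split; lra.
      by rewrite derive1E h dJ_ge0// x0.
    - apply: derivable_within_continuous => x; rewrite in_itv/= => /andP[x0 x1].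
      by have /is_dJ[] : - (pi + 1) < x < pi + 1 by apply/andP; split; lra.
    - by rewrite in_itv/= lexx ltW.
    - by rewrite in_itv/= lexx ltW.
    - exact: ltW.
  (* [J] vanishes at 0. At [pi] the values of [T], known because every [k < n <= m], turn
     [0 <= J pi] into the claim with error [K e / 2], once the nonnegative product [P(pi) D(pi)] is
     dropped. *)
  move: J0pi; rewrite /J D0 T0 big1 => [|k _]; last by rewrite T0 mulr0.
  rewrite Tpi// (eq_bigr (fun k : 'I_n => 2 * pi * (Re (d k) * rho ^+ k))).
    rewrite -mulr_sumr expr0 => h.
    have := mulr_ge0 (poisson_ge0 pi) Dpi; rewrite -/e => h'.
    rewrite -(ler_pM2l (_ : 0 < 2 * pi)) ?mulr_gt0 ?pi_gt0//.
    by lra.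
  move=> k _; rewrite Tpi; first by ring.
  exact: leq_trans (ltnW (ltn_ord k)) nm.
have cm : (fun m => M + K * (L * rho ^+ m) / 2) @ \oo --> M.
  rewrite -[X in _ --> X]addr0; apply: cvgD; first exact: cvg_cst.
  rewrite (_ : 0 = K * (L * 0) / 2); last by ring.
  apply: cvgM; last exact: cvg_cst.
  apply: cvgM; first exact: cvg_cst.
  apply: cvgM; first exact: cvg_cst.
  by apply: cvg_expr; rewrite ger0_norm.
rewrite -(cvg_lim _ cm)//; apply: limr_ge; first by apply/cvg_ex; eexists; exact: cm.
by exists n => // m /=; exact: main.
Qed.

Lemma poisson_majorant : cabs (psum c (rsc rho (expi theta)) n) <= M.
Proof.
have [w [w1 <-]] := cabs_unit_Re (psum c (rsc rho (expi theta)) n).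
apply: le_trans (poisson_majorant_real w1).
have ReR (d : C) y : Re (d * Complex y 0) = Re d * y.
  by rewrite cReM /= mulr0 subr0.
rewrite /psum mulr_sumr Re_sum ler_sum// => k _.
by rewrite rscX /rsc [Complex _ _ * _]mulrC !mulrA ReR.
Qed.

End majorant.

End PoissonKernel.

(** * The Hardy-Littlewood inequality applied along radii *)

Section RadialMaximal.
Variable R : realType.
Local Notation C := R[i].
Local Notation mu := (@lebesgue_measure R).
Local Notation circ := (`[0, 2 * pi]%classic : set R).
Local Notation wide := (`[- (1%:R * (2 * pi)), 2%:R * (2 * pi)]%classic : set R).

Lemma continuous_cabs_trigpoly n (c : nat -> C) :
  continuous (fun t : R => cabs (trigpoly n c t)).
Proof. by move=> t; exact: ccv_cabs (ccv_trigpoly n c t). Qed.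

Lemma integrable_cabs_trigpoly n (c : nat -> C) (a b : R) :
  mu.-integrable `[a, b] (EFin \o (fun t => cabs (trigpoly n c t))).
Proof.
apply: continuous_compact_integrable; first exact: segment_compact.
by apply: continuous_subspaceT; exact: continuous_cabs_trigpoly.
Qed.

(** The exceptional set is where the maximal function of [|u|], cut off to [wide], exceeds [e]; the
    3 is the constant of the weak-type inequality. Elsewhere all centred averages are at most [e],
    and [poisson_majorant] applies with [M = e]. The interval [wide] exceeds the circle by a full
    period on each side, more than the [pi + 1] required. *)
Lemma radial_maximal n (c : nat -> C) (e : R) : 0 < e ->
  exists E : set R, [/\ measurable E,
    (mu E <= (3 / e)%:E * \int[mu]_(t in wide) (cabs (trigpoly n c t))%:E)%E &
    forall t rho, circ t -> ~ E t -> 0 <= rho < 1 ->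
      cabs (psum c (rsc rho (expi t)) n) <= e].
Proof.
move=> e0; pose u t := cabs (trigpoly n c t); pose v := u \_ wide.
have locv : locally_integrable setT v.
  apply: integrable_locally => //.
  exact: integrable_cabs_trigpoly.
exists [set x | (e%:E < HL_maximal v x)%E]; split.
- rewrite -[X in measurable X]setTI; apply: emeasurable_fun_o_infty => //.
  exact: measurable_HL_maximal.
- apply: le_trans (maximal_inequality locv e0) _.
  rewrite lee_wpmul2l ?lee_fin ?divr_ge0 ?(ltW e0)//.
  rewrite [leRHS]integral_mkcond le_eqVlt; apply/orP; left; apply/eqP.
  apply: eq_integral => y _; rewrite /v /u /patch; case: ifP => _.
    by rewrite gee0_abs ?lee_fin ?cabs_ge0.
  exact: abse0.
move=> t rho; rewrite /= in_itv/= => /andP[t0 t2] /negP; rewrite -leNgt => HLe rho01.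
have pi2 : 2 <= pi :> R := pi_ge2 R.
pose a : R := - (1%:R * (2 * pi)); pose b : R := 2%:R * (2 * pi).
pose Phi y := (\int[mu]_(s in `[a, y]) u s)%R.
have dPhi x : a < x < b -> is_derive x 1 Phi (u x).
  move=> /andP[ax xb].
  have [d1 d2] := continuous_FTC1_closed xb (integrable_cabs_trigpoly n c a b) ax
    (@continuous_cabs_trigpoly n c x).
  by apply: DeriveDef => //; rewrite -derive1E.
apply: (@poisson_majorant _ _ rho01 _ _ _ _ Phi).
  move=> x /andP[x1 x2]; apply: dPhi; apply/andP.
  by rewrite /a /b; split; lra.
move=> h /andP[h0 hpi].
have ht : t - h < t + h by lra.
have FTC : (\int[mu]_(s in `[(t - h)%R, (t + h)%R]) (u s)%:E =
    (Phi (t + h))%:E - (Phi (t - h))%:E)%E.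
  have dF x : t - h <= x <= t + h -> is_derive x 1 Phi (u x).
    by move=> /andP[x1 x2]; apply: dPhi; apply/andP; rewrite /a /b; split; lra.
  have cF x : t - h <= x <= t + h -> {for x, continuous Phi}.
    move=> /dF[dx _]; apply: differentiable_continuous.
    exact/derivable1_diffP.
  apply: continuous_FTC2 => //.
  - by apply: continuous_subspaceT; exact: continuous_cabs_trigpoly.
  - split.
    + move=> x /[!in_itv]/= /andP[x1 x2].
      have xx : t - h <= x <= t + h by rewrite !ltW.
      by case: (dF x xx).
    + by apply: cvg_at_right_filter; apply: cF; rewrite ?lexx ?andbT ltW.
    + by apply: cvg_at_left_filter; apply: cF; rewrite ?lexx ?andbT ltW.
  - move=> x /[!in_itv]/= /andP[x1 x2]; rewrite derive1E.
    have xx : t - h <= x <= t + h by rewrite !ltW.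
    by case: (dF x xx).
rewrite -lee_fin EFinB -FTC.
have : (iavg v (ball t h) <= e%:E)%E.
  apply: le_trans HLe; apply: ereal_sup_ubound.
  by exists h => //=; rewrite in_itv/= h0.
rewrite /iavg lebesgue_measure_ball ?(ltW h0)// inver mulrn_eq0/= gt_eqF//.
(* For [t] on the circle and [h <= pi] the ball lies inside [wide], so the cut-off does not alter
   the integrand there. *)
have -> : (\int[mu]_(y in ball t h) `|(v y)%:E| =
    \int[mu]_(s in `[(t - h)%R, (t + h)%R]) (u s)%:E)%E.
  rewrite (@integral_itv_bndoo _ _ _ (EFin \o u)) -?ball_itv; last first.
    apply/measurable_EFinP; apply: measurable_funTS.
    apply: continuous_measurable_fun; exact: (@continuous_cabs_trigpoly n c).
  apply: eq_integral => y; rewrite inE ball_itv/= in_itv/= => /andP[y1 y2].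
  rewrite /v /patch ifT; first by rewrite ger0_norm ?cabs_ge0.
  by rewrite inE/= in_itv/=; apply/andP; split; lra.
rewrite muleC lee_pdivrMr ?mulrn_wgt0// => /le_trans; apply.
by rewrite -EFinM lee_fin -mulr_natr; lra.
Qed.

(** Cauchy-Schwarz in the form [|u| <= delta / 2 + |u|^2 / (2 delta)]. The interval has length
    [6 pi], and by Parseval over three periods each of the two terms integrates to at most
    [3 pi delta]. *)
Lemma integral_cabs_trigpoly n (c : nat -> C) (delta : R) : 0 < delta ->
  \sum_(k < n) cabs (c k) ^+ 2 <= delta ^+ 2 ->
  (\int[mu]_(t in wide) (cabs (trigpoly n c t))%:E <= (6 * pi * delta)%:E)%E.
Proof.
move=> d0 cd; pose u t := cabs (trigpoly n c t).
have mu2 : measurable_fun wide (fun t => (u t ^+ 2)%:E).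
  by apply: measurable_cabs2E; exact: cmeas_trigpoly.
apply: (@le_trans _ _ (\int[mu]_(t in wide)
    ((delta / 2)%:E + (2 * delta)^-1%:E * (u t ^+ 2)%:E))%E).
  apply: ge0_le_integral => //=.
  - by move=> t _; rewrite lee_fin cabs_ge0.
  - apply/measurable_EFinP; apply: measurable_funTS.
    apply: continuous_measurable_fun; exact: (@continuous_cabs_trigpoly n c).
  - apply: emeasurable_funD; first exact: measurable_cst.
    exact: measurable_funeM.
  - move=> t _; rewrite -EFinM -EFinD lee_fin -/(u t).
    rewrite -(ler_pM2l (_ : 0 < 2 * delta)) ?mulr_gt0// mulrDr.
    rewrite [X in _ + X]mulVKf ?gt_eqF ?mulr_gt0//.
    by have := sqr_ge0 (u t - delta); nra.
rewrite ge0_integralD//; last 3 first.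
- by move=> t _; rewrite lee_fin divr_ge0 ?ltW.
- by move=> t _; rewrite -EFinM lee_fin mulr_ge0 ?sqr_ge0// invr_ge0 mulr_ge0 ?ltW.
- exact: measurable_funeM.
rewrite integral_cst// ge0_integralZl_EFin//; last 2 first.
- by move=> t _; rewrite lee_fin sqr_ge0.
- by rewrite invr_ge0 mulr_ge0 ?ltW.
rewrite -[X in (_ + _ * X)%E]/(sqint wide (trigpoly n c)).
have pi0 := pi_gt0 R.
have muE : mu wide = (6 * pi)%:E.
  rewrite lebesgue_measure_itv/= ifT; last by rewrite lte_fin; lra.
  by rewrite -EFinB; congr EFin; ring.
rewrite [X in (X + _)%E](_ : _ = (delta / 2 * (6 * pi))%:E); last first.
  exact: (congr1 (mule (delta / 2)%:E) muE).
rewrite sqint_trigpoly_periods// -EFinM -EFinD lee_fin natrD.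
have : (2 * delta)^-1 * ((1 + 2) * (2 * pi) * \sum_(k < n) cabs (c k) ^+ 2) <= 3 * pi * delta.
  rewrite ler_pdivrMl ?mulr_gt0//.
  by have := ler_wpM2l (mulr_ge0 (ler0n R 6) (ltW pi0)) cd; lra.
lra.
Qed.

End RadialMaximal.

(** * Radial limits *)

Section RadialLimits.
Variable R : realType.
Local Notation C := R[i].
Local Notation mu := (@lebesgue_measure R).
Local Notation circ := (`[0, 2 * pi]%classic : set R).

Lemma ccv_cauchy T (F : set_system T) (FF : ProperFilter F) (g : T -> C) :
  (forall e : R, 0 < e -> exists l, \forall x \near F, cabs (g x - l) < e) ->
  exists l, ccv F g l.
Proof.
move=> h.
have cr : cvg ((fun x => Re (g x)) @ F).
  apply: cauchy_cvg; apply: cauchy_exP => e e0; have [l hl] := h _ e0.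
  exists (Re l); apply: filterS hl => x; apply: le_lt_trans.
  by rewrite /= cabs_distC -cReN -cReD normr_Re_le.
have ci : cvg ((fun x => Im (g x)) @ F).
  apply: cauchy_cvg; apply: cauchy_exP => e e0; have [l hl] := h _ e0.
  exists (Im l); apply: filterS hl => x; apply: le_lt_trans.
  by rewrite /= cabs_distC -cImN -cImD normr_Im_le.
by exists (Complex (lim ((fun x => Re (g x)) @ F)) (lim ((fun x => Im (g x)) @ F)));
  apply/ccvP; split.
Qed.

Lemma ccv_rsc_left (w : C) : ccv (1 : R)^'- (fun r => rsc r w) w.
Proof.
rewrite -[X in ccv _ _ X]mul1r; apply: ccvM; last exact: ccv_cst.
apply/ccvP; split => /=; last exact: cvg_cst.
by apply: cvg_at_left_filter; exact: cvg_id.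
Qed.

Lemma ccv_psum_left (a : nat -> C) (w : C) N :
  ccv (1 : R)^'- (fun r => psum a (rsc r w) N) (psum a w N).
Proof.
apply: ccv_sum => k; apply: ccvM; first exact: ccv_cst.
by apply: ccvX; exact: ccv_rsc_left.
Qed.

Lemma psum_truncate (a : nat -> C) z N m : (N <= m)%N ->
  psum a z m = psum a z N + psum (fun k => if (k < N)%N then 0 else a k) z m.
Proof.
move=> jm; rewrite /psum -(subnKC jm) !big_split_ord/=; congr (_ + _).
rewrite [X in _ = X + _]big1 => [|k _]; last by rewrite ltn_ord mul0r.
by rewrite add0r; apply: eq_bigr => k _; rewrite ltnNge leq_addr.
Qed.

Lemma sum_sqr_truncate (a : nat -> C) N m : (N <= m)%N ->
  \sum_(k < m) cabs (a k) ^+ 2 = \sum_(k < N) cabs (a k) ^+ 2 +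
    \sum_(k < m) cabs (if (k < N)%N then 0 else a k) ^+ 2.
Proof.
move=> jm; rewrite -(subnKC jm) !big_split_ord/=; congr (_ + _).
rewrite [X in _ = X + _]big1 => [|k _]; last by rewrite ltn_ord cabs0 expr0n.
by rewrite add0r; apply: eq_bigr => k _; rewrite ltnNge leq_addr.
Qed.

Variables (a : nat -> C) (f : C -> C) (M : R).
Hypothesis af : taylor_on_D a f.
Hypothesis aM : forall N, \sum_(k < N) cabs (a k) ^+ 2 <= M.

Let s N : R := \sum_(k < N) cabs (a k) ^+ 2.

Let s_nd m n : (m <= n)%N -> s m <= s n.
Proof.
move=> mn; rewrite /s -(subnKC mn) big_split_ord/= lerDl.
by rewrite sumr_ge0// => i _; rewrite sqr_ge0.
Qed.

Let s_tail (e : R) : 0 < e -> exists N, forall n, s n <= s N + e.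
Proof.
move=> e0; have cs : cvgn s.
  apply: nondecreasing_is_cvgn; first by move=> m n; exact: s_nd.
  by exists M => _ [N _ <-]; exact: aM.
have := @cvgr_dist_lt _ _ _ _ _ _ _ cs _ e0; case=> N _ hN; exists N => n.
have := hN N (leqnn N); rewrite /= ltr_distlC => /andP[h _].
have sn : s n <= limn s by apply: nondecreasing_cvgn_le => // i k; exact: s_nd.
lra.
Qed.

(** Tails of [l^2] norm at most [4^-j] are examined at height [2^-j]: the maximal inequality loses a
    factor [2^j], and exceptional sets of summable measure [O(2^-j)] remain. *)
Let tail_index j : {N | forall n, s n <= s N + ((4^-1) ^+ j) ^+ 2}.
Proof.
by apply: cid; apply: s_tail; rewrite !exprn_gt0// invr_gt0.
Qed.

(** Summing the indices makes the sequence nondecreasing, and the added [j] makes it unbounded. *)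
Let N_ j : nat := (j + \sum_(i < j.+1) sval (tail_index i))%N.

Let N_nd i j : (i <= j)%N -> (N_ i <= N_ j)%N.
Proof.
move=> ij; rewrite /N_ leq_add//.
have -> : j.+1 = (i.+1 + (j - i))%N by rewrite addSn subnKC.
by rewrite big_split_ord/= leq_addr.
Qed.

Let s_N_ j n : s n <= s (N_ j) + ((4^-1) ^+ j) ^+ 2.
Proof.
have := svalP (tail_index j) n => /le_trans; apply; rewrite lerD2r; apply: s_nd.
by rewrite /N_ big_ord_recr/= addnA leq_addl.
Qed.

(** Cut at [N_ j.+1], the series with these coefficients is the block of [a] between [N_ j] and
    [N_ j.+1]. *)
Let d j k : C := if (k < N_ j)%N then 0 else a k.

Let psum_split z j m : (N_ j <= m)%N -> psum a z m = psum a z (N_ j) + psum (d j) z m.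
Proof. exact: psum_truncate. Qed.

Let d_sqr j : \sum_(k < N_ j.+1) cabs (d j k) ^+ 2 <= ((4^-1) ^+ j) ^+ 2.
Proof.
have jj : (N_ j <= N_ j.+1)%N by exact: N_nd.
have := s_N_ j (N_ j.+1); rewrite /s.
by rewrite (sum_sqr_truncate a jj) lerD2l.
Qed.

Let half_gt0 j : 0 < (2^-1) ^+ j :> R.
Proof. by rewrite exprn_gt0// invr_gt0. Qed.

(** The bound is the product of [3 / 2^-j] from the maximal inequality and [6 pi 4^-j] from the
    integral of the block. *)
Let bad_spec j : {E : set R | [/\ measurable E,
    (mu E <= (18 * pi * (2^-1) ^+ j)%:E)%E &
    forall t rho, circ t -> ~ E t -> 0 <= rho < 1 ->
      cabs (psum (d j) (rsc rho (expi t)) (N_ j.+1)) <= (2^-1) ^+ j]}.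
Proof.
apply: cid; have [E [mE muE hE]] := radial_maximal (N_ j.+1) (d j) (half_gt0 j).
exists E; split => //; apply: le_trans muE _.
have d0 : 0 < (4^-1) ^+ j :> R by rewrite exprn_gt0// invr_gt0.
have c0 : 0 <= 3 / (2^-1) ^+ j :> R by rewrite divr_ge0// ltW.
apply: le_trans (lee_wpmul2l _ (integral_cabs_trigpoly d0 (d_sqr j))) _.
  by rewrite lee_fin.
rewrite -EFinM lee_fin.
have -> : (4^-1 : R) ^+ j = (2^-1) ^+ j * (2^-1) ^+ j.
  by rewrite -exprMn; congr (_ ^+ _); field.
rewrite le_eqVlt; apply/orP; left; apply/eqP.
by have := lt0r_neq0 (half_gt0 j) => ?; field.
Qed.

Let bad j : set R := sval (bad_spec j).

Let bad_sum : (\sum_(0 <= j <oo) mu (bad j) < +oo)%E.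
Proof.
apply: (@le_lt_trans _ _ (36 * pi)%:E); last exact: ltry.
apply: lime_le; first by apply: is_cvg_nneseries => n _ _; exact: measure_ge0.
apply: nearW => n; apply: (@le_trans _ _
    (\sum_(0 <= j < n) (18 * pi * (2^-1) ^+ j)%:E)%E).
  by apply: lee_sum => j _; case: (svalP (bad_spec j)).
rewrite sumEFin lee_fin big_mkord -mulr_sumr.
have := @geometric_sum_le R (2^-1) n; rewrite invr_ge0 ler0n/= invf_lt1// ltr1n.
move=> /(_ isT); rewrite (_ : (1 - 2^-1 : R)^-1 = 2); last by field.
by move=> h; have := ler_wpM2l (mulr_ge0 (ler0n R 18) (pi_ge0 R)) h; lra.
Qed.

(** Fatou's theorem for [H^2]. By Borel-Cantelli almost every [t] lies in finitely many bad sets,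
    and from then on the blocks are at most [2^-j] at all radii simultaneously. So the partial sums
    of index [N_ j] converge uniformly along the radius, and each of them is continuous up to the
    circle. *)
Lemma radial_limits_ae : exists B : set R, [/\ measurable B, mu B = 0 &
  forall t, circ t -> ~ B t -> has_radial f (expi t)].
Proof.
have mbad j : measurable (bad j) by case: (svalP (bad_spec j)).
exists (lim_sup_set bad); split.
- apply: bigcap_measurable => // n _; exact: bigcup_measurable.
- exact: lim_sup_set_cvg0.
move=> t tc tB.
have [J hJ] : exists J, forall j, (J <= j)%N -> ~ bad j t.
  apply: contrapT => /forallNP h; apply: tB => n _; apply: contrapT => nt.
  by apply: (h n) => j nj bj; apply: nt; exists j.
have step j rho : (J <= j)%N -> 0 <= rho < 1 ->
    cabs (psum a (rsc rho (expi t)) (N_ j.+1) - psum a (rsc rho (expi t)) (N_ j))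
      <= (2^-1) ^+ j.
  move=> Jj r01; rewrite (@psum_split _ j (N_ j.+1)) ?N_nd// addrAC subrr add0r.
  by case: (svalP (bad_spec j)) => _ _; apply => //; exact: hJ.
(* The geometric sum is kept in closed form, since the plain bound [2 * 2^-j] would not pass through
   the induction on [m]. *)
have tele j m rho : (J <= j)%N -> 0 <= rho < 1 ->
    cabs (psum a (rsc rho (expi t)) (N_ (j + m)) - psum a (rsc rho (expi t)) (N_ j))
      <= (2^-1) ^+ j * (2 - 2 * (2^-1) ^+ m).
  move=> Jj r01; elim: m => [|m ih]; first by rewrite addn0 subrr cabs0 expr0; lra.
  rewrite addnS; have := step (j + m)%N rho (leq_trans Jj (leq_addr _ _)) r01.
  rewrite exprD => h.
  rewrite -(subrK (psum a (rsc rho (expi t)) (N_ (j + m))) (psum a _ (N_ _.+1))).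
  rewrite -addrA (le_trans (cabsD _ _))//.
  have -> : (2^-1 : R) ^+ j * (2 - 2 * 2^-1 ^+ m.+1) =
     2^-1 ^+ j * 2^-1 ^+ m + 2^-1 ^+ j * (2 - 2 * 2^-1 ^+ m).
    by rewrite exprS; field.
  exact: lerD.
(* The full Taylor sums converge to [f], hence so do those of index [N_ (j + n0)], because this
   index is at least [n0]. *)
have close j rho : (J <= j)%N -> 0 <= rho < 1 ->
    cabs (f (rsc rho (expi t)) - psum a (rsc rho (expi t)) (N_ j)) <= 2 * (2^-1) ^+ j.
  move=> Jj r01; have cf := af (inD_rsc_expi t r01).
  apply/ler_addgt0Pr => e e0.
  move/cvgrPdist_lt : cf => /(_ _ e0)[n0 _ hn].
  have := hn (N_ (j + n0)) _; rewrite /= sub0r normrN ger0_norm ?cabs_ge0//.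
  have n0N : (n0 <= N_ (j + n0))%N by rewrite /N_ -addnA addnCA leq_addr.
  move=> /(_ n0N); rewrite -/(psum a _ _) => h1.
  have h2 := tele j n0 rho Jj r01.
  rewrite -(subrK (psum a (rsc rho (expi t)) (N_ (j + n0))) (f _)) -addrA.
  rewrite (le_trans (cabsD _ _))// [leLHS]addrC lerD//; last first.
    by rewrite cabs_distC ltW.
  rewrite (le_trans h2)// mulrC ler_wpM2r ?(ltW (half_gt0 j))//.
  by rewrite gerBl mulr_ge0// (ltW (half_gt0 n0)).
apply: ccv_cauchy => e e0.
have [j Jj je] : exists2 j, (J <= j)%N & 2 * (2^-1) ^+ j < e / 2 :> R.
  have h : (fun j => 2 * (2^-1) ^+ j : R) @ \oo --> (0 : R).
    rewrite -[X in _ --> X](mulr0 2); apply: cvgM; first exact: cvg_cst.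
    by apply: cvg_expr; rewrite ger0_norm ?invr_ge0// invf_lt1// ltr1n.
  move/cvgrPdist_lt : h => /(_ (e / 2)); rewrite divr_gt0// => /(_ isT)[n _ hn].
  exists (maxn J n); first exact: leq_maxl.
  have := hn (maxn J n) (leq_maxr _ _); rewrite /= sub0r normrN ger0_norm//.
exists (psum a (expi t) (N_ j)).
have := ccv_psum_left a (expi t) (N_ j).
move/cvgrPdist_lt => /(_ (e / 2)); rewrite divr_gt0// => /(_ isT) hp.
near=> rho.
have r01 : 0 <= rho < 1.
  apply/andP; split; last by near: rho; exact: nbhs_left_lt.
  by apply: ltW; near: rho; exact: nbhs_left_gt.
rewrite -(subrK (psum a (rsc rho (expi t)) (N_ j)) (f _)) -addrA.
apply: le_lt_trans (cabsD _ _) _.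
have h1 := close j rho Jj r01.
have h2 : cabs (psum a (rsc rho (expi t)) (N_ j) - psum a (expi t) (N_ j)) < e / 2.
  suff : `|0 - cabs (psum a (rsc rho (expi t)) (N_ j) - psum a (expi t) (N_ j))| < e / 2.
    by rewrite sub0r normrN ger0_norm ?cabs_ge0.
  by near: rho.
by rewrite [e]splitr ltrD// (le_lt_trans h1).
Unshelve. all: by end_near. Qed.

End RadialLimits.

(** * Dividing out Blaschke factors *)

Section BlaschkeDecomposition.
Variable R : realType.
Local Notation C := R[i].
Implicit Types (a b : nat -> C) (z : C) (M : R).

Definition l2_le a M : Prop := forall N, \sum_(k < N) cabs (a k) ^+ 2 <= M.
Definition l2 a : Prop := exists M, l2_le a M.

Lemma l2_absconv a : l2 a -> absconv a.
Proof.
move=> [M aM]; apply: (@bounded_absconv _ _ (M + 1)) => k.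
have h : cabs (a k) ^+ 2 <= M.
  apply: le_trans (aM k.+1); rewrite big_ord_recr/= lerDr.
  by rewrite sumr_ge0// => i _; rewrite sqr_ge0.
by have := sqr_ge0 (cabs (a k) - 1); have := cabs_ge0 (a k); nra.
Qed.

Lemma taylor_l2 a : l2 a -> taylor_on_D a (evs a).
Proof. by move=> /l2_absconv; exact: taylor_evs. Qed.

Lemma l2D a b : l2 a -> l2 b -> l2 (fun k => a k + b k).
Proof.
move=> [M aM] [M' bM]; exists (2 * M + 2 * M') => N.
apply: (@le_trans _ _ (2 * \sum_(k < N) cabs (a k) ^+ 2 +
  2 * \sum_(k < N) cabs (b k) ^+ 2)); last first.
  by rewrite lerD// ler_wpM2l.
rewrite !mulr_sumr -big_split/= ler_sum// => k _.
have := cabsD (a k) (b k); have := cabs_ge0 (a k + b k).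
by have := sqr_ge0 (cabs (a k) - cabs (b k)); nra.
Qed.

Lemma l2Z c a : l2 a -> l2 (fun k => c * a k).
Proof.
move=> [M aM]; exists (cabs c ^+ 2 * M) => N.
rewrite (eq_bigr (fun k : 'I_N => cabs c ^+ 2 * cabs (a k) ^+ 2)).
  by rewrite -mulr_sumr ler_wpM2l ?sqr_ge0 ?aM.
by move=> k _; rewrite cabsM exprMn.
Qed.

Lemma evsD a b z : l2 a -> l2 b -> inD z ->
  evs (fun k => a k + b k) z = evs a z + evs b z.
Proof.
move=> la lb zD.
exact: (taylor_unique (taylor_l2 (l2D la lb)) (taylorD (taylor_l2 la) (taylor_l2 lb))).
Qed.

Lemma evsZ c a z : l2 a -> inD z -> evs (fun k => c * a k) z = c * evs a z.
Proof.
move=> la zD.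
exact: (taylor_unique (taylor_l2 (l2Z c la)) (taylorZ c (taylor_l2 la))).
Qed.

Section step.
Variable alpha : C.
Hypothesis alphaD : inD alpha.
Hypothesis alpha0 : alpha != 0.
Local Notation alpha' := (conjc alpha).

Let A2_gt0 : 0 < 1 - cabs alpha ^+ 2.
Proof. by rewrite subr_gt0 expr_lt1// cabs_ge0. Qed.

(** Homogeneous form of [|1 - alpha w|^2 - |conj alpha - w|^2 = (1 - |alpha|^2) (1 - |w|^2)], the
    identity that makes a Blaschke factor unimodular on the circle. *)
Let identity (r r1 : C) : cabs (r - alpha * r1) ^+ 2 = cabs (alpha' * r - r1) ^+ 2 +
  (1 - cabs alpha ^+ 2) * (cabs r ^+ 2 - cabs r1 ^+ 2).
Proof.
by rewrite !cabs_sqr; case: alpha r r1 => x y [u v] [s t] /=; ring.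
Qed.

(* [tailq a v k] is [sum_(j >= k) a_j alpha^(j - k)] when [v] is the full sum
   [sum_j a_j alpha^j]; it satisfies [a_k = r_k - alpha r_(k+1)], so that
   [|a_k|^2 - |conj alpha r_k - r_(k+1)|^2] telescopes. *)
Definition tailq a (v : C) k : C := (v - psum a alpha k) / alpha ^+ k.

(** For [v = f(alpha)] these are the coefficients of the quotient by [bfactor alpha] of [f - (1 -
    |alpha|^2) f(alpha) / (1 - conj alpha z)]. The subtracted function is the orthogonal projection
    of [f] onto the Szego kernel at [alpha]. *)
Definition bstep a (v : C) k : C := alpha' * tailq a v k - tailq a v k.+1.

Let tailq_rec a v k : a k = tailq a v k - alpha * tailq a v k.+1.
Proof.
rewrite /tailq {2}/psum big_ord_recr/= exprS.
have ak : alpha ^+ k != 0 by rewrite expf_neq0.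
by rewrite -/(psum a alpha k); field; rewrite ak.
Qed.

Let telescope_sqr a v N : \sum_(k < N) cabs (a k) ^+ 2 =
  \sum_(k < N) cabs (bstep a v k) ^+ 2 +
  (1 - cabs alpha ^+ 2) * (cabs (tailq a v 0) ^+ 2 - cabs (tailq a v N) ^+ 2).
Proof.
elim: N => [|N ih]; first by rewrite !big_ord0 subrr mulr0 addr0.
rewrite !big_ord_recr/= ih (tailq_rec a v N) identity -/(bstep a v N).
by ring.
Qed.

Let tailq0 a v : tailq a v 0 = v.
Proof. by rewrite /tailq /psum big_ord0 subr0 expr0 divr1. Qed.

Let ccv_tailq a k : l2 a ->
  ccv \oo (fun m => tailq a (psum a alpha m) k) (tailq a (evs a alpha) k).
Proof.
move=> la; apply: ccvM; last exact: ccv_cst.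
by apply: ccvB; [exact: (taylor_l2 la)|exact: ccv_cst].
Qed.

(** With [v] the partial sum of length [m] instead of the full sum, [tailq] at [m] is exactly 0 and
    the telescoped identity has no remainder. The limit in [m] is taken afterwards, with only [N]
    terms kept. *)
Lemma bstep_le a M N : l2_le a M ->
  \sum_(k < N) cabs (bstep a (evs a alpha) k) ^+ 2 +
    (1 - cabs alpha ^+ 2) * cabs (evs a alpha) ^+ 2 <= M.
Proof.
move=> aM; have la : l2 a by exists M.
have h : (fun m => \sum_(k < N) cabs (bstep a (psum a alpha m) k) ^+ 2 +
    (1 - cabs alpha ^+ 2) * cabs (psum a alpha m) ^+ 2) @ \oo -->
  \sum_(k < N) cabs (bstep a (evs a alpha) k) ^+ 2 +
    (1 - cabs alpha ^+ 2) * cabs (evs a alpha) ^+ 2.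
  apply: cvgD.
    apply: (@cvg_big _ _ +%R 0) => //; first exact: add_continuous.
    move=> k _; apply: ccv_cabs2; apply: ccvB; last exact: ccv_tailq.
    by apply: ccvM; [exact: ccv_cst|exact: ccv_tailq].
  apply: cvgM; first exact: cvg_cst.
  by apply: ccv_cabs2; exact: (taylor_l2 la).
rewrite -(cvg_lim _ h)//; apply: limr_le; first by apply/cvg_ex; eexists; exact: h.
exists N => // m /= Nm; apply: le_trans (aM m).
rewrite (telescope_sqr a (psum a alpha m) m) tailq0.
rewrite [tailq _ _ m]/tailq subrr mul0r cabs0 expr0n/= subr0 lerD2r.
rewrite -(subnKC Nm) big_split_ord/= lerDl.
by rewrite sumr_ge0// => i _; rewrite sqr_ge0.
Qed.

Lemma bstep_l2_le a M : l2_le a M -> l2_le (bstep a (evs a alpha)) M.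
Proof.
move=> aM N; apply: le_trans (bstep_le N aM); rewrite lerDl.
by rewrite mulr_ge0 ?sqr_ge0// ltW.
Qed.

(** The sharp bound for point evaluation, obtained from [bstep_le] with an empty sum. *)
Lemma eval_l2_le a M : l2_le a M -> (1 - cabs alpha ^+ 2) * cabs (evs a alpha) ^+ 2 <= M.
Proof. by move=> /(bstep_le 0); rewrite big_ord0 add0r. Qed.

(** Boundedness in [k] is what makes [tailq k] times [z^k] tend to 0 in [bstep_eval]. It follows by
    comparing the telescoped identity at [k] with the one at a larger [m]. *)
Let tailq_le a M k : l2_le a M ->
  (1 - cabs alpha ^+ 2) * cabs (tailq a (evs a alpha) k) ^+ 2 <= M.
Proof.
move=> aM; have la : l2 a by exists M.
have h : (fun m => (1 - cabs alpha ^+ 2) * cabs (tailq a (psum a alpha m) k) ^+ 2)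
    @ \oo --> (1 - cabs alpha ^+ 2) * cabs (tailq a (evs a alpha) k) ^+ 2.
  by apply: cvgM; [exact: cvg_cst|exact: ccv_cabs2 (ccv_tailq _ la)].
rewrite -(cvg_lim _ h)//; apply: limr_le; first by apply/cvg_ex; eexists; exact: h.
exists k => // m /= km; apply: le_trans (aM m).
have e := telescope_sqr a (psum a alpha m) k.
rewrite (telescope_sqr a (psum a alpha m) m).
rewrite [tailq _ _ m]/tailq subrr mul0r cabs0 expr0n/=.
have a0 : 0 <= \sum_(i < k) cabs (a i) ^+ 2.
  by rewrite sumr_ge0// => i _; rewrite sqr_ge0.
have : \sum_(i < k) cabs (bstep a (psum a alpha m) i) ^+ 2 <=
    \sum_(i < m) cabs (bstep a (psum a alpha m) i) ^+ 2.
  rewrite -(subnKC km) big_split_ord/= lerDl.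
  by rewrite sumr_ge0// => i _; rewrite sqr_ge0.
by lra.
Qed.

Let bstep_psum a v z N :
  (alpha - z) * psum (bstep a v) z N = (1 - alpha' * z) * psum a z N +
  (1 - alpha * alpha') * (tailq a v N * z ^+ N - tailq a v 0).
Proof.
elim: N => [|N ih]; first by rewrite /psum !big_ord0 expr0 !mulr0 mulr1 subrr mulr0 addr0.
have aN := tailq_rec a v N.
rewrite /psum !big_ord_recr/= -!/(psum _ _ _) mulrDr ih aN /bstep exprS.
by ring.
Qed.

(** The limit of the finite identity [bstep_psum]; it justifies reading [bstep] as a quotient by the
    Blaschke factor. *)
Lemma bstep_eval a z : l2 a -> inD z ->
  (alpha - z) * evs (bstep a (evs a alpha)) z =
  (1 - alpha' * z) * evs a z - (1 - alpha * alpha') * evs a alpha.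
Proof.
move=> [M aM] zD; have la : l2 a by exists M.
have lb : l2 (bstep a (evs a alpha)) by exists M; exact: bstep_l2_le.
have h0 : ccv \oo (fun N => tailq a (evs a alpha) N * z ^+ N) 0.
  pose K := M / (1 - cabs alpha ^+ 2) + 1.
  have tK N : cabs (tailq a (evs a alpha) N) <= K.
    have := tailq_le N aM; rewrite mulrC -ler_pdivlMr// => h.
    have := sqr_ge0 (cabs (tailq a (evs a alpha) N) - 1).
    by have := cabs_ge0 (tailq a (evs a alpha) N); rewrite /K; nra.
  rewrite /ccv; apply: (@squeeze_cvgr _ _ _ _ (cst 0) (fun N => K * cabs z ^+ N)).
  - apply: nearW => N; rewrite cabs_ge0 subr0 cabsM cabsX ler_wpM2r//.
    by rewrite exprn_ge0// cabs_ge0.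
  - exact: cvg_cst.
  - rewrite -[X in _ --> X](mulr0 K); apply: cvgM; first exact: cvg_cst.
    by apply: cvg_expr; rewrite ger0_norm// cabs_ge0.
have l : ccv \oo (fun N => (alpha - z) * psum (bstep a (evs a alpha)) z N)
    ((alpha - z) * evs (bstep a (evs a alpha)) z).
  by apply: ccvM; [exact: ccv_cst|exact: (taylor_l2 lb)].
have r : ccv \oo (fun N => (1 - alpha' * z) * psum a z N + (1 - alpha * alpha') *
      (tailq a (evs a alpha) N * z ^+ N - tailq a (evs a alpha) 0))
    ((1 - alpha' * z) * evs a z + (1 - alpha * alpha') * (0 - tailq a (evs a alpha) 0)).
  apply: ccvD; first by apply: ccvM; [exact: ccv_cst|exact: (taylor_l2 la)].
  by apply: ccvM; [exact: ccv_cst|apply: ccvB => //; exact: ccv_cst].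
rewrite (ccv_unique l (ccv_ext _ r)).
  by rewrite tailq0 sub0r mulrN.
by move=> N; rewrite bstep_psum.
Qed.

End step.

End BlaschkeDecomposition.

(** * Uniform limits of polynomials, and division by a whole Blaschke product *)

Section BlaschkeProducts.
Variable R : realType.
Local Notation C := R[i].
Implicit Types (a b : nat -> C) (z : C) (M : R).

Lemma den_neq0 (alpha z : C) : inD alpha -> cabs z <= 1 -> 1 - conjc alpha * z != 0.
Proof.
move=> aD z1; rewrite subr_eq0; apply/eqP => /(congr1 (@cabs R)).
rewrite cabs1 cabsM cabs_conjc => e; have := cabs_ge0 z; have := cabs_ge0 alpha.
by move: aD; rewrite /inD; nra.
Qed.

Lemma szego_remainder (alpha z : C) N : inD alpha -> cabs z <= 1 ->
  psum (fun k => conjc alpha ^+ k) z N - (1 - conjc alpha * z)^-1 =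
  - ((conjc alpha * z) ^+ N / (1 - conjc alpha * z)).
Proof.
move=> aD z1; have d0 := den_neq0 aD z1.
apply: (mulfI d0); rewrite mulrBr divff// mulrN mulrCA divff// mulr1.
rewrite (_ : psum _ _ _ = \sum_(k < N) (conjc alpha * z) ^+ k); last first.
  by apply: eq_bigr => k _; rewrite exprMn.
by rewrite -[1 - _]opprB mulNr -subrX1; ring.
Qed.

Definition bfactor (alpha z : C) : C := (alpha - z) / (1 - conjc alpha * z).

Lemma cabs_bfactor_le1 alpha z : inD alpha -> cabs z <= 1 -> cabs (bfactor alpha z) <= 1.
Proof.
move=> aD z1; have d0 := den_neq0 aD z1.
rewrite /bfactor cabsM cabsV ler_pdivrMr ?cabs_gt0// mul1r.
rewrite -(ler_pXn2r (_ : 0 < 2)%N) ?nnegrE ?cabs_ge0// -subr_ge0.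
rewrite (_ : _ - _ = (1 - cabs alpha ^+ 2) * (1 - cabs z ^+ 2)).
  rewrite mulr_ge0// subr_ge0 exprn_ile1 ?cabs_ge0//.
  exact: ltW.
by rewrite !cabs_sqr; case: (alpha) (z) => x y [u v] /=; ring.
Qed.

(** Membership in the disc algebra, through uniform polynomial approximation on the closed disc. The
    common bound [K] serves as the dominating constant when integrals of the approximants pass to
    the limit. *)
Definition polylim (h : C -> C) : Prop := exists (Q : nat -> {poly C}) (K : R),
  (forall N z, cabs z <= 1 -> cabs (Q N).[z] <= K) /\
  forall e, 0 < e -> exists N0, forall N, (N0 <= N)%N ->
    forall z, cabs z <= 1 -> cabs ((Q N).[z] - h z) <= e.

Lemma polylim_ccv h : polylim h -> exists (Q : nat -> {poly C}) (K : R),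
  (forall N z, cabs z <= 1 -> cabs (Q N).[z] <= K) /\
  forall z, cabs z <= 1 -> ccv \oo (fun N => (Q N).[z]) (h z).
Proof.
move=> [Q [K [QK Qh]]]; exists Q, K; split => // z z1.
apply/cvgrPdist_le => e e0; have [N0 hN0] := Qh _ e0; exists N0 => // N /= N0N.
by rewrite sub0r normrN ger0_norm ?cabs_ge0// hN0.
Qed.

Lemma polylim_bounded h : polylim h -> exists K, forall z, cabs z <= 1 -> cabs (h z) <= K.
Proof.
move=> [Q [K [QK Qh]]]; exists (K + 1) => z z1; have [N0 hN0] := Qh _ ltr01.
have := hN0 N0 (leqnn _) z z1; have := QK N0 z z1.
by have := lerB_cabs (h z) (Q N0).[z]; rewrite cabs_distC; lra.
Qed.

Lemma polylim_horner (p : {poly C}) : polylim (horner p).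
Proof.
exists (fun=> p), (\sum_(k < size p) cabs p`_k); split => [_ z z1|e e0].
  rewrite horner_coef (le_trans (cabs_sum _ _ _))// ler_sum// => k _.
  by rewrite cabsM cabsX ler_piMr ?cabs_ge0// exprn_ile1// cabs_ge0.
by exists 0%N => N _ z _; rewrite subrr cabs0 ltW.
Qed.

Lemma polylimM g h : polylim g -> polylim h -> polylim (fun z => g z * h z).
Proof.
move=> [Q [K [QK Qg]]] hh; have [L hL] := polylim_bounded hh.
have [Q' [K' [QK' Qh]]] := hh.
exists (fun N => Q N * Q' N), (K * K'); split => [N z z1|e e0].
  by rewrite hornerM cabsM ler_pM ?cabs_ge0 ?QK ?QK'.
have c0 : cabs (0 : C) <= 1 by rewrite cabs0.
have K0 : 0 <= K := le_trans (cabs_ge0 _) (QK 0%N 0 c0).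
have L0 : 0 <= L := le_trans (cabs_ge0 _) (hL 0 c0).
pose d := e / (K + L + 1).
have d0 : 0 < d by rewrite divr_gt0// ltr_wpDl// addr_ge0.
have de : K * d + L * d <= e.
  have -> : e = d * (K + L + 1) by rewrite /d divfK// gt_eqF// ltr_wpDl// addr_ge0.
  by move: (ltW d0); nra.
have [N1 h1] := Qg _ d0; have [N2 h2] := Qh _ d0.
exists (maxn N1 N2) => N; rewrite geq_max => /andP[N1N N2N] z z1.
rewrite hornerM (_ : _ - _ = (Q N).[z] * ((Q' N).[z] - h z) +
  h z * ((Q N).[z] - g z)); last by ring.
apply: le_trans (cabsD _ _) _; rewrite !cabsM; apply: le_trans de.
by apply: lerD; apply: ler_pM; rewrite ?cabs_ge0 ?QK ?hL ?h1 ?h2.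
Qed.

Lemma polylim_szego alpha : inD alpha -> polylim (fun z => (1 - conjc alpha * z)^-1).
Proof.
move=> aD; exists (fun N => \poly_(k < N) conjc alpha ^+ k), (1 - cabs alpha)^-1.
have a01 : 0 <= cabs alpha < 1 by rewrite cabs_ge0.
have hp N z : (\poly_(k < N) conjc alpha ^+ k).[z] =
    psum (fun k => conjc alpha ^+ k) z N by rewrite horner_poly.
split=> [N z z1|e e0].
  rewrite hp (le_trans (cabs_psum_le _ _ z1))//.
  apply: le_trans (geometric_sum_le N a01).
  by apply: ler_sum => k _; rewrite expr1n mulr1 cabsX cabs_conjc.
have h : (fun N => cabs alpha ^+ N * (1 - cabs alpha)^-1) @ \oo --> (0 : R).
  rewrite -[X in _ --> X](mul0r (1 - cabs alpha)^-1); apply: cvgM; last exact: cvg_cst.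
  by apply: cvg_expr; rewrite ger0_norm ?cabs_ge0.
move/cvgrPdist_le : h => /(_ _ e0)[N0 _ hN0]; exists N0 => N N0N z z1.
have := hN0 N N0N; rewrite /= sub0r normrN ger0_norm; last first.
  by rewrite mulr_ge0 ?exprn_ge0 ?cabs_ge0// invr_ge0 subr_ge0 ltW.
apply: le_trans; rewrite hp szego_remainder// cabsN cabsM cabsV cabsX cabsM cabs_conjc.
have az : cabs alpha * cabs z <= cabs alpha by rewrite ler_piMr ?cabs_ge0.
apply: ler_pM; rewrite ?exprn_ge0 ?invr_ge0 ?mulr_ge0 ?cabs_ge0//.
  by rewrite lerXn2r// nnegrE ?mulr_ge0 ?cabs_ge0.
have := lerB_cabs 1 (conjc alpha * z); rewrite cabs1 cabsM cabs_conjc => h1.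
rewrite lef_pV2 ?posrE ?subr_gt0//; first by lra.
by apply: lt_le_trans h1; rewrite subr_gt0 (le_lt_trans az).
Qed.

Lemma polylim_bfactor alpha : inD alpha -> polylim (bfactor alpha).
Proof.
move=> aD; rewrite (_ : bfactor alpha =
    fun z => (alpha%:P - 'X).[z] * (1 - conjc alpha * z)^-1).
  by apply: polylimM; [exact: polylim_horner|exact: polylim_szego].
by apply/funext => z; rewrite !hornerE.
Qed.

Definition linear_l2 (c : (nat -> C) -> C) : Prop :=
  (forall a b, l2 a -> l2 b -> c (fun k => a k + b k) = c a + c b) /\
  (forall x a, l2 a -> c (fun k => x * a k) = x * c a).

(** Only the [c i] have to be linear, since they define the operator of rank at most [d]; the
    quotient [b] enters through its norm alone and may be chosen arbitrarily. The [e i] lie in the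
    disc algebra so that [e i o phi] belongs to [H^2]. *)
Definition decomposable (d : nat) (B : C -> C) : Prop :=
  exists (c : 'I_d -> (nat -> C) -> C) (e : 'I_d -> C -> C),
    [/\ forall i, linear_l2 (c i), forall i, polylim (e i) &
      forall a M, l2_le a M -> exists2 b, l2_le b M &
        forall z, inD z -> evs a z = \sum_(i < d) c i a * e i z + B z * evs b z].

Lemma decomposable1 : decomposable 0 (fun=> 1).
Proof.
exists (fun i _ => 0), (fun i _ => 0); split; [by case|by case|].
by move=> a M aM; exists a => // z _; rewrite big_ord0 add0r mul1r.
Qed.

(** [S] is division by the single factor [h] after removal of a multiple of [e0]. Decomposing [S a]
    along [B] and multiplying by [h] adds just one dimension. *)
Lemma decomposable_step d B (h e0 : C -> C) (c0 : (nat -> C) -> C)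
    (S : (nat -> C) -> nat -> C) :
  polylim h -> polylim e0 -> linear_l2 c0 ->
  (forall a M, l2_le a M -> l2_le (S a) M) ->
  (forall a b, l2 a -> l2 b -> S (fun k => a k + b k) = fun k => S a k + S b k) ->
  (forall x a, l2 a -> S (fun k => x * a k) = fun k => x * S a k) ->
  (forall a z, l2 a -> inD z -> evs a z = c0 a * e0 z + h z * evs (S a) z) ->
  decomposable d B -> decomposable d.+1 (fun z => h z * B z).
Proof.
move=> hh e0H c0l SM SD SZ dec [c [e [cl eH cB]]].
have lS a : l2 a -> l2 (S a) by move=> [M /SM aM]; exists M.
exists (fun i a => if unlift ord0 i is Some j then c j (S a) else c0 a),
  (fun i z => if unlift ord0 i is Some j then h z * e j z else e0 z); split.
- move=> i; case: (unlift ord0 i) => [j|//].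
  have [cD cZ] := cl j; split => [a b la lb|x a la].
    by rewrite SD// cD//; exact: lS.
  by rewrite SZ// cZ//; exact: lS.
- by move=> i; case: (unlift ord0 i) => [j|//]; exact: polylimM.
- move=> a M aM; have [b bM hb] := cB _ _ (SM _ _ aM); exists b => // z zD.
  rewrite dec//; last by exists M.
  rewrite hb// big_ord_recl unlift_none mulrDr mulrA -addrA; congr (_ + (_ + _)).
  rewrite mulr_sumr; apply: eq_bigr => j _; rewrite liftK.
  by rewrite mulrCA.
Qed.

(** Division by [z] is the backward shift after removal of the constant term. A zero at the origin
    is treated apart because [tailq] divides by powers of [alpha]. *)
Lemma decomposableX d B : decomposable d B -> decomposable d.+1 (fun z => z * B z).
Proof.
apply: (@decomposable_step _ _ _ (fun=> 1) (fun a => a 0%N) (fun a k => a k.+1)) => //.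
- rewrite (_ : (fun z => z) = horner 'X); first exact: polylim_horner.
  by apply/funext => z; rewrite hornerX.
- rewrite (_ : (fun z => 1) = horner 1%:P); first exact: polylim_horner.
  by apply/funext => z; rewrite hornerC.
- move=> a M aM N; apply: le_trans (aM N.+1).
  by rewrite big_ord_recl lerDr sqr_ge0.
- move=> a z la zD; rewrite mulr1.
  have lS : l2 (fun k => a k.+1).
    case: la => M aM; exists M => N; apply: le_trans (aM N.+1).
    by rewrite big_ord_recl lerDr sqr_ge0.
  have h1 : ccv \oo (fun N => a 0%N + z * psum (fun k => a k.+1) z N)
     (a 0%N + z * evs (fun k => a k.+1) z).
    apply: ccvD; first exact: ccv_cst.
    by apply: ccvM; [exact: ccv_cst|exact: (taylor_l2 lS)].
  have h2 : ccv \oo (fun N => psum a z N.+1) (evs a z).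
    by rewrite /ccv (cvg_shiftS (fun N => cabs (psum a z N - evs a z)));
      exact: (taylor_l2 la).
  apply: (ccv_unique h2); apply: (ccv_ext _ h1) => N.
  rewrite /psum big_ord_recl expr0 mulr1 mulr_sumr; congr (_ + _).
  by apply: eq_bigr => k _; rewrite lift0 exprS mulrCA.
Qed.

Lemma decomposable_bfactor d B alpha : inD alpha -> alpha != 0 ->
  decomposable d B -> decomposable d.+1 (fun z => bfactor alpha z * B z).
Proof.
move=> aD a0.
have A2_gt0 : 0 < 1 - cabs alpha ^+ 2 by rewrite subr_gt0 expr_lt1// cabs_ge0.
apply: (@decomposable_step _ _ _ (fun z => (1 - conjc alpha * z)^-1)
  (fun a => (1 - alpha * conjc alpha) * evs a alpha)
  (fun a => bstep alpha a (evs a alpha))).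
- exact: polylim_bfactor.
- exact: polylim_szego.
- split=> [a b la lb|x a la]; first by rewrite evsD// mulrDr.
  by rewrite evsZ// mulrCA.
- by move=> a M; exact: bstep_l2_le.
- move=> a b la lb; apply/funext => k; rewrite evsD//.
  have pD N : psum (fun k => a k + b k) alpha N = psum a alpha N + psum b alpha N.
    by rewrite /psum -big_split/=; apply: eq_bigr => i _; rewrite mulrDl.
  by rewrite /bstep /tailq !pD; ring.
- move=> x a la; apply/funext => k; rewrite evsZ//.
  have pZ N : psum (fun k => x * a k) alpha N = x * psum a alpha N.
    by rewrite /psum mulr_sumr; apply: eq_bigr => i _; rewrite mulrA.
  by rewrite /bstep /tailq !pZ; ring.
- move=> a z la zD; have d0 := den_neq0 aD (ltW zD).
  apply: (mulfI d0); rewrite mulrDr /bfactor.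
  rewrite [_ * (_ * _^-1)]mulrCA divff// mulr1.
  rewrite mulrA [_ * (_ / _)]mulrCA divff// mulr1 bstep_eval//.
  by ring.
Qed.

Lemma decomposable_blaschke m (w : seq C) :
  (forall alpha, alpha \in w -> inD alpha /\ alpha != 0) ->
  decomposable (m + size w) (blaschke m w).
Proof.
move=> hw; elim: m => [|m ih].
  elim: w hw => [|alpha w ih] hw.
    rewrite (_ : blaschke 0 [::] = fun=> 1); first exact: decomposable1.
    by apply/funext => z; rewrite /blaschke big_nil expr0 mulr1.
  have [aD a0] := hw alpha (mem_head _ _).
  rewrite (_ : blaschke _ _ = fun z => bfactor alpha z * blaschke 0 w z).
    apply: decomposable_bfactor => //; apply: ih => b bw.
    by apply: hw; rewrite inE bw orbT.
  by apply/funext => z; rewrite /blaschke big_cons !expr0 !mul1r.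
rewrite (_ : blaschke _ _ = fun z => z * blaschke m w z); first exact: decomposableX.
by apply/funext => z; rewrite /blaschke exprS mulrA.
Qed.

Lemma polylim_blaschke m (w : seq C) :
  (forall alpha, alpha \in w -> inD alpha /\ alpha != 0) -> polylim (blaschke m w).
Proof.
move=> hw; apply: polylimM.
  rewrite (_ : (fun z => _) = horner ('X^m)); first exact: polylim_horner.
  by apply/funext => z; rewrite hornerXn.
elim: w hw => [|alpha w ih] hw.
  rewrite (_ : (fun z => _) = horner 1%:P); first exact: polylim_horner.
  by apply/funext => z; rewrite big_nil hornerC.
rewrite (_ : (fun z => _) = (fun z => bfactor alpha z *
   \prod_(a <- w) ((a - z) / (1 - conjc a * z)))); last first.
  by apply/funext => z; rewrite big_cons.
have [aD a0] := hw alpha (mem_head _ _).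
apply: polylimM; first exact: polylim_bfactor.
by apply: ih => b bw; apply: hw; rewrite inE bw orbT.
Qed.

Lemma cabs_blaschke_le1 m (w : seq C) z :
  (forall alpha, alpha \in w -> inD alpha /\ alpha != 0) -> cabs z <= 1 ->
  cabs (blaschke m w z) <= 1.
Proof.
move=> hw z1; rewrite /blaschke cabsM cabsX.
apply: mulr_ile1; rewrite ?cabs_ge0 ?exprn_ge0 ?cabs_ge0 ?exprn_ile1 ?cabs_ge0//.
elim: w hw => [|alpha w ih] hw; first by rewrite big_nil cabs1.
rewrite big_cons cabsM mulr_ile1 ?cabs_ge0//.
  by apply: cabs_bfactor_le1 => //; case: (hw alpha (mem_head _ _)).
by apply: ih => b bw; apply: hw; rewrite inE bw orbT.
Qed.

End BlaschkeProducts.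

(** * Uniform limits and boundary values *)

Section UniformLimits.
Variable R : realType.
Local Notation C := R[i].
Local Notation mu := (@lebesgue_measure R).
Local Notation circ := (`[0, 2 * pi]%classic : set R).

Lemma H2norm2_le_sup (f : C -> C) (K : R) : analytic_D f ->
  (forall z, inD z -> cabs (f z) <= K) -> (H2norm2 f <= (K ^+ 2)%:E)%E.
Proof.
move=> [a af] fK; apply: H2norm2_le => r /andP[r0 r1].
have K0 : 0 <= K by apply: le_trans (cabs_ge0 (f 0)) (fK _ _); rewrite /inD cabs0.
have muE : mu circ = (2 * pi)%:E.
  by rewrite lebesgue_measure_itv/= lte_fin twopi_gt0 oppr0 adde0.
rewrite int_mean2E.
apply: (@le_trans _ _ (((2 * pi)^-1)%:E * ((K ^+ 2)%:E * (2 * pi)%:E))%E); last first.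
  rewrite -!EFinM lee_fin mulrCA mulVf ?mulr1// gt_eqF// twopi_gt0//.
rewrite lee_wpmul2l ?invtwopi_ge0//.
have -> : ((K ^+ 2)%:E * (2 * pi)%:E)%E = sqint circ (fun=> Complex K 0).
  rewrite /sqint cabs_real real_normK ?num_real// integral_cst//.
  by rewrite (congr1 (mule (K ^+ 2)%:E) muE).
apply: le_sqint => //.
- by apply: cmeas_taylor af; rewrite (ltW r0).
- move=> t _; rewrite cabs_real ger0_norm//; apply: fK.
  by apply: inD_rsc_expi; rewrite (ltW r0).
Qed.

(** Cauchy's estimate, here read off from Parseval: a single coefficient is bounded by the [H^2]
    norm, hence by the supremum. *)
Lemma taylor_coef_le_sup (a : nat -> C) (f : C -> C) (K : R) k : taylor_on_D a f ->
  (forall z, inD z -> cabs (f z) <= K) -> cabs (a k) <= K.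
Proof.
move=> af fK; have fa : analytic_D f by exists a.
have K0 : 0 <= K by apply: le_trans (cabs_ge0 (f 0)) (fK _ _); rewrite /inD cabs0.
have := (H2norm2_leP _ af).1 (H2norm2_le_sup fa fK) k.+1.
rewrite big_ord_recr/= => h; rewrite -(ler_pXn2r (_ : 0 < 2)%N) ?nnegrE ?cabs_ge0//.
by apply: le_trans h; rewrite lerDr sumr_ge0// => i _; rewrite sqr_ge0.
Qed.

(** Weierstrass' theorem: by [taylor_coef_le_sup] the coefficients of [F N] are Cauchy uniformly in
    the index [k], and their limits are the coefficients of [f]. *)
Lemma analytic_uniform_limit (F : nat -> C -> C) (f : C -> C) :
  (forall N, analytic_D (F N)) ->
  (forall e : R, 0 < e -> exists N0, forall N, (N0 <= N)%N ->
     forall z, inD z -> cabs (F N z - f z) <= e) ->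
  analytic_D f.
Proof.
move=> Fa Ff; have [a ha] := choice Fa.
have close e : 0 < e -> exists N0, forall N, (N0 <= N)%N -> forall k,
    cabs (a N k - a N0 k) <= e.
  move=> e0; have e20 : 0 < e / 2 by rewrite divr_gt0.
  have [N0 hN0] := Ff _ e20; exists N0 => N N0N k.
  have -> : a N k - a N0 k = a N k + -1 * a N0 k by rewrite mulN1r.
  apply: (@taylor_coef_le_sup (fun k => a N k + -1 * a N0 k)
    (fun z => F N z + -1 * F N0 z)).
    by apply: taylorD => //; exact: taylorZ.
  move=> z zD; have -> : F N z + -1 * F N0 z = (F N z - f z) - (F N0 z - f z).
    by ring.
  rewrite (le_trans (cabsD _ _))// cabsN.
  by have := hN0 _ N0N _ zD; have := hN0 _ (leqnn _) _ zD; lra.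
have lim k : exists l, ccv \oo (fun N => a N k) l.
  apply: ccv_cauchy => e e0; have e20 : 0 < e / 2 by rewrite divr_gt0.
  have [N0 hN0] := close _ e20; exists (a N0 k); exists N0 => // N /= N0N.
  by have := hN0 _ N0N k; lra.
have [l hl] := choice lim; exists l => z zD.
have z1 : 0 < 1 - cabs z by rewrite subr_gt0.
(* The budget of [d]: replacing the limit coefficients by those of [F N0] costs [2 d / (1 - |z|)],
   the Taylor remainder of [F N0] costs [d], and passing from [F N0] to [f] costs [d]. *)
apply/cvgrPdist_le => e e0; pose d := e / (2 * (1 - cabs z)^-1 + 2).
have c0 : 0 < (1 - cabs z)^-1 by rewrite invr_gt0.
have d0 : 0 < d by rewrite divr_gt0// addr_gt0// mulr_gt0.
have de : 2 * d * (1 - cabs z)^-1 + 2 * d <= e.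
  have -> : e = d * (2 * (1 - cabs z)^-1 + 2).
    by rewrite /d divfK// gt_eqF// addr_gt0// mulr_gt0.
  by lra.
have [N1 h1] := close _ d0; have [N2 h2] := Ff _ d0.
pose N0 := maxn N1 N2.
have lN0 k : cabs (l k - a N0 k) <= 2 * d.
  have hc : (fun N => cabs (a N k - a N0 k)) @ \oo --> cabs (l k - a N0 k).
    by apply: ccv_cabs; apply: ccvB; [exact: hl|exact: ccv_cst].
  rewrite -(cvg_lim _ hc)//; apply: limr_le; first by apply/cvg_ex; eexists; exact: hc.
  exists N1 => // N /= N1N.
  rewrite (_ : _ - _ = (a N k - a N1 k) - (a N0 k - a N1 k)); last by ring.
  rewrite (le_trans (cabsD _ _))// cabsN.
  by have := h1 _ N1N k; have := h1 N0 (leq_maxl _ _) k; lra.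
have := ha N0 z zD => /cvgrPdist_le /(_ _ d0)[M0 _ hM0]; exists M0 => // M /= M0M.
have := hM0 M M0M; rewrite /= !sub0r !normrN !ger0_norm ?cabs_ge0//.
rewrite -!/(psum _ _ _) => h3; apply: le_trans de.
rewrite (_ : _ - _ = (psum l z M - psum (a N0) z M) + ((psum (a N0) z M - F N0 z) +
  (F N0 z - f z))); last by ring.
apply: le_trans (cabsD _ _) _; apply: lerD.
  rewrite (_ : _ - _ = psum (fun k => l k - a N0 k) z M); last first.
    by rewrite /psum -sumrB; apply: eq_bigr => k _; rewrite mulrBl.
  apply: le_trans (cabs_psum_le _ _ (lexx _)) _.
  apply: (@le_trans _ _ (2 * d * \sum_(k < M) cabs z ^+ k)).
    by rewrite mulr_sumr ler_sum// => k _; rewrite ler_wpM2r// exprn_ge0// cabs_ge0.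
  rewrite ler_wpM2l ?geometric_sum_le ?cabs_ge0//.
  by rewrite mulr_ge0// ltW.
apply: le_trans (cabsD _ _) _.
by have := h2 N0 (leq_maxr _ _) z zD; lra.
Qed.

Lemma inH2_polylim (h phi : C -> C) : polylim h -> selfmap_D phi ->
  inH2 (fun z => h (phi z)).
Proof.
move=> hh [pa pD]; have [K hK] := polylim_bounded hh.
have [Q [_ [_ hQ]]] := hh.
have ha : analytic_D (fun z => h (phi z)).
  apply: (@analytic_uniform_limit (fun N z => (Q N).[phi z])).
    by move=> N; exact: analytic_horner.
  move=> e /hQ[N0 hN0]; exists N0 => N N0N z zD.
  by apply: hN0 => //; apply: ltW; exact: pD.
split=> //; apply: (@le_lt_trans _ _ (K ^+ 2)%:E); last exact: ltry.
by apply: H2norm2_le_sup => // z zD; apply: hK; apply: ltW; exact: pD.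
Qed.

End UniformLimits.

(** * Boundary values of the self-map and the splitting of the circle *)

Section BoundaryValues.
Variable R : realType.
Local Notation C := R[i].
Local Notation mu := (@lebesgue_measure R).
Local Notation circ := (`[0, 2 * pi]%classic : set R).

Lemma bval_eq (f : C -> C) (w l : C) : radial_lim f w l -> bval f w = l.
Proof.
move=> fl; apply: xget_unique => // y /= fy.
exact: (@ccv_unique R R (1 : R)^'- _ _ _ _ fy fl).
Qed.

Lemma radial_lim_bval (f : C -> C) (w : C) : has_radial f w -> radial_lim f w (bval f w).
Proof. by move=> [l fl]; rewrite (bval_eq fl). Qed.

(** This is what testing with polynomials buys: the extension by radial limits, which the Carleson
    integral uses where [|phi| = 1], is plain evaluation. *)
Lemma ext_f_horner (p : {poly C}) (w : C) : cabs w <= 1 -> ext_f (horner p) w = p.[w].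
Proof.
move=> w1; rewrite /ext_f; case: ifP => // _; apply: bval_eq.
by apply: ccv_horner; exact: ccv_rsc_left.
Qed.

(** A sequence of radii increasing to 1, as the convergence theorems for integrals act on sequences;
    the shift by 2 keeps even the first radius positive. *)
Definition radius (m : nat) : R := 1 - m.+2%:R^-1.

Lemma radius01 m : 0 < radius m < 1.
Proof.
by rewrite /radius subr_gt0 invf_lt1// ltr1n/= gtrBl invr_gt0.
Qed.

Lemma cvg_radius : radius @ \oo --> (1 : R).
Proof.
rewrite -[X in _ --> X]subr0; apply: cvgB; first exact: cvg_cst.
by rewrite (cvg_shiftS (fun m => m.+1%:R^-1 : R)); exact: cvg_harmonic.
Qed.

Lemma cvg_radius_left (f : R -> C) (l : C) : ccv (1 : R)^'- f l ->
  ccv \oo (fun m => f (radius m)) l.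
Proof.
move=> fl; apply/cvgrPdist_lt => e e0.
move/cvgrPdist_lt : fl => /(_ _ e0)[d /= d0 hd].
move/cvgrPdist_lt : cvg_radius => /(_ _ d0)[N _ hN].
exists N => // m Nm; apply: hd; first exact: hN.
by case/andP : (radius01 m).
Qed.

Variable phi : C -> C.
Hypothesis phiD : selfmap_D phi.

Let phi_lt1 r t : 0 <= r < 1 -> cabs (phi (rsc r (expi t))) < 1.
Proof. by move=> r01; apply: (phiD.2); exact: inD_rsc_expi. Qed.

(** A self-map is bounded by 1, so Fatou's theorem applies. The point [2 * pi] joins the null set
    because [int_mean2] integrates over the closed interval and [mu_phi_r_int2] over the half-open
    one. *)
Lemma selfmap_radial_limits : exists B : set R, [/\ measurable B, mu B = 0 &
  forall t, circ t -> ~ B t -> t < 2 * pi /\ has_radial phi (expi t)].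
Proof.
have [[a ta] pD] := phiD.
have [|B [mB B0 hB]] := @radial_limits_ae _ a phi (1 ^+ 2) ta.
  apply/(H2norm2_leP _ ta); apply: H2norm2_le_sup; first by exists a.
  by move=> z zD; apply: ltW; exact: pD.
exists (B `|` [set 2 * pi]); split.
- by apply: measurableU => //; exact: measurable_set1.
- by apply: null_set_setU => //; exact: lebesgue_measure_set1.
- move=> t ct /not_orP[nB t2]; split; last exact: hB.
  by move: ct; rewrite /= in_itv/= => /andP[_]; rewrite le_eqVlt => /predU1P[].
Qed.

Section boundary.
Variable B : set R.
Hypotheses (mB : measurable B) (B0 : mu B = 0)
  (hB : forall t, circ t -> ~ B t -> t < 2 * pi /\ has_radial phi (expi t)).
Local Notation D0 := (circ `\` B).
Local Notation psi := (fun t => bval phi (expi t)).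

Let mD0 : measurable D0. Proof. exact: measurableD. Qed.

Let muD0 : (mu D0 < +oo)%E.
Proof.
apply: le_lt_trans (mu_circle R); by apply: le_measure; rewrite ?inE.
Qed.

Let psi_lim t : D0 t -> ccv \oo (fun m => phi (rsc (radius m) (expi t))) (psi t).
Proof.
move=> [ct nBt].
apply: (@cvg_radius_left (fun r => phi (rsc r (expi t)))).
exact: radial_lim_bval (hB ct nBt).2.
Qed.

Let radius01' m : 0 <= radius m < 1.
Proof. by have /andP[/ltW -> ->] := radius01 m. Qed.

Lemma cabs_boundary_le1 t : D0 t -> cabs (psi t) <= 1.
Proof.
move=> /psi_lim /ccv_cabs h; rewrite -(cvg_lim _ h)//; apply: limr_le.
  by apply/cvg_ex; eexists; exact: h.
by apply: nearW => m; apply: ltW; exact: phi_lt1.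
Qed.

Let cmeas_phi D r : 0 <= r < 1 -> cmeas D (fun t => phi (rsc r (expi t))).
Proof. by move=> r01; have [[a ta] _] := phiD; exact: cmeas_taylor ta. Qed.

Lemma cmeas_boundary : cmeas D0 psi.
Proof.
apply: (@cmeas_lim _ _ (fun m t => phi (rsc (radius m) (expi t)))) => //.
by move=> m; exact: cmeas_phi.
Qed.

Let sqint_D0 f : cmeas circ f -> sqint circ f = sqint D0 f.
Proof.
move=> mf; apply: ge0_negligible_integral => //; first exact: measurable_cabs2E.
by move=> t _; rewrite lee_fin sqr_ge0.
Qed.

Let horner_bounded (q : {poly C}) : exists K, forall z, cabs z <= 1 -> cabs q.[z] <= K.
Proof. exact: polylim_bounded (polylim_horner q). Qed.

Lemma cvg_int_mean2_boundary (q : {poly C}) :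
  (fun m => int_mean2 (fun z => q.[phi z]) (radius m)) @ \oo -->
  (((2 * pi)^-1)%:E * sqint D0 (fun t => q.[psi t]))%E.
Proof.
have [K hK] := horner_bounded q.
apply: cvgeZl => //.
rewrite (_ : (fun m => _) =
    fun m => sqint D0 (fun t => q.[phi (rsc (radius m) (expi t))])).
  apply: (@sqint_dominated _ _ (fun m t => q.[phi (rsc (radius m) (expi t))]) _ K) => //.
  - by move=> m; apply: cmeas_horner; exact: cmeas_phi.
  - by move=> t Dt; apply: ccv_horner; exact: psi_lim.
  - by move=> m t _; apply: hK; apply: ltW; exact: phi_lt1.
apply/funext => m; rewrite -sqint_D0//.
by apply: cmeas_horner; exact: cmeas_phi.
Qed.

Lemma boundary_le_H2norm2 (q : {poly C}) :
  (((2 * pi)^-1)%:E * sqint D0 (fun t => q.[psi t]) <= H2norm2 (fun z => q.[phi z]))%E.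
Proof.
have h := @cvg_int_mean2_boundary q.
rewrite -(cvg_lim _ h)//; apply: lime_le; first by apply/cvg_ex; eexists; exact: h.
by apply: nearW => m; apply: int_mean2_le_H2norm2; exact: radius01.
Qed.

(** The means increase with the radius, so each is at most their limit, the boundary integral. *)
Lemma int_mean2_le_boundary (q : {poly C}) r : 0 < r < 1 ->
  (int_mean2 (fun z => q.[phi z]) r <=
   ((2 * pi)^-1)%:E * sqint D0 (fun t => q.[psi t]))%E.
Proof.
move=> /andP[r0 r1]; have h := @cvg_int_mean2_boundary q.
rewrite -(cvg_lim _ h)//; apply: lime_ge; first by apply/cvg_ex; eexists; exact: h.
have : \forall m \near \oo, r <= radius m by apply: (cvgr_ge _ cvg_radius).
apply: filterS => m rm; apply: le_int_mean2 => //; last 2 first.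
- exact: ltW.
- by case/andP : (radius01 m).
by apply: analytic_horner; exact: phiD.1.
Qed.

(** The inequality for polynomial approximants, taken to the limit on both sides while [r] stays
    fixed. *)
Lemma int_mean2_polylim_le_boundary (h : C -> C) r : polylim h -> 0 < r < 1 ->
  (int_mean2 (fun z => h (phi z)) r <= ((2 * pi)^-1)%:E * sqint D0 (h \o psi))%E.
Proof.
move=> /polylim_ccv[Q [K [QK Qh]]] r01.
have r01' : 0 <= r < 1 by have /andP[/ltW -> ->] := r01.
have cl : (fun N => int_mean2 (fun z => (Q N).[phi z]) r) @ \oo -->
    int_mean2 (fun z => h (phi z)) r.
  apply: (@cvg_int_mean2 _ (fun N z => (Q N).[phi z]) (fun z => h (phi z)) r K).
  - by move=> N; apply: cmeas_horner; exact: cmeas_phi.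
  - by move=> t; apply: Qh; apply: ltW; exact: phi_lt1.
  - by move=> N t; apply: QK; apply: ltW; exact: phi_lt1.
have cr : (fun N => ((2 * pi)^-1)%:E * sqint D0 (fun t => (Q N).[psi t]))%E @ \oo -->
    (((2 * pi)^-1)%:E * sqint D0 (h \o psi))%E.
  apply: cvgeZl => //.
  apply: (@sqint_dominated _ _ (fun N t => (Q N).[psi t]) _ K) => //.
  - by move=> N; apply: cmeas_horner; exact: cmeas_boundary.
  - by move=> t Dt; apply: Qh; exact: cabs_boundary_le1.
  - by move=> N t Dt; apply: QK; exact: cabs_boundary_le1.
rewrite -(cvg_lim _ cl)// -(cvg_lim _ cr)//; apply: lee_lim.
- by apply/cvg_ex; eexists; exact: cl.
- by apply/cvg_ex; eexists; exact: cr.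
- by apply: nearW => N; exact: int_mean2_le_boundary.
Qed.

Lemma cmeas_polylim D f (h : C -> C) : polylim h -> cmeas D f ->
  (forall t, D t -> cabs (f t) <= 1) -> cmeas D (h \o f).
Proof.
move=> /polylim_ccv[Q [K [QK Qh]]] mf f1.
apply: (@cmeas_lim _ _ (fun N t => (Q N).[f t])).
  by move=> N; exact: cmeas_horner.
by move=> t Dt; apply: Qh; exact: f1.
Qed.

(** Where [|phi| <= r] the factor [|b|^2] is at most [s] and the rest is part of the norm of
    [p o phi]; where [|phi| > r] the bound [|b| <= 1] leaves the Carleson integral of [p]. *)
Lemma boundary_split (b : C -> C) (p : {poly C}) (r s : R) : polylim b ->
  (forall z, cabs z <= 1 -> cabs (b z) <= 1) -> 0 <= r -> 0 <= s ->
  (forall t, has_radial phi (expi t) -> cabs (psi t) <= r -> cabs (b (psi t)) ^+ 2 <= s) ->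
  (((2 * pi)^-1)%:E * sqint D0 ((fun z => (b z * p.[z])%R) \o psi) <=
   s%:E * H2norm2 (fun z => p.[phi z]) + mu_phi_r_int2 phi r (horner p))%E.
Proof.
move=> pb b1 r0 s0 bs; set F := (_ \o _).
(* The moduli are compared through their squares because squared moduli are known to be
   measurable. *)
pose A0 := D0 `&` [set t | cabs (psi t) ^+ 2 <= r ^+ 2].
pose A1 := D0 `&` [set t | r ^+ 2 < cabs (psi t) ^+ 2].
have mcabs := measurable_cabs2 cmeas_boundary.
have mA0 : measurable A0.
  rewrite (_ : A0 = D0 `&` (fun t => cabs (psi t) ^+ 2) @^-1` `]-oo, r ^+ 2]).
    by apply: mcabs.
  by apply/seteqP; split => t /=; rewrite in_itv.
have mA1 : measurable A1.
  rewrite (_ : A1 = D0 `&` (fun t => cabs (psi t) ^+ 2) @^-1` `]r ^+ 2, +oo[).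
    by apply: mcabs.
  by apply/seteqP; split => t; rewrite /A1 /= !in_itv/= ?andbT.
have DA : D0 = A0 `|` A1.
  apply/seteqP; split => [t Dt|t [[]|[]]//].
  by have [h|h] := leP (cabs (psi t) ^+ 2) (r ^+ 2); [left|right].
have mF : cmeas D0 F.
  apply: cmeas_polylim => //; last exact: cabs_boundary_le1.
    by apply: polylimM => //; exact: polylim_horner.
  exact: cmeas_boundary.
have -> : sqint D0 F = (sqint A0 F + sqint A1 F)%E.
  rewrite [in LHS]DA /sqint ge0_integral_setU//.
  - by rewrite -DA; exact: measurable_cabs2E.
  - by move=> t _; rewrite lee_fin sqr_ge0.
  - rewrite disj_set2E; apply/eqP/seteqP; split => // t /= [[_ h] [_]].
    by rewrite /= ltNge h.
rewrite ge0_muleDr ?sqint_ge0//; apply: leeD; last first.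
  (* The domain of [mu_phi_r_int2] includes every [t] with a radial limit, also those in the null
     set [B], and its measurability is not established; [le_sqint_subset] only asks for
     inclusion. *)
  rewrite lee_wpmul2l ?invtwopi_ge0//; apply: le_sqint_subset.
    move=> t [[ct nBt] /= h]; have [t2 ht] := hB ct nBt; split.
      by move: ct; rewrite /= !in_itv/= t2 => /andP[->].
    split=> //.
    by rewrite -(ltr_pXn2r (_ : 0 < 2)%N) ?nnegrE ?cabs_ge0.
  move=> t [Dt _]; have p1 := cabs_boundary_le1 Dt.
  by rewrite ext_f_horner// /F/= cabsM ler_piMl ?cabs_ge0// b1.
apply: (@le_trans _ _ (s%:E * (((2 * pi)^-1)%:E * sqint D0 (fun t => p.[psi t])))%E).
  rewrite muleCA lee_wpmul2l ?invtwopi_ge0//.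
  have mp : cmeas A0 (fun t => p.[psi t]).
    apply: cmeas_horner; apply: cmeas_sub cmeas_boundary; first exact: mD0.
    by move=> ? [].
  apply: (@le_trans _ _ (s%:E * sqint A0 (fun t => p.[psi t]))%E); last first.
    rewrite lee_wpmul2l ?lee_fin//; apply: le_sqint_subset => //.
    by move=> t [].
  rewrite /sqint -ge0_integralZl_EFin//; last 2 first.
  - by move=> t _; rewrite lee_fin sqr_ge0.
  - exact: measurable_cabs2E.
  apply: ge0_le_integral => //.
  - by move=> t _; rewrite lee_fin sqr_ge0.
  - by apply: measurable_cabs2E; apply: cmeas_sub mF => // t [].
  - by apply: measurable_funeM; exact: measurable_cabs2E.
  move=> t [[ct nBt] /= h]; rewrite -EFinM lee_fin /F/= cabsM exprMn ler_wpM2r ?sqr_ge0//.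
  apply: bs; first exact: (hB ct nBt).2.
  by rewrite -(ler_pXn2r (_ : 0 < 2)%N) ?nnegrE ?cabs_ge0.
by rewrite lee_wpmul2l ?lee_fin//; exact: boundary_le_H2norm2.
Qed.

End boundary.

Lemma H2norm2_comp_split (b : C -> C) (p : {poly C}) (r s : R) : polylim b ->
  (forall z, cabs z <= 1 -> cabs (b z) <= 1) -> 0 <= r -> 0 <= s ->
  (forall t, has_radial phi (expi t) -> cabs (bval phi (expi t)) <= r ->
     cabs (b (bval phi (expi t))) ^+ 2 <= s) ->
  (H2norm2 (fun z => (b (phi z) * p.[phi z])%R) <=
   s%:E * H2norm2 (fun z => p.[phi z]) + mu_phi_r_int2 phi r (horner p))%E.
Proof.
move=> pb b1 r0 s0 bs; have [B [mB B0 hB]] := selfmap_radial_limits.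
apply: H2norm2_le => rho rho01.
apply: le_trans (boundary_split mB B0 hB p pb b1 r0 s0 bs).
apply: (int_mean2_polylim_le_boundary mB B0 hB (h := fun z => b z * p.[z])) => //.
by apply: polylimM => //; exact: polylim_horner.
Qed.

End BoundaryValues.

(** * The upper bound *)

Section TaylorCoefficients.
Variable R : realType.
Local Notation C := R[i].

(** Carries functions to sequences, where the functionals of [decomposable] live. The chosen
    coefficients depend linearly on [f] because Taylor coefficients are unique. *)
Definition coef (f : C -> C) : nat -> C :=
  if pselect (analytic_D f) is left h then sval (cid h) else fun=> 0.

Lemma coefP f : analytic_D f -> taylor_on_D (coef f) f.
Proof. by rewrite /coef => fa; case: pselect => // h; case: (cid h). Qed.

Lemma coefD f g : analytic_D f -> analytic_D g ->
  coef (fun z => f z + g z) = fun k => coef f k + coef g k.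
Proof.
move=> fa ga; apply: (taylor_coef_unique (f := fun z => f z + g z)) => //.
  by apply: coefP; exact: analyticD.
by apply: taylorD; exact: coefP.
Qed.

Lemma coefZ c f : analytic_D f -> coef (fun z => c * f z) = fun k => c * coef f k.
Proof.
move=> fa; apply: (taylor_coef_unique (f := fun z => c * f z)) => //.
  by apply: coefP; exact: analyticZ.
by apply: taylorZ; exact: coefP.
Qed.

Lemma coef_l2_le f (M : R) : analytic_D f -> (H2norm2 f <= M%:E)%E -> l2_le (coef f) M.
Proof. by move=> fa; move/(H2norm2_leP _ (coefP fa)). Qed.

Lemma coef_l2 f : inH2 f -> l2 (coef f).
Proof.
move=> [fa f2]; exists (fine (H2norm2 f)); apply: coef_l2_le => //.
by rewrite fineK// ge0_fin_numE// H2norm2_ge0.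
Qed.

Lemma taylor_horner (p : {poly C}) : taylor_on_D (fun k => p`_k) (horner p).
Proof.
move=> z _; apply: (@ccv_near R nat \oo _ (fun=> p.[z])); last exact: ccv_cst.
by exists (size p) => // N /= pN; rewrite (horner_coef_wide _ pN).
Qed.

Definition trunc (a : nat -> C) N : {poly C} := \poly_(k < N) a k.

Lemma trunc_H2norm2 (a : nat -> C) (M : R) N : l2_le a M ->
  (H2norm2 (horner (trunc a N)) <= M%:E)%E.
Proof.
move=> aM; apply/(H2norm2_leP _ (taylor_horner _)) => m.
apply: le_trans (aM m); apply: ler_sum => k _; rewrite coef_poly.
by case: ifP => // _; rewrite cabs0 expr0n/= sqr_ge0.
Qed.

Lemma inH2_horner (p : {poly C}) : inH2 (horner p).
Proof.
split; first by eexists; exact: taylor_horner.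
apply: (@le_lt_trans _ _ (\sum_(k < size p) cabs p`_k ^+ 2)%:E); last exact: ltry.
apply/(H2norm2_leP _ (taylor_horner _)) => N.
have [Np|pN] := leqP N (size p).
  rewrite -(subnKC Np) big_split_ord/= lerDl sumr_ge0// => i _.
  by rewrite sqr_ge0.
rewrite -(subnKC (ltnW pN)) big_split_ord/= [X in _ + X]big1 ?addr0// => i _.
by rewrite nth_default ?cabs0 ?expr0n// leq_addr.
Qed.

Lemma ccv_trunc (a : nat -> C) f z : taylor_on_D a f -> inD z ->
  ccv \oo (fun N => (trunc a N).[z]) (f z).
Proof.
by move=> af zD; apply: (ccv_ext _ (af _ zD)) => N; rewrite horner_poly.
Qed.

Lemma int_mean2_fatou (f : nat -> C -> C) (g : C -> C) (r : R) (V : \bar R) :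
  (forall n, cmeas (`[0, 2 * pi]%classic : set R) (fun t => f n (rsc r (expi t)))) ->
  (forall t, ccv \oo (fun n => f n (rsc r (expi t))) (g (rsc r (expi t)))) ->
  (forall n, (int_mean2 (f n) r <= V)%E) -> (int_mean2 g r <= V)%E.
Proof.
move=> mf fg fV.
have e (x : \bar R) : (((2 * pi)^-1)%:E * ((2 * pi)%:E * x) = x)%E.
  by rewrite muleA -EFinM mulVf ?mul1e// gt_eqF// twopi_gt0.
have e' (x : \bar R) : ((2 * pi)%:E * (((2 * pi)^-1)%:E * x) = x)%E.
  by rewrite muleA -EFinM mulfV ?mul1e// gt_eqF// twopi_gt0.
rewrite -(e V) int_mean2E lee_wpmul2l ?invtwopi_ge0//.
apply: (@sqint_fatou _ _ (fun n t => f n (rsc r (expi t)))) => // n.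
rewrite -(e' (sqint _ _)) lee_wpmul2l//; last exact: fV.
by rewrite lee_fin ltW// twopi_gt0.
Qed.

End TaylorCoefficients.

Section UpperBound.
Variables (R : realType) (phi : R[i] -> R[i]).
Hypothesis phiD : selfmap_D phi.
Local Notation C := R[i].

Definition opnorm2 (T : Op R) : \bar R :=
  ereal_sup [set H2norm2 (T f) | f in [set f | inH2 f /\ (H2norm2 f <= 1)%E]].

Lemma opnorm2_ge0 T : (0 <= opnorm2 T)%E.
Proof.
apply: le_trans (H2norm2_ge0 (T (horner 0))) _; apply: ereal_sup_ubound.
exists (horner 0) => //; split; first exact: inH2_horner.
apply/(H2norm2_leP _ (taylor_horner _)) => N; rewrite big1// => k _.
by rewrite coef0 cabs0 expr0n.
Qed.

Lemma opnorm_sqr T : (opnorm T * opnorm T)%E = opnorm2 T.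
Proof. by rewrite -expe2 sqr_sqrte// opnorm2_ge0. Qed.

(** Here the polynomial in [H2norm2_comp_split] becomes a general function of norm at most 1: its
    truncations obey the bound with the same constants, and Fatou on each circle transfers it to the
    limit. *)
Lemma upper_bound_carleson (B : C -> C) (b : nat -> C) (r s K : R) : polylim B ->
  (forall z, cabs z <= 1 -> cabs (B z) <= 1) -> 0 <= r -> 0 <= s -> 0 <= K ->
  (forall t, has_radial phi (expi t) -> cabs (bval phi (expi t)) <= r ->
     cabs (B (bval phi (expi t))) ^+ 2 <= s) ->
  (forall f, inH2 f -> (mu_phi_r_int2 phi r f <= K%:E * H2norm2 f)%E) ->
  l2_le b 1 ->
  (H2norm2 (fun z => (B (phi z) * evs b (phi z))%R) <=
     s%:E * opnorm2 (Cop phi) + K%:E)%E.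
Proof.
move=> pB B1 r0 s0 K0 Bs hK b1; have lb : l2 b by exists 1.
apply: H2norm2_le => rho rho01; have rho01' : 0 <= rho < 1.
  by have /andP[/ltW -> ->] := rho01.
have phiDt t : inD (phi (rsc rho (expi t))) by apply: phiD.2; exact: inD_rsc_expi.
have mphi : cmeas (`[0, 2 * pi]%classic : set R) (fun t => phi (rsc rho (expi t))).
  by have [[a ta] _] := phiD; exact: cmeas_taylor ta.
apply: (@int_mean2_fatou _ (fun N z => B (phi z) * (trunc b N).[phi z])).
- move=> N; apply: cmeasM; last exact: cmeas_horner.
  by apply: (cmeas_polylim pB mphi) => t _; apply: ltW; exact: phiDt.
- move=> t; apply: ccvM; first exact: ccv_cst.
  by apply: ccv_trunc => //; exact: taylor_l2.
move=> N; apply: le_trans (int_mean2_le_H2norm2 _ rho01) _.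
apply: le_trans (H2norm2_comp_split phiD (trunc b N) pB B1 r0 s0 Bs) _.
have tN := trunc_H2norm2 N b1.
apply: leeD.
  rewrite lee_wpmul2l ?lee_fin//; apply: ereal_sup_ubound.
  by exists (horner (trunc b N)) => //; split => //; exact: inH2_horner.
apply: le_trans (hK _ (inH2_horner _)) _; rewrite -[leRHS]mule1.
by rewrite lee_wpmul2l ?lee_fin.
Qed.

(** The adjoined 0 gives the supremum over an empty set the value 0 instead of [-oo]. Since
    [|B| <= 1] on the closed disc, the supremum is also at most 1, hence a real number. *)
Lemma approx_num_upper_bound (n : nat) (B : C -> C) (r : R) :
  is_blaschke n.-1 B -> 0 < r < 1 ->
  (approx_num n (Cop phi) <=
   sqrte (ereal_sup ([set 0%E] `|`
            [set ((cabs (B (bval phi (expi t)))) ^+ 2)%R%:E | t in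
               [set t : R | has_radial phi (expi t) /\
                            (cabs (bval phi (expi t)) <= r)%R]])
          * (opnorm (Cop phi) * opnorm (Cop phi))
          + carleson_norm (mu_phi_r_int2 phi r)))%E.
Proof.
move=> [m [w [dn [hw BE]]]] /andP[r0 r1].
have B1 z : cabs z <= 1 -> cabs (B z) <= 1 by rewrite BE; exact: cabs_blaschke_le1.
have pB : polylim B by rewrite BE; exact: polylim_blaschke.
have [c [e [cl pe dec]]] : decomposable n.-1 B.
  by rewrite BE -dn; exact: decomposable_blaschke.
set S := ereal_sup _; rewrite opnorm_sqr.
have S0 : (0 <= S)%E by apply: ereal_sup_ubound; left.
have S1 : (S <= 1)%E.
  apply: ge_ereal_sup => _ [->|[t [ht tr] <-]]; first exact: lee01.
  by rewrite lee_fin exprn_ile1 ?cabs_ge0// B1// (le_trans tr)// ltW.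
have Sfin : S \is a fin_num by rewrite ge0_fin_numE// (le_lt_trans S1)// ltry.
pose s := fine S; have Ss : S = s%:E by rewrite fineK.
have s0 : 0 <= s by rewrite -lee_fin -Ss.
have Bs t : has_radial phi (expi t) -> cabs (bval phi (expi t)) <= r ->
    cabs (B (bval phi (expi t))) ^+ 2 <= s.
  move=> ht tr; rewrite -lee_fin -Ss; apply: ereal_sup_ubound.
  by right; exists t.
(* The part of the decomposition outside the range of [B], composed with [phi]: it has [n.-1] terms,
   and subtracting it from [f o phi] leaves [(B o phi) (g o phi)]. *)
pose Rk : Op R := fun f z => \sum_(i < n.-1) c i (coef f) * e i (phi z).
have rkRk : rank_lt n Rk.
  split; [|split].
  - move=> f g fH gH z zD; rewrite /Rk -big_split/=; apply: eq_bigr => i _.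
    rewrite coefD ?(cl i).1 -?mulrDl//; first [exact: coef_l2|exact: fH.1|exact: gH.1].
  - move=> x f fH z zD; rewrite /Rk mulr_sumr; apply: eq_bigr => i _.
    rewrite coefZ ?(cl i).2 -?mulrA//; first [exact: coef_l2|exact: fH.1].
  - exists (fun i z => e i (phi z)); split; first by move=> i; exact: inH2_polylim.
    by move=> f fH; exists (fun i => c i (coef f)).
apply: (@le_trans _ _ (opnorm (fun f z => Cop phi f z - Rk f z))).
  by apply: ereal_inf_lbound; exists Rk.
have car0 : (0 <= carleson_norm (mu_phi_r_int2 phi r))%E.
  by apply: le_ereal_inf_tmp => _ [K [K0 _] <-]; rewrite lee_fin.
have Sop0 : (0 <= S * opnorm2 (Cop phi))%E by rewrite mule_ge0// opnorm2_ge0.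
rewrite /opnorm lee_sqrt ?adde_ge0//; apply: ge_ereal_sup => _ [f [fH f1] <-].
have fa := fH.1; have a1 := coef_l2_le fa f1.
have [b b1 hb] := dec _ _ a1.
rewrite (@eq_H2norm2 _ _ (fun z => B (phi z) * evs b (phi z))); last first.
  move=> z zD; congr cabs; have pz : inD (phi z) by exact: phiD.2.
  rewrite /Cop/= (taylor_unique (coefP fa) (taylor_l2 (coef_l2 fH)) pz) hb//.
  by rewrite /Rk addrAC subrr add0r.
(* The estimate is proved for every admissible Carleson constant [K]; the infimum over [K] comes
   last, which also covers the case that there is none. *)
have main K : 0 <= K ->
    (forall g, inH2 g -> (mu_phi_r_int2 phi r g <= K%:E * H2norm2 g)%E) ->
    (H2norm2 (fun z => (B (phi z) * evs b (phi z))%R) <=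
       S * opnorm2 (Cop phi) + K%:E)%E.
  by move=> K0 hK; rewrite Ss; apply: (upper_bound_carleson pB B1 (ltW r0)).
(* Moving the product to the other side requires it to be finite; if it is infinite, the right-hand
   side is [+oo], as the Carleson norm is nonnegative. *)
have [Sfin'|] := boolP ((S * opnorm2 (Cop phi))%E \is a fin_num).
  rewrite -leeBlDl//; apply: le_ereal_inf_tmp => _ [K [K0 hK] <-].
  by rewrite leeBlDl//; exact: main.
rewrite ge0_fin_numE// -leNgt leye_eq => /eqP ->.
by rewrite addye ?leey// gt_eqF// (lt_le_trans _ car0)// ltNy0.
Qed.

End UpperBound.

(** * The lower bound *)

Section LowerBound.
Variables (R : realType) (phi : R[i] -> R[i]) (n : nat).
Hypothesis phiD : selfmap_D phi.
Hypothesis n0 : (0 < n)%N.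
Local Notation C := R[i].

(** The origin is separate because [eval_l2_le] rests on division by powers of the point; there the
    value is the coefficient of index 0. *)
Lemma H2_eval_le (f : C -> C) (M : R) w : inH2 f -> inD w ->
  (H2norm2 f <= M%:E)%E -> (1 - cabs w ^+ 2) * cabs (f w) ^+ 2 <= M.
Proof.
move=> fH wD fM; have aM := coef_l2_le fH.1 fM.
have fE := taylor_unique (coefP fH.1) (taylor_l2 (coef_l2 fH)) wD.
have [w0|w0] := eqVneq w 0; last by rewrite fE; exact: eval_l2_le.
rewrite w0 cabs0 expr0n/= subr0 mul1r.
have c0 : ccv \oo (psum (coef f) 0) (coef f 0%N).
  apply: (@ccv_near R nat \oo _ (fun=> coef f 0%N)); last exact: ccv_cst.
  exists 1%N => // -[//|N] _ /=; rewrite /psum big_ord_recl big1 ?addr0 ?expr0 ?mulr1//.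
  by move=> i _; rewrite lift0 expr0n mulr0.
have D0 : inD (0 : C) by rewrite -w0.
have -> := ccv_unique (coefP fH.1 D0) c0.
by have := aM 1%N; rewrite big_ord1.
Qed.

(** Homogeneity: [p] is divided by the square root of [V] to enter the unit ball, which is why [V]
    is positive, and the factor is restored afterwards. *)
Lemma opnorm2_scale (T : Op R) (p : {poly C}) (o V : R) :
  (forall p, analytic_D (T (horner p))) ->
  (forall c p z, inD z -> T (horner (c *: p)) z = c * T (horner p) z) ->
  (opnorm2 T <= (o ^+ 2)%:E)%E -> 0 < V -> (H2norm2 (horner p) <= V%:E)%E ->
  (H2norm2 (T (horner p)) <= (o ^+ 2 * V)%:E)%E.
Proof.
move=> Ta TZ To V0 pV; pose s := Num.sqrt V.
have s0 : 0 < s by rewrite sqrtr_gt0.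
have s2 : s ^+ 2 = V by rewrite sqr_sqrtr// ltW.
have sC x : cabs (Complex x 0 : C) ^+ 2 = x ^+ 2.
  by rewrite cabs_real real_normK ?num_real.
pose q := Complex s^-1 0 *: p.
have q1 : (H2norm2 (horner q) <= 1%:E)%E.
  rewrite (_ : horner q = fun w => Complex s^-1 0 * p.[w]); last first.
    by apply/funext => w; rewrite hornerZ.
  apply: le_trans (H2norm2Z_le (Complex s^-1 0) (inH2_horner p).1 pV) _.
  by rewrite lee_fin sC -s2 exprVn mulVf// expf_neq0// gt_eqF.
have h1 : (H2norm2 (T (horner q)) <= (o ^+ 2)%:E)%E.
  apply: le_trans To; apply: ereal_sup_ubound; exists (horner q) => //.
  by split => //; exact: inH2_horner.
have := H2norm2Z_le (Complex s 0) (Ta q) h1; rewrite sC s2 mulrC.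
apply: le_trans; rewrite le_eqVlt; apply/orP; left; apply/eqP.
apply: eq_H2norm2 => z zD; congr cabs; rewrite TZ//.
rewrite mulrA (_ : Complex s 0 * Complex s^-1 0 = 1) ?mul1r//.
apply: complex_ext; rewrite ?cReM ?cImM/=; last by ring.
by rewrite mulr0 subr0 mulfV// gt_eqF.
Qed.

Variable Z : 'I_n -> C.
Hypothesis ZD : forall j, inD (Z j).

Local Notation W := (phi \o Z).

Let WD j : inD (W j). Proof. by apply: phiD.2; exact: ZD. Qed.

Let dZ j : 0 < 1 - cabs (Z j) ^+ 2.
Proof. by rewrite subr_gt0 expr_lt1// ?cabs_ge0//; exact: ZD. Qed.

Let dW j : 0 < 1 - cabs (W j) ^+ 2.
Proof. by rewrite subr_gt0 expr_lt1// ?cabs_ge0//; exact: WD. Qed.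

#[local] Hint Extern 0 (is_true (0 < 1 - _)) =>
  solve [exact: dZ | exact: dW] : core.

(** The constants whose infimum is [interp_const (phi \o Z)]. *)
Definition interpolates (c : R) : Prop := 0 <= c /\
  forall a : 'I_n -> C, exists f, inH2 f /\ (forall j, f (W j) = a j) /\
    (H2norm2 f <= (c ^+ 2 * \sum_(j < n) cabs (a j) ^+ 2 * (1 - cabs (W j) ^+ 2))%:E)%E.

(** For data 1 at one point and 0 elsewhere, point evaluation bounds the norm of any solution from
    below by the weight of that point. This keeps the constant of interpolation away from 0, whose
    inverse is [+oo]. *)
Lemma interpolates_ge1 c : interpolates c -> 1 <= c.
Proof.
move=> [c0 hc]; have [j0 _] : exists j : 'I_n, true by exists (Ordinal n0).
have [f [fH [fa f2]]] := hc (fun j => if j == j0 then 1 else 0).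
have := H2_eval_le fH (WD j0) f2; rewrite fa /= eqxx cabs1 expr1n mulr1.
rewrite (bigD1 j0)//= eqxx cabs1 expr1n mul1r big1 ?addr0 => [h|j /negbTE ->].
  by move: h; rewrite ler_pMl ?(dW j0)// expr_ge1.
by rewrite cabs0 expr0n mul0r.
Qed.

(** The values of [n.-1] functions at [n] points form a matrix with more rows than columns, so its
    left kernel is nonzero. *)
Lemma exists_annihilator (g : 'I_n.-1 -> C -> C) : exists v : 'I_n -> C,
  (exists j, v j != 0) /\ forall i, \sum_(j < n) v j * g i (Z j) = 0.
Proof.
pose A : 'M[C]_(n, n.-1) := \matrix_(j, i) g i (Z j).
have /rowV0Pn[v /sub_kermxP vA v0] : kermx A != 0.
  rewrite -mxrank_eq0 mxrank_ker subn_eq0 -ltnNge.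
  by rewrite (leq_ltn_trans (rank_leq_col A))// prednK.
exists (fun j => v 0 j); split.
  by have /rV0Pn[j vj] := v0; exists j.
move=> i; have := congr1 (fun M : 'rV_n.-1 => M 0 i) vA; rewrite !mxE => e; rewrite -[RHS]e.
by apply: eq_bigr => j _; rewrite mxE.
Qed.

(* Choosing [a_j = conj v_j / (1 - |w_j|^2)] for the interpolation data turns the
   pairing [sum_j v_j a_j] into the weighted norm [Q] of [v], so that no linearity
   of the interpolating function in the data is required. *)
Lemma lower_bound_core (Rk : Op R) (c k o q : R) : rank_lt n Rk ->
  interpolates c -> 0 <= k ->
  (forall f, inH2 f -> (upsilon_int2 Z f <= k%:E * H2norm2 f)%E) ->
  (opnorm2 (fun f z => (Cop phi f z - Rk f z)%R) <= (o ^+ 2)%:E)%E -> 0 < q ->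
  (forall j, q <= Num.sqrt ((1 - cabs (Z j) ^+ 2) / (1 - cabs (W j) ^+ 2))) ->
  q ^+ 2 <= k * (o ^+ 2 * c ^+ 2).
Proof.
move=> [RD [RZ [g [gH Rg]]]] /[dup] /interpolates_ge1 c1 [c0 hc] k0 hk ho q0 hq.
have [v [[j0 vj0] vg]] := exists_annihilator g.
pose a j := conjc (v j) / Complex (1 - cabs (W j) ^+ 2) 0.
(* [Q] is the weighted norm adapted to interpolation at the images, [P] the one dual to the Carleson
   measure at the points [Z]; the lower bound [q] on the ratios compares them. *)
pose Q := \sum_(j < n) cabs (v j) ^+ 2 / (1 - cabs (W j) ^+ 2).
pose P := \sum_(j < n) cabs (v j) ^+ 2 / (1 - cabs (Z j) ^+ 2).
have Q0 : 0 < Q.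
  rewrite /Q (bigD1 j0)//= ltr_wpDr//.
    by rewrite sumr_ge0// => j _; rewrite divr_ge0 ?sqr_ge0// ltW.
  by rewrite divr_gt0// exprn_gt0// cabs_gt0.
have QP : q ^+ 2 * P <= Q.
  rewrite /P /Q mulr_sumr ler_sum// => j _; rewrite mulrCA ler_wpM2l ?sqr_ge0//.
  rewrite ler_pdivrMr// mulrC -[leRHS]/(_ / _).
  have rj : 0 <= (1 - cabs (Z j) ^+ 2) / (1 - cabs (W j) ^+ 2).
    by rewrite divr_ge0// ltW.
  rewrite -(sqr_sqrtr rj) lerXn2r ?nnegrE ?sqrtr_ge0 ?hq//.
  exact: ltW.
have [f [fH [fa f2]]] := hc a.
have fV : (H2norm2 f <= (c ^+ 2 * Q)%:E)%E.
  apply: le_trans f2 _; rewrite lee_fin ler_wpM2l ?sqr_ge0// ler_sum// => j _.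
  rewrite /a cabsM cabsV cabs_conjc cabs_real (gtr0_norm (dW j)) exprMn.
  by rewrite -mulrA ler_wpM2l ?sqr_ge0// expr2 -mulrA mulVf ?mulr1// gt_eqF.
have V0 : 0 < c ^+ 2 * Q by rewrite mulr_gt0// exprn_gt0// (lt_le_trans ltr01).
have va : \sum_(j < n) v j * f (W j) = Complex Q 0.
  rewrite (eq_bigr (fun j => Complex (cabs (v j) ^+ 2 / (1 - cabs (W j) ^+ 2)) 0)).
    apply: complex_ext; rewrite ?Re_sum ?Im_sum//=.
    by rewrite big1.
  move=> j _; rewrite fa /a mulrA mul_conjc.
  have dj : Complex (1 - cabs (W j) ^+ 2) 0 != 0 :> C.
    by rewrite -cabs_gt0 cabs_real normr_gt0 gt_eqF.
  apply: (mulIf dj); rewrite divfK//.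
  by apply: complex_ext; rewrite ?cReM ?cImM/= ?divfK ?gt_eqF//; ring.
pose T : Op R := fun f z => Cop phi f z - Rk f z.
have Ta p : analytic_D (T (horner p)).
  have [x hx] := Rg _ (inH2_horner p).
  have : analytic_D (fun z => p.[phi z] + -1 * \sum_(i < n.-1) x i * g i z).
    apply: analyticD; first by apply: analytic_horner; exact: phiD.1.
    apply: analyticZ; apply: analytic_sum => i; apply: analyticZ.
    exact: (gH i).1.
  by move=> [b tb]; exists b; apply: taylor_eq tb => z zD; rewrite /T hx// mulN1r.
have TZ x p z : inD z -> T (horner (x *: p)) z = x * T (horner p) z.
  move=> zD; rewrite /T /Cop/= hornerZ mulrBr -RZ//; last exact: inH2_horner.
  by congr (_ - Rk _ _); apply/funext => w; rewrite hornerZ.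
(* From here on [f] is replaced by its Taylor polynomials: [T] of a polynomial is analytic with a
   norm bound, hence admissible in the Carleson inequality. *)
pose p N := trunc (coef f) N.
have pV N : (H2norm2 (horner (p N)) <= (c ^+ 2 * Q)%:E)%E.
  by apply: trunc_H2norm2; exact: coef_l2_le fH.1 fV.
have Tp N := opnorm2_scale Ta TZ ho V0 (pV N).
pose E := k * (o ^+ 2 * (c ^+ 2 * Q)).
have TE N : \sum_(j < n) (1 - cabs (Z j) ^+ 2) * cabs (T (horner (p N)) (Z j)) ^+ 2 <= E.
  rewrite -lee_fin; apply: le_trans (hk _ _) _.
    by split; [exact: Ta|apply: le_lt_trans (Tp N) _; exact: ltry].
  by rewrite /E EFinM lee_wpmul2l ?lee_fin.
have vT N : \sum_(j < n) v j * T (horner (p N)) (Z j) = \sum_(j < n) v j * (p N).[W j].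
  have [x hx] := Rg _ (inH2_horner (p N)).
  under eq_bigr => j _ do rewrite /T hx//= mulrBr.
  rewrite sumrB -[RHS]subr0; congr (_ - _).
  under eq_bigr => j _ do rewrite mulr_sumr.
  rewrite exchange_big big1//= => i _.
  rewrite (eq_bigr (fun j => x i * (v j * g i (Z j)))); last by move=> j _; ring.
  by rewrite -mulr_sumr vg mulr0.
(* Termwise [x y <= (q^2 / 2) x^2 / d + d y^2 / (2 q^2)] with [d = 1 - |z_j|^2]. The weight [q^2] is
   chosen so that the first sum is at most [Q / 2]. *)
have bound N : cabs (\sum_(j < n) v j * (p N).[W j]) <=
    q ^+ 2 / 2 * P + (2 * q ^+ 2)^-1 * E.
  rewrite -vT (le_trans (cabs_sum _ _ _))//.
  apply: (@le_trans _ _ (\sum_(j < n) (q ^+ 2 / 2 * (cabs (v j) ^+ 2 / (1 - cabs (Z j) ^+ 2))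
     + (2 * q ^+ 2)^-1 * ((1 - cabs (Z j) ^+ 2) * cabs (T (horner (p N)) (Z j)) ^+ 2)))).
    apply: ler_sum => j _; rewrite cabsM.
    move: (dZ j) (cabs (v j)) (cabs (T _ _)); move: (1 - _) => d d0 x y.
    have q20 : 0 < q ^+ 2 by rewrite exprn_gt0.
    rewrite -subr_ge0 (_ : _ - _ = (q ^+ 2 * x - d * y) ^+ 2 / (2 * q ^+ 2 * d)).
      by rewrite divr_ge0 ?sqr_ge0// !mulr_ge0// ltW.
    by field; rewrite !gt_eqF.
  rewrite big_split/= -!mulr_sumr lerD2l ler_wpM2l//.
  by rewrite invr_ge0 mulr_ge0// exprn_ge0// ltW.
have Qle : Q <= q ^+ 2 / 2 * P + (2 * q ^+ 2)^-1 * E.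
  have cl : (fun N => cabs (\sum_(j < n) v j * (p N).[W j])) @ \oo --> Q.
    rewrite -[X in _ --> X]gtr0_norm// -cabs_real -va; apply: ccv_cabs.
    apply: ccv_sum => j; apply: ccvM; first exact: ccv_cst.
    by apply: ccv_trunc => //; apply: coefP; exact: fH.1.
  rewrite -(cvg_lim _ cl)//; apply: limr_le; first by apply/cvg_ex; eexists; exact: cl.
  by apply: nearW => N; exact: bound.
have q20 : 0 < q ^+ 2 by rewrite exprn_gt0.
(* Half of [Q] absorbs the term in [P]. Since [E] contains the factor [Q], dividing by it leaves a
   bound independent of [v]. *)
have : Q / 2 <= (2 * q ^+ 2)^-1 * E by move: QP Qle; lra.
rewrite ler_pdivlMl ?mulr_gt0// /E => h.
rewrite -(ler_pM2r Q0).
by apply: le_trans (le_trans h _); rewrite le_eqVlt; apply/orP; left; apply/eqP; field.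
Qed.

(** [lower_bound_core] holds for all admissible [c] and [k]; infima are taken over [k], then over
    [c]. An infinite constant has inverse 0, so the bound is then trivial, whereas a vanishing
    constant would have inverse [+oo] and must be excluded. *)
Lemma approx_num_lower_bound :
  ((interp_const (phi \o Z))^-1 * (sqrte (carleson_norm (upsilon_int2 Z)))^-1
   * ereal_inf [set (Num.sqrt ((1 - cabs (Z j) ^+ 2) /
                               (1 - cabs (phi (Z j)) ^+ 2)))%R%:E | j in [set: 'I_n]]
   <= approx_num n (Cop phi))%E.
Proof.
apply: le_ereal_inf_tmp => _ [Rk rk <-].
set T : Op R := fun f z => _; set I := ereal_inf _.
set M := interp_const _; set K := carleson_norm _.
have oT0 : (0 <= opnorm T)%E by exact: sqrte_ge0.
have [ofin|] := boolP (opnorm T \is a fin_num); last first.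
  by rewrite ge0_fin_numE// -leNgt leye_eq => /eqP ->; rewrite leey.
pose o := fine (opnorm T); have oE : opnorm T = o%:E by rewrite fineK.
have o0 : 0 <= o by rewrite -lee_fin -oE.
have To : (opnorm2 T <= (o ^+ 2)%:E)%E by rewrite -opnorm_sqr oE -EFinM expr2.
have I0 : (0 <= I)%E.
  by apply: le_ereal_inf_tmp => _ [j _ <-]; rewrite lee_fin sqrtr_ge0.
have Ile j : (I <= (Num.sqrt ((1 - cabs (Z j) ^+ 2) / (1 - cabs (W j) ^+ 2)))%:E)%E.
  by apply: ereal_inf_lbound; exists j.
have Ifin : I \is a fin_num.
  by rewrite ge0_fin_numE// (le_lt_trans (Ile (Ordinal n0)))// ltry.
pose q := fine I; have qE : I = q%:E by rewrite fineK.
have q_ge0 : 0 <= q by rewrite -lee_fin -qE.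
have [q0|q_neq0] := eqVneq q 0; first by rewrite qE q0 mule0.
have q0 : 0 < q by rewrite lt_def q_neq0.
have hq j : q <= Num.sqrt ((1 - cabs (Z j) ^+ 2) / (1 - cabs (W j) ^+ 2)).
  by rewrite -lee_fin -qE.
have core c k (hc : interpolates c) (k0 : 0 <= k) hk :=
  @lower_bound_core Rk c k o q rk hc k0 hk To q0 hq.
have M1 : (1 <= M)%E.
  by apply: le_ereal_inf_tmp => _ [c hc <-]; rewrite lee_fin; exact: interpolates_ge1 hc.
have K0 : (0 <= K)%E.
  by apply: le_ereal_inf_tmp => _ [k [k0 _] <-]; rewrite lee_fin.
have [Mfin|] := boolP (M \is a fin_num); last first.
  rewrite ge0_fin_numE ?(le_trans lee01)// -leNgt leye_eq => /eqP ->.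
  by rewrite invey !mul0e.
have [Kfin|] := boolP (K \is a fin_num); last first.
  rewrite ge0_fin_numE// -leNgt leye_eq => /eqP ->.
  by rewrite /sqrte invey mule0 mul0e.
pose m := fine M; have mE : M = m%:E by rewrite fineK.
pose kap := fine K; have kE : K = kap%:E by rewrite fineK.
have m1 : 1 <= m by rewrite -lee_fin -mE.
have kap0 : 0 <= kap by rewrite -lee_fin -kE.
(* Infimum over [k] for fixed [c]. If [o] were 0, one could not divide, but then any admissible [k]
   would already force [q^2 <= 0]. *)
have stepK c : interpolates c -> q ^+ 2 <= kap * (o ^+ 2 * c ^+ 2).
  move=> hc; have c1 := interpolates_ge1 hc.
  have [ oz|oz] := eqVneq o 0.
    have [k [k0 hk]] : exists k, 0 <= k /\ forall f, inH2 f ->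
        (upsilon_int2 Z f <= k%:E * H2norm2 f)%E.
      apply: contrapT => nk; move: Kfin; rewrite /K /carleson_norm.
      rewrite (_ : [set K%:E | K in _] = set0) ?ereal_inf0//.
      by apply/seteqP; split => // x [k hk <-]; apply: nk; exists k.
    have := core c k hc k0 hk; rewrite oz expr0n/= mul0r mulr0.
    by rewrite leNgt exprn_gt0.
  have o_gt0 : 0 < o by rewrite lt_def oz.
  have c_gt0 : 0 < c by exact: lt_le_trans ltr01 c1.
  have oc : 0 < o ^+ 2 * c ^+ 2 by rewrite mulr_gt0// exprn_gt0.
  rewrite -ler_pdivrMr// -lee_fin -kE; apply: le_ereal_inf_tmp => _ [k [k0 hk] <-].
  by rewrite lee_fin ler_pdivrMr//; exact: core.
have [c0 hc0] : exists c, interpolates c.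
  apply: contrapT => nc; move: Mfin; rewrite /M /interp_const.
  rewrite (_ : [set c%:E | c in _] = set0) ?ereal_inf0//.
  by apply/seteqP; split => // x [c hc <-]; apply: nc; exists c.
pose sk := Num.sqrt kap; have sk2 : sk ^+ 2 = kap by rewrite sqr_sqrtr.
have sk0 : 0 <= sk by exact: sqrtr_ge0.
have lin c : interpolates c -> q <= sk * o * c.
  move=> hc; have c1 := interpolates_ge1 hc.
  rewrite -(ler_pXn2r (_ : 0 < 2)%N) ?nnegrE ?(ltW q0)//; last first.
    by rewrite !mulr_ge0// (le_trans ler01).
  by rewrite !exprMn sk2 -mulrA; exact: stepK.
(* As [q] is positive, neither factor can vanish; this excludes a zero Carleson norm. *)
have so0 : 0 < sk * o.
  rewrite lt_def mulr_ge0// andbT; apply/eqP => so.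
  by have := lin _ hc0; rewrite so mul0r leNgt q0.
have sk_gt0 : 0 < sk.
  by rewrite lt_def sk0 andbT; apply: contraTneq so0 => ->; rewrite mul0r ltxx.
have mlin : q <= sk * o * m.
  rewrite mulrC -ler_pdivrMr// -lee_fin -mE; apply: le_ereal_inf_tmp => _ [c hc <-].
  by rewrite lee_fin ler_pdivrMr// mulrC; exact: lin.
have m0 : 0 < m by rewrite (lt_le_trans ltr01).
rewrite mE kE qE oE /= -/sk !inver !gt_eqF//.
rewrite -!EFinM lee_fin -invfM ler_pdivrMl ?mulr_gt0//.
by move: mlin; lra.
Qed.

End LowerBound.

Theorem theorem3p1 (R : realType) (phi : R[i] -> R[i]) (n : nat) :
  selfmap_D phi -> (0 < n)%N ->
  (* (a) *)
  (forall (B : R[i] -> R[i]) (r : R), is_blaschke n.-1 B -> 0 < r < 1 ->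
     (approx_num n (Cop phi) <=
      sqrte (ereal_sup ([set 0%E] `|`
               [set ((cabs (B (bval phi (expi t)))) ^+ 2)%R%:E | t in
                  [set t : R | has_radial phi (expi t) /\
                               (cabs (bval phi (expi t)) <= r)%R]])
             * (opnorm (Cop phi) * opnorm (Cop phi))
             + carleson_norm (mu_phi_r_int2 phi r)))%E) /\
  (* (b) *)
  (forall Z : 'I_n -> R[i], (forall j, inD (Z j)) -> injective Z ->
     injective (phi \o Z) ->
     ((interp_const (phi \o Z))^-1 * (sqrte (carleson_norm (upsilon_int2 Z)))^-1
      * ereal_inf [set (Num.sqrt ((1 - cabs (Z j) ^+ 2) /
                                  (1 - cabs (phi (Z j)) ^+ 2)))%R%:E | j in [set: 'I_n]]
      <= approx_num n (Cop phi))%E).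
Proof.
move=> phiD n0; split=> [B r HB r01|Z ZD _ _].
  exact: approx_num_upper_bound.
exact: approx_num_lower_bound.
Qed.
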